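(* Let $M$ be a countable set with at least $3$ elements, let $\Gamma \curvearrowright M$ be a transitive permutation group and let $\mathbf{M}$ be an ultrahomogeneous, relational structure for $\Gamma$ with universe $M$ (i.e., $\mathrm{Aut}(\mathbf{M})=\Gamma$). Then $$\mathcal{S}_{\mathcal{K}(\Gamma)}(W) \cong \{p \in \mathrm{S}_1(\overline{\mathcal{K}}(\mathbf{M})) : \forall x, y \in X \ \ p(v) \models \neg B(x, v, y)\},$$ with the action of $\mathcal{K}(\Gamma)$ on the right-hand side given by permuting the parameters. The highly proximal factor map $\pi \colon \mathcal{S}_{\mathcal{K}(\Gamma)}(W) \to W$ is given by $$\pi(p) = \zeta \iff \forall x \in X \setminus \{\zeta\} \ \ p(v) \models \Phi(x, v) = \Phi(x, \zeta).$$
   Context: Permutation groups. A permutation group $\Gamma \curvearrowright M$ is a closed subgroup of $\mathrm{Sym}(M)$ with the pointwise convergence topology. ''Countable'' means finite or countably infinite; $n=|M|\in\{3,4,\ldots,\infty\}$. A structure is ultrahomogeneous if every isomorphism between finitely generated substructures extends to an automorphism. Flows. A $G$-flow is a continuous action of a topological group $G$ on a compact Hausdorff space. A factor map $\pi\colon Y\to Z$ of $G$-flows (continuous, surjective, equivariant) is highly proximal if it is irreducible: for every non-empty open $U\subseteq Y$ there is $z\in Z$ with $\pi^{-1}(\{z\})\subseteq U$. Then $Y$ is called a highly proximal extension of $Z$. $\mathcal{S}_G(Z)\to Z$ denotes the universal highly proximal extension of a flow $Z$: for every highly proximal extension $Z'\to Z$ there is a highly proximal map $\mathcal{S}_G(Z)\to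 Z'$ commuting with the maps to $Z$. Dendrites. A dendrite is a compact, metrizable, locally connected, uniquely arcwise connected topological space. For a point $x$ of a dendrite $D$, $\hat{x}$ is the set of connected components of $D \setminus \{x\}$; $x$ is a branch point of order $|\hat x|$ if $|\hat x| \ge 3$. The Ważewski dendrite $W = W_n$ is the unique (up to homeomorphism) dendrite in which every branch point has order $n$ and the set of branch points is dense. $X$ is its (countable) set of branch points and $\widehat X=\bigsqcup_{x\in X}\hat x$. For $x\in X$, $y\in W\setminus\{x\}$, $\Phi(x,y)\in\hat x$ is the component containing $y$. $[x,y]$ is the arc joining $x,y$; $(x,y)=[x,y]\setminus\{x,y\}$. $K(x,y,z)$ is the unique point of $[x,y]\cap[y,z]\cap[x,z]$, and $B(x,y,z)$ means $K(x,y,z)=y$ ($y$ is between $x$ and $z$). Kaleidoscopic groups and structures. A kaleidoscopic coloring is $\kappa\colon\widehat X\to M$ such that each restriction $\kappa_x=\kappa|_{\hat x}\colon \hat x \to M$ is a bijection and for all $x\neq y$ in $X$, $a\neq b$ in $M$ there is $z\in X\cap(x,y)$ with $\kappa(\Phi(z,x))=a$, $\kappa(\Phi(z,y))=b$. Fix one (they exist, uniquely up to homeomorphism of $W$). $\mathcal{K}(\Gamma)=\{g\in\mathrm{Homeo}(W): \kappa_{g\cdot x}\circ g|_{\hat x}\circ\kappa_x^{-1}\in\Gamma\ \text{for all }x\in X\}$, a closed subgroup of $\mathrm{Homeo}(W)$. The structure $\mathcal{K}(\mathbf{M})$ has universe $X$, the ternary function $K$, and for each $k$-ary relation symbol $R$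 of $\mathbf{M}$ a $k$-ary relation on the imaginary sort of components $\widehat X$: $R(a_0,\ldots,a_{k-1})$ iff there is $x\in X$ with all $a_i\in\hat x$ and $R^{\mathbf{M}}(\kappa(a_0),\ldots,\kappa(a_{k-1}))$. (The sort $\widehat X$ is the quotient of $\{(x,y)\in X^2:x\neq y\}$ by $(x_1,y_1)\sim(x_2,y_2)$ iff $x_1=x_2$ and $\neg B(y_1,x_1,y_2)$; the class of $(x,y)$ is $\Phi(x,y)$.) Its automorphism group is $\mathcal{K}(\Gamma)$ acting on $X$. $\overline{\mathcal{K}}(\mathbf{M})$ is the expansion of $\mathcal{K}(\mathbf{M})$ by a relation symbol for every $\mathcal{K}(\Gamma)$-invariant subset of $X^k$, for every $k$. Types. $\mathrm{S}_1(\overline{\mathcal{K}}(\mathbf{M}))$ is the Stone space of complete $1$-types in the variable $v$ over the parameter set $X$ of the first-order theory of $\overline{\mathcal{K}}(\mathbf{M})$ with constants for $X$; $g\in\mathcal{K}(\Gamma)$ acts by $\phi(v,\bar x)\in g\cdot p\iff\phi(v,g^{-1}\cdot\bar x)\in p$. For $x\in X$, $\zeta\in W\setminus\{x\}$, the condition $p(v)\models\Phi(x,v)=\Phi(x,\zeta)$ means that $p$ contains the formula $v\neq x\wedge\neg B(v,x,y)$ for some (equivalently any) $y\in X\cap\Phi(x,\zeta)$. *)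

(* Defs.v *)
From HB Require Import structures.
From mathcomp Require Import all_boot all_order all_algebra.
From mathcomp Require Import all_classical all_reals all_analysis.

Set Implicit Arguments.
Unset Strict Implicit.
Unset Printing Implicit Defensive.

Import Order.TTheory GRing.Theory Num.Theory.
Import numFieldNormedType.Exports.

Local Open Scope classical_set_scope.
Local Open Scope ring_scope.
Local Open Scope card_scope.

(* The last field says that the group is closed in Sym(M): a permutation that
   agrees on every finite set with an element of the group belongs to it. *)
Record perm_group (M : Type) := PermGroup {
  pg_set :> set (M -> M);
  pg_id : pg_set id;
  pg_comp : forall f g, pg_set f -> pg_set g -> pg_set (f \o g);
  pg_inv : forall f, pg_set f -> exists2 g, pg_set g & cancel f g /\ cancel g f;
  pg_closed : forall f, bijective f ->
    (forall A : set M, finite_set A ->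
      exists2 g, pg_set g & forall a, A a -> g a = f a) ->
    pg_set f
}.

Definition transitive_group (M : Type) (Gamma : perm_group M) : Prop :=
  forall a b : M, exists2 g, pg_set Gamma g & g a = b.

Record rel_structure (M : Type) := RelStructure {
  rsym : Type;
  rar : rsym -> nat;
  rint : forall s : rsym, ('I_(rar s) -> M) -> Prop
}.

Definition automorphisms (M : Type) (MM : rel_structure M) : set (M -> M) :=
  [set f | bijective f /\
    forall (s : rsym MM) (t : 'I_(rar s) -> M), rint t <-> rint (f \o t)].

(* In a relational language the finitely generated substructures are the finite
   subsets; f restricted to A is an isomorphism of A onto f @` A. *)
Definition ultrahomogeneous (M : Type) (MM : rel_structure M) : Prop :=
  forall (A : set M) (f : M -> M), finite_set A -> set_inj A f ->
    (forall (s : rsym MM) (t : 'I_(rar s) -> M),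
       (forall i, A (t i)) -> (rint t <-> rint (f \o t))) ->
  exists2 g, automorphisms MM g & forall a, A a -> g a = f a.

Record homeo (T U : topologicalType) := Homeo {
  hfun :> T -> U;
  hback : U -> T;
  hfunK : cancel hfun hback;
  hbackK : cancel hback hfun;
  hfun_continuous : continuous hfun;
  hback_continuous : continuous hback
}.

Section HomeoGroup.
Context {T : topologicalType}.

Definition homeo_id : homeo T T :=
  @Homeo T T id id (fun=> erefl) (fun=> erefl)
    (fun=> cvg_id) (fun=> cvg_id).

Definition homeo_comp (g h : homeo T T) : homeo T T :=
  @Homeo T T (g \o h) (hback h \o hback g)
    (can_comp (@hfunK _ _ g) (@hfunK _ _ h))
    (can_comp (@hbackK _ _ h) (@hbackK _ _ g))
    (fun x => continuous_comp (@hfun_continuous _ _ h x)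
                              (@hfun_continuous _ _ g _))
    (fun x => continuous_comp (@hback_continuous _ _ g x)
                              (@hback_continuous _ _ h _)).

Definition homeo_inv (g : homeo T T) : homeo T T :=
  Homeo (@hbackK _ _ g) (@hfunK _ _ g)
    (@hback_continuous _ _ g) (@hfun_continuous _ _ g).

(* On a compact Hausdorff T this is the usual topology of Homeo(T), that of
   uniform convergence. *)
HB.instance Definition _ := gen_eqMixin (homeo T T).
HB.instance Definition _ := gen_choiceMixin (homeo T T).
HB.instance Definition _ := Topological.copy (homeo T T)
  (initial_topology (fun g : homeo T T => (g : {compact-open, T -> T}))).

End HomeoGroup.

Section Flows.
Context {G : topologicalType} (one : G) (mul : G -> G -> G).

Definition is_flow (Y : topologicalType) (act : G -> Y -> Y) : Prop :=
  [/\ compact [set: Y], hausdorff_space Y,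
      forall y, act one y = y,
      forall g h y, act (mul g h) y = act g (act h y) &
      continuous (fun gy : G * Y => act gy.1 gy.2)].

Definition factor_map (Y Z : topologicalType) (actY : G -> Y -> Y)
    (actZ : G -> Z -> Z) (pi : Y -> Z) : Prop :=
  [/\ continuous pi, forall z, exists y, pi y = z &
      forall g y, pi (actY g y) = actZ g (pi y)].

Definition highly_proximal (Y Z : topologicalType) (actY : G -> Y -> Y)
    (actZ : G -> Z -> Z) (pi : Y -> Z) : Prop :=
  factor_map actY actZ pi /\
  forall U : set Y, open U -> U !=set0 -> exists z, pi @^-1` [set z] `<=` U.

Definition hp_extension (Y Z : topologicalType) (actY : G -> Y -> Y)
    (actZ : G -> Z -> Z) (pi : Y -> Z) : Prop :=
  [/\ is_flow actY, is_flow actZ & highly_proximal actY actZ pi].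

Definition universal_hp_extension (S Z : topologicalType) (actS : G -> S -> S)
    (actZ : G -> Z -> Z) (pi : S -> Z) : Prop :=
  hp_extension actS actZ pi /\
  forall (Y : topologicalType) (actY : G -> Y -> Y) (rho : Y -> Z),
    hp_extension actY actZ rho ->
    exists2 tau : S -> Y, highly_proximal actS actY tau & rho \o tau = pi.

End Flows.

Section Dendrites.
Context (R : realType) {W : topologicalType}.

Definition metrizable : Prop :=
  exists T : metricType R, inhabited (homeo W T).

Definition locally_connected : Prop :=
  forall (x : W) (U : set W), nbhs x U ->
    exists V : set W, [/\ open V, connected V, V x & V `<=` U].

(* In a Hausdorff space, a continuous injection of [0, 1] is a homeomorphism
   onto its image. *)
Definition is_arc (x y : W) (A : set W) : Prop :=
  exists f : R -> W, [/\ {within `[0, 1], continuous f}, set_inj `[0, 1] f,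
    f @` `[0, 1] = A, f 0 = x & f 1 = y].

Definition uniquely_arcwise_connected : Prop :=
  forall x y : W, x <> y -> exists! A, is_arc x y A.

Definition dendrite : Prop :=
  [/\ [set: W] !=set0, compact [set: W], metrizable, locally_connected &
      uniquely_arcwise_connected].

(* There is no arc from x to itself, so that arc x x = [set x]. *)
Definition arc (x y : W) : set W := x |` \bigcup_(A in is_arc x y) A.

Definition open_arc (x y : W) : set W := arc x y `\` [set x; y].

Definition arc_center (x y z : W) : W :=
  xget x (arc x y `&` arc y z `&` arc x z).

Definition hat (x : W) : set (set W) :=
  connected_component (~` [set x]) @` (~` [set x]).

Definition branch_points : set W := [set x | `I_3 #<= hat x].

(* M only matters through its cardinality, the order of the branch points. *)
Definition wazewski (M : Type) : Prop :=
  [/\ dendrite, forall x, branch_points x -> hat x #= [set: M] &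
      dense branch_points].

End Dendrites.
Arguments metrizable R W : clear implicits.
Arguments locally_connected W : clear implicits.
Arguments uniquely_arcwise_connected R W : clear implicits.
Arguments dendrite R W : clear implicits.
Arguments wazewski R W M : clear implicits.

Notation branch W := (set_type (@branch_points W)).

Record component (W : topologicalType) := Component {
  cbase : branch W;
  cset : set W;
  csetP : hat (\val cbase) cset
}.

Section Components.
Context {W : topologicalType}.

Definition Phi (x : branch W) (y : W) (xy : y <> \val x) : component W :=
  @Component W x (connected_component (~` [set \val x]) y)
    (ex_intro2 _ _ y xy erefl).

Lemma homeo_connected_component (g : homeo W W) (A : set W) (y : W) : A y ->
  g @` connected_component A y = connected_component (g @` A) (g y).
Proof.
have sub (h : homeo W W) B z : B z ->
    h @` connected_component B z `<=` connected_component (h @` B) (h z).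
  move=> Bz; apply: connected_component_max.
  - by exists z => //; exact: connected_component_refl.
  - by apply: image_subset; exact: connected_component_sub.
  - apply: connected_continuous_connected; first exact: component_connected.
    exact/continuous_subspaceT/hfun_continuous.
move=> Ay; apply/seteqP; split; first exact: sub.
move=> w gw; exists (hback g w); last exact: hbackK.
have := @sub (homeo_inv g) (g @` A) (g y).
rewrite /= hfunK => /(_ (ex_intro2 _ _ y Ay erefl)).
have -> : [set hback g x | x in g @` A] = A.
  apply/seteqP; split=> [_ [_ [u Au <-] <-]|u Au]; first by rewrite hfunK.
  by exists (g u); [exists u | rewrite hfunK].
by apply; exists w.
Qed.

Lemma homeo_setC1 (g : homeo W W) (x : W) : g @` (~` [set x]) = ~` [set g x].
Proof.
apply/seteqP; split=> [_ [u ux <-] gux|w wgx].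
  by apply: ux; rewrite /= -(hfunK g u) gux hfunK.
exists (hback g w); last exact: hbackK.
by move=> /= wx; apply: wgx; rewrite /= -wx hbackK.
Qed.

Lemma homeo_hat (g : homeo W W) (x : W) (C : set W) :
  hat x C -> hat (g x) (g @` C).
Proof.
move=> [y yx <-]; exists (g y); first by rewrite -homeo_setC1; exists y.
by rewrite homeo_connected_component // homeo_setC1.
Qed.

Lemma homeo_branch (g : homeo W W) (x : W) :
  branch_points x -> branch_points (g x).
Proof.
move=> /card_le_trans; apply.
have inj : {in hat x &, injective (fun C : set W => g @` C)}.
  move=> C D _ _ gCD; apply/seteqP; split=> w Cw.
  + have : (g @` D) (g w) by rewrite -gCD; exists w.
    by move=> [v Dv /(can_inj (@hfunK _ _ g)) <-].
  + have : (g @` C) (g w) by rewrite gCD; exists w.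
    by move=> [v Cv /(can_inj (@hfunK _ _ g)) <-].
rewrite -(card_le_eql (inj_card_eq inj)); apply: subset_card_le.
by move=> _ [C Cx <-]; exact: homeo_hat.
Qed.

Definition branch_act (g : homeo W W) (x : branch W) : branch W :=
  SigSub (mem_set (homeo_branch g (set_mem (valP x)))).

Definition component_act (g : homeo W W) (c : component W) : component W :=
  @Component W (branch_act g (cbase c)) (g @` cset c) (homeo_hat g (csetP c)).

(* Restriction of [arc_center] to the branch points: in a dendrite the center of
   three branch points is a branch point, and the default value is not used. *)
Definition Kfun (R : realType) (x y z : branch W) : branch W :=
  insubd x (arc_center R (\val x) (\val y) (\val z)).

End Components.

Section Kaleidoscopic.
Context {W : topologicalType} {M : Type} (kappa : component W -> M).

Definition kaleidoscopic (R : realType) : Prop :=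
  (forall x : branch W, set_bij [set c | cbase c = x] [set: M] kappa) /\
  (forall x y : branch W, x <> y -> forall a b : M, a <> b ->
     exists (z : branch W) (zx : \val x <> \val z) (zy : \val y <> \val z),
       [/\ open_arc R (\val x) (\val y) (\val z),
           kappa (Phi zx) = a & kappa (Phi zy) = b]).

Context (Gamma : perm_group M).

(* gamma is kappa_(g x) \o g \o kappa_x^-1. *)
Definition kgroup : set (homeo W W) :=
  [set g | forall x : branch W, exists2 gamma, pg_set Gamma gamma &
     forall c, cbase c = x -> kappa (component_act g c) = gamma (kappa c)].

Lemma component_eq (c d : component W) :
  cbase c = cbase d -> cset c = cset d -> c = d.
Proof.
case: c d => x C xC [y D yD] /= xy CD; subst y D.
by rewrite (Prop_irrelevance xC yD).
Qed.

Lemma kgroup_id : kgroup homeo_id.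
Proof.
move=> x; exists id; first exact: pg_id.
move=> c _; congr kappa; apply: component_eq => /=; last exact: image_id.
by apply: val_inj.
Qed.

Lemma kgroup_comp g h : kgroup g -> kgroup h -> kgroup (homeo_comp g h).
Proof.
move=> Kg Kh x; have [a Ga aE] := Kh x.
have [b Gb bE] := Kg (branch_act h x).
exists (b \o a); first exact: pg_comp.
move=> c cx /=; rewrite -aE// -bE/= ?cx//.
congr kappa; apply: component_eq => /=; last by rewrite image_comp.
exact: val_inj.
Qed.

Lemma kgroup_inv g : kgroup g -> kgroup (homeo_inv g).
Proof.
move=> Kg x; have [a Ga aE] := Kg (branch_act (homeo_inv g) x).
have [b Gb [ab ba]] := pg_inv Ga; exists b => // c cx.
rewrite -[LHS]ab -aE/= ?cx//; congr (b (kappa _)).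
apply: component_eq => /=; first by apply: val_inj; rewrite /= hbackK.
apply/seteqP; split=> [_ [_ [u cu <-] <-]|u cu]; first by rewrite hbackK.
by exists (hback g u); [exists u | rewrite hbackK].
Qed.

(* As a type, K(Gamma) carries the subspace topology of Homeo(W). *)
Definition kone : kgroup := SigSub (mem_set kgroup_id).
Definition kmul (g h : kgroup) : kgroup :=
  SigSub (mem_set (kgroup_comp (set_mem (valP g)) (set_mem (valP h)))).
Definition kinv (g : kgroup) : kgroup :=
  SigSub (mem_set (kgroup_inv (set_mem (valP g)))).

Definition kact (g : kgroup) (w : W) : W := \val g w.

Definition invariant (k : nat) (P : set ('I_k -> branch W)) : Prop :=
  forall (g : kgroup) t, P t <-> P (branch_act (\val g) \o t).

End Kaleidoscopic.
Arguments kone {W M} kappa Gamma.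
Arguments kmul {W M kappa Gamma} g h.
Arguments kact {W M kappa Gamma} g w.

Section Logic.
Context (R : realType) {W : topologicalType} {M : Type}
  (kappa : component W -> M) (Gamma : perm_group M) (MM : rel_structure M).

Notation X := (branch W).

(* Formulas have two sorts of variables (de Bruijn indices): n of the home sort
   X and m of the imaginary sort of components. The elements of X are
   constants. *)
Inductive term (n : nat) : Type :=
| Tvar of 'I_n
| Tpar of X
| TK of term n & term n & term n.

(* [Finv] are the symbols for the K(Gamma)-invariant relations, [Frel] those of
   MM on components, and [Fcomp t u i] says that t != u and that the i-th
   component variable is the class Phi(t, u) of (t, u). *)
Inductive formula : nat -> nat -> Type :=
| Feq n m of term n & term n : formula n m
| Finv n m k (P : set ('I_k -> X)) of invariant kappa Gamma P &
    ('I_k -> term n) : formula n m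
| Frel n m (s : rsym MM) of ('I_(rar s) -> 'I_m) : formula n m
| Fceq n m of 'I_m & 'I_m : formula n m
| Fcomp n m of term n & term n & 'I_m : formula n m
| Fnot n m of formula n m : formula n m
| Fand n m of formula n m & formula n m : formula n m
| Fex n m of formula n.+1 m : formula n m
| Fcex n m of formula n m.+1 : formula n m.

Definition scons (A : Type) n (a : A) (e : 'I_n -> A) (i : 'I_n.+1) : A :=
  if unlift ord0 i is Some j then e j else a.

Fixpoint eval n (e : 'I_n -> X) (t : term n) : X :=
  match t with
  | Tvar i => e i
  | Tpar x => x
  | TK t u v => Kfun R (eval e t) (eval e u) (eval e v)
  end.

Fixpoint sat n m (phi : formula n m) :
    ('I_n -> X) -> ('I_m -> component W) -> Prop :=
  match phi with
  | Feq _ _ t u => fun e _ => eval e t = eval e u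
  | Finv _ _ _ P _ ts => fun e _ => P (fun i => eval e (ts i))
  | Frel _ _ s ci => fun _ h =>
      (exists x : X, forall i, cbase (h (ci i)) = x) /\
      @rint _ MM s (fun i => kappa (h (ci i)))
  | Fceq _ _ i j => fun _ h => h i = h j
  | Fcomp _ _ t u i => fun e h =>
      exists tu : \val (eval e u) <> \val (eval e t), h i = Phi tu
  | Fnot _ _ p => fun e h => ~ sat p e h
  | Fand _ _ p q => fun e h => sat p e h /\ sat q e h
  | Fex _ _ p => fun e h => exists x : X, sat p (scons x e) h
  | Fcex _ _ p => fun e h => exists c : component W, sat p e (scons c h)
  end.

Fixpoint tmap n (f : X -> X) (t : term n) : term n :=
  match t with
  | Tvar i => Tvar i
  | Tpar x => Tpar n (f x)
  | TK t u v => TK (tmap f t) (tmap f u) (tmap f v)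
  end.

Fixpoint map_params n m (f : X -> X) (phi : formula n m) : formula n m :=
  match phi with
  | Feq _ _ t u => Feq _ (tmap f t) (tmap f u)
  | Finv _ _ _ _ invP ts => Finv _ invP (fun i => tmap f (ts i))
  | Frel _ _ _ ci => Frel _ ci
  | Fceq _ _ i j => Fceq _ i j
  | Fcomp _ _ t u i => Fcomp (tmap f t) (tmap f u) i
  | Fnot _ _ p => Fnot (map_params f p)
  | Fand _ _ p q => Fand (map_params f p) (map_params f q)
  | Fex _ _ p => Fex (map_params f p)
  | Fcex _ _ p => Fcex (map_params f p)
  end.

(* [FB t u w] is the formula B(t, u, w), and [varv] the free variable v. *)
Definition FB n m (t u w : term n) : formula n m := Feq m (TK t u w) u.
Definition varv : term 1 := Tvar ord0.

Definition no_component : 'I_0 -> component W :=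
  fun i => False_rect _ (notF (ltn_ord i)).

Definition holds_at (a : X) (phi : formula 1 0) : Prop :=
  sat phi (fun=> a) no_component.

Definition finitely_satisfiable (p : set (formula 1 0)) : Prop :=
  forall F : set (formula 1 0), finite_set F -> F `<=` p ->
    exists a : X, forall phi, F phi -> holds_at a phi.

(* The theory with constants for X is that of the structure itself, so that the
   sets of formulas consistent with it are the finitely satisfiable ones. *)
Definition complete_types : set (set (formula 1 0)) :=
  [set p | finitely_satisfiable p /\
    forall q, finitely_satisfiable q -> p `<=` q -> q = p].

Definition S1 : Type := set_type complete_types.

HB.instance Definition _ := Choice.copy S1 (set_type complete_types).

Definition type_contains (p : S1) : set (formula 1 0) := \val p.

(* Stone topology: the sets of types containing a given formula form a base. *)
HB.instance Definition _ := @isSubBaseTopological.Build S1 (set S1)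
  (range (fun (phi : formula 1 0) (p : S1) => type_contains p phi)) id.

Definition nonbetween_types : set S1 :=
  [set p | forall x y : X,
     type_contains p (Fnot (FB 0 (Tpar 1 x) varv (Tpar 1 y)))].

(* p(v) |= Phi(x, v) = Phi(x, zeta) *)
Definition same_direction (p : S1) (x : X) (zeta : W) : Prop :=
  exists2 y : X, connected_component (~` [set \val x]) zeta (\val y) &
    type_contains p (Fand (Fnot (Feq 0 varv (Tpar 1 x)))
                          (Fnot (FB 0 varv (Tpar 1 x) (Tpar 1 y)))).

End Logic.
Arguments nonbetween_types R {W M} kappa Gamma MM.

(* Main.v *)
Require Import Defs.
From mathcomp Require Import all_boot all_order all_algebra.
From mathcomp Require Import all_classical all_reals all_analysis.
From mathcomp Require Import lra zify.

Set Implicit Arguments.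
Unset Strict Implicit.
Unset Printing Implicit Defensive.

Import Order.TTheory GRing.Theory Num.Theory.
Import numFieldNormedType.Exports.

Local Open Scope classical_set_scope.
Local Open Scope ring_scope.
Local Open Scope card_scope.

(** Why the theorem holds. Let G be K(Gamma) and, for a finite set F of branch
    points, G_F its pointwise stabiliser.

    By [sat_act] and [definable], the subsets of X that are definable with
    parameters are exactly those that are invariant under some G_F. A type that
    satisfies the non-betweenness conditions is thus an ultrafilter p on the
    Boolean algebra of these sets, and no member of p is contained in an arc.
    By compactness the closures in W of the members of p have a common point,
    and it is unique because any two points of W are separated by a branch
    point; this is [location].

    The core is [homogeneous]: for a component C of the complement of a branch
    point, the elements of G that are the identity off C act transitively on
    the branch points in C. To send a to b in C, permute the colours at a by an
    element gamma of Gamma that maps the colour of r at a to its colour at b,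
    where r is the point that C is a component at. The new colouring is again
    kaleidoscopic, and any two kaleidoscopic colourings are isomorphic by back
    and forth, with a and r going where they should. The isomorphism differs
    from a colour preserving homeomorphism only at a, where it acts by gamma;
    it preserves C and is pasted with the identity of the complement of C.

    Irreducibility of [location] follows ([contains_half]). A formula phi of p
    with parameters F holds at some a in X that is on no arc between points of
    F. Let r be the projection of a to the subtree spanned by F. The component
    of a at r contains no parameter, so by homogeneity phi holds at all its
    branch points, hence in all types located at a.

    For universality, let rho : Y -> W be highly proximal. The lift of p is the
    common point of the closed sets [cloud phi], the closures of the inverse
    images under rho of the interior of the closure of the set that phi defines,
    for phi in p. They have at most one common point ([lift_point_unique]):
    given two, they have disjoint neighbourhoods of the form G_F V, as the
    stabilisers G_F are a basis of neighbourhoods of 1 ([nbhs_one]). The branch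
    points whose fiber is contained in G_F V form a G_F-invariant, hence
    definable set, and irreducibility of rho puts it into p. Two members of p
    would then have disjoint intersection.

    All this uses that dendrites are tree-like: y lies on the arc from x to z
    iff no component of the complement of y contains both ([arcP]). As the arcs
    of W are unique, this reduces to the theorem that a connected open subset of
    a compact, locally connected metric space is connected by arcs, which is
    proved in two steps: a path is a limit of finer and finer chains, and an arc
    is left when the excursions of a path are cut out. *)

(** * Paths in compact, locally connected metric spaces *)

(** Otherwise the sets [A] such that [Q] holds for the part of [K] outside [A]
    form a proper filter, which contradicts [Q] near a cluster point. This is
    the form in which all covering arguments below are made. *)
Lemma compact_induction (T : topologicalType) (K : set T) (Q : set (set T)) :
  compact K -> Q set0 -> (forall A B, Q A -> Q B -> Q (A `|` B)) ->
  (forall A B, A `<=` B -> Q B -> Q A) ->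
  (forall x, K x -> exists2 U, nbhs x U & Q U) -> Q K.
Proof.
move=> cK Q0 QU QS Qloc; apply: contrapT => nQ.
pose F := [set A | Q (K `\` A)].
have FF : ProperFilter F.
  split; first by rewrite /F /= setD0.
  split.
  - by rewrite /F /= setDT.
  - by move=> A B; rewrite /F /= setDIr; exact: QU.
  - by move=> A B AB; apply: QS; exact: setDS.
have [|x [Kx clx]] := cK F FF; first by rewrite /F /= setDv.
have [U xU QU'] := Qloc x Kx.
have : F (~` U) by apply: QS QU'; rewrite setDE setCK; exact: subIsetr.
by move=> /clx/(_ xU) [y []].
Qed.

Lemma within_continuous_metricP (R : realType) (T : metricType R) (A : set R)
  (f : R -> T) : {within A, continuous f} <->
  forall t, A t -> forall e : R, 0 < e -> exists2 h : R, 0 < h &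
    forall t', A t' -> `|t - t'| < h -> mdist (f t) (f t') < e.
Proof.
split=> [/subspace_continuousP cf t At e e0|H].
  have /= := cf t At _ (nbhsx_ballx _ _ e0).
  move=> /nbhs_ballP[h /= h0 hP]; exists h => // t' At' tt'.
  by have := hP t' tt' At'; rewrite /= ballEmdist.
apply/subspace_continuousP => t At; apply/metricType_numDomainType.cvgrPdist_lt => e e0.
have [h h0 hP] := H t At e e0.
by apply/nbhs_ballP; exists h => //= t' tt' At'; exact: hP.
Qed.

Section Paths.
Context {R : realType} {T : metricType R}.
Hypothesis cT : compact [set: T].
Hypothesis lcT : locally_connected T.
Local Notation d := (@mdist R T).

(** This is a Lebesgue number: near a given point, one connected neighbourhood
    serves all pairs. *)
Lemma uniformly_locally_connected (e : R) : 0 < e ->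
  exists2 dl : R, 0 < dl & forall a b, d a b < dl ->
    exists S : set T, [/\ connected S, S a, S b & forall c, S c -> d a c < e].
Proof.
move=> e0.
pose Q (A : set T) := exists2 dl : R, 0 < dl & forall a b, A a -> d a b < dl ->
  exists S : set T, [/\ connected S, S a, S b & forall c, S c -> d a c < e].
have [|A B [r r0 rA] [s s0 sB]|A B AB [r r0 rB]|x _|r r0 H] :=
  @compact_induction T setT Q cT.
- by exists 1.
- exists (Num.min r s); first by rewrite lt_min r0.
  move=> a b [Aa|Ba]; rewrite lt_min => /andP[ab1 ab2]; first exact: rA.
  exact: sB.
- by exists r => // a b /AB; exact: rB.
- have e2 : 0 < e / 2 by rewrite divr_gt0.
  have [V [oV cV Vx Vb]] := lcT (nbhsx_ballx x _ e2).
  have /nbhs_ballP[r /= r0 rV] := open_nbhs_nbhs (conj oV Vx).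
  have r2 : 0 < r / 2 by rewrite divr_gt0.
  exists (ball x (r/2)); first exact: nbhsx_ballx.
  exists (r / 2) => // a b xa ab; exists V; split => //.
  + by apply: rV; apply: le_ball xa; lra.
  + apply: rV; rewrite [X in ball _ X _]splitr; apply: ball_triangle xa _.
    by rewrite ballEmdist.
  + move=> c /Vb xc; have : V a by apply: rV; apply: le_ball xa; lra.
    move=> /Vb; rewrite !ballEmdist /= in xc * => xa'.
    have := metric_triangle a x c; rewrite (metric_sym a x); lra.
by exists r => // a b ab; exact: H.
Qed.

(** The points that can be reached form a clopen subset of [S]. *)
Lemma connected_chain (S : set T) (a b : T) (dl : R) : connected S -> S a ->
  S b -> 0 < dl -> exists (c : nat -> T) (N : nat),
  [/\ c 0 = a, forall i, (N <= i)%N -> c i = b, forall i, S (c i) &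
      forall i, d (c i) (c i.+1) < dl].
Proof.
move=> cS Sa Sb dl0.
pose E := [set b | S b /\ exists (c : nat -> T) (N : nat),
  [/\ c 0 = a, forall i, (N <= i)%N -> c i = b, forall i, S (c i) &
      forall i, d (c i) (c i.+1) < dl]].
have step x y : E x -> S y -> d x y < dl -> E y.
  move=> [Sx [c [N [c0 cN cc cd]]]] Sy xy; split=> //.
  exists (fun i => if (i <= N)%N then c i else y), N.+1; split => //.
  - by move=> i Ni; rewrite ifF//; apply/negbTE; lia.
  - by move=> i; case: ifP.
  - move=> i; case: ifPn; case: ifPn => //.
    + by move=> h1 h2; rewrite (cN i)//; lia.
    + by move=> h1 h2; exfalso; lia.
    + by move=> _ _; rewrite mdistxx.
suff ES : E = S by suff [] : E b by []; rewrite ES.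
apply: cS.
- exists a; split => //; exists (fun=> a), 0; split => // i.
  by rewrite mdistxx.
- exists (\bigcup_(x in E) (ball x dl)°).
    by apply: bigcup_open => x _; exact: open_interior.
  apply/seteqP; split => [x Ex|x [Sx [y Ey /interior_subset]]].
    split; first by case: Ex.
    by exists x => //; apply: nbhs_singleton; apply: nbhs_interior; exact: nbhsx_ballx.
  by rewrite ballEmdist => /= ?; apply: step Ey _ _.
- exists (~` \bigcup_(x in S `\` E) (ball x dl)°).
    by apply: open_closedC; apply: bigcup_open => x _; exact: open_interior.
  apply/seteqP; split => [x Ex|x [Sx nx]].
    split; first by case: Ex.
    move=> [y [Sy nEy] /interior_subset]; rewrite ballEmdist /= => yx.
    by apply: nEy; apply: step Ex Sy _; rewrite metric_sym.
  apply: contrapT => nE; apply: nx; exists x => //.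
  by apply: nbhs_singleton; apply: nbhs_interior; exact: nbhsx_ballx.
Qed.

(** A discrete path of mesh [dl] with [s.1] steps; it stays at [v] afterwards, so
    that every index has a value. *)
Definition fine_chain (u v : T) (dl : R) (s : nat * (nat -> T)) :=
  [/\ (0 < s.1)%N, s.2 0 = u, forall i, (s.1 <= i)%N -> s.2 i = v &
      forall i, d (s.2 i) (s.2 i.+1) < dl].

(** Every step is replaced by a finer chain in a small connected set. All steps
    get the same number [N] of substeps, so that the old chain at index [i] and
    the new one at [i * N] correspond to the same time in [0, 1]. *)
Lemma refine_chain (u v : T) (e dl dl' : R) (s : nat * (nat -> T)) : 0 < dl' ->
  (forall a b, d a b < dl ->
    exists S : set T, [/\ connected S, S a, S b & forall c, S c -> d a c < e]) ->
  0 < dl -> 0 < e ->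
  fine_chain u v dl s ->
  exists (N : nat) (q : nat -> T), [/\ (0 < N)%N, fine_chain u v dl' ((s.1 * N)%N, q) &
     forall i j, (j < N)%N -> d (s.2 i) (q (i * N + j)%N) < e].
Proof.
case: s => L p dl'0 ulc dl0 e0 [/= L0 p0 pL pd].
have /choice[c /choice[Nc cP]] : forall i, exists (c : nat -> T) (N : nat),
    [/\ c 0 = p i, forall j, (N <= j)%N -> c j = p i.+1,
     forall j, d (p i) (c j) < e & forall j, d (c j) (c j.+1) < dl'].
  move=> i; have [S [cS Sa Sb Se]] := ulc _ _ (pd i).
  have [c [N [c0 cN cc cd]]] := connected_chain cS Sa Sb dl'0.
  by exists c, N; split => // j; exact/Se/cc.
pose N := (\max_(i < L) Nc i).+1.
have NcN i : (i < L)%N -> (Nc i < N)%N.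
  by move=> iL; rewrite /N ltnS; apply: (leq_bigmax (Ordinal iL)).
pose q m := if (m %/ N < L)%N then c (m %/ N)%N (m %% N)%N else v.
have N0 : (0 < N)%N by [].
exists N, q; split => //.
- split => /=; first by rewrite muln_gt0 L0.
  + by rewrite /q div0n L0 mod0n; case: (cP 0) => ->.
  + by move=> i Li; rewrite /q ltnNge leq_divRL// Li.
  + move=> m; rewrite /q.
    have := divn_eq m N; have := ltn_pmod m N0; move: (m %/ N)%N (m %% N)%N => i j jN mE.
    have [jN1|jN1] := ltnP j.+1 N.
      have -> : (m.+1 %/ N)%N = i by rewrite mE -addnS divnMDl// divn_small// addn0.
      have -> : (m.+1 %% N)%N = j.+1 by rewrite mE -addnS modnMDl modn_small.
      by case: ifP => iL; [case: (cP i)|rewrite mdistxx].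
    have jE : j.+1 = N by lia.
    have mE' : m.+1 = (i.+1 * N + 0)%N by rewrite mE -addnS jE mulSn addn0 addnC.
    have -> : (m.+1 %/ N)%N = i.+1 by rewrite mE' divnMDl// div0n addn0.
    have -> : (m.+1 %% N)%N = 0 by rewrite mE' modnMDl mod0n.
    have [iL|iL] := ltnP i L; last first.
      by rewrite ifF ?mdistxx//; apply/negbTE; rewrite -leqNgt ltnW.
    have -> : (if (i.+1 < L)%N then c i.+1 0 else v) = c i j.+1.
      have [_ cN _ _] := cP i; rewrite (cN j.+1) ?jE ?(ltnW (NcN _ _))//.
      case: ltnP => iL'; first by have [-> _ _ _] := cP i.+1.
      by rewrite pL.
    by case: (cP i).
- move=> i j jN; rewrite /q divnMDl// divn_small// addn0 modnMDl modn_small//.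
  case: ltnP => iL; first by have [_ _ + _] := cP i.
  by rewrite pL// mdistxx.
Qed.

(** The path is the uniform limit of chains that are refined again and again; the
    first of them lies in [S0], and the later ones move away from it by less than
    [e]. *)
Lemma path_near_connected (S0 : set T) (u v : T) (e : R) : connected S0 ->
  S0 u -> S0 v -> 0 < e -> exists f : R -> T,
  [/\ {within `[0, 1], continuous f}, f 0 = u, f 1 = v &
      forall t, 0 <= t <= 1 -> exists2 s, S0 s & d s (f t) < e].
Proof.
move=> cS Su Sv e0.
(* The errors from level [n] on add up to [2 * en n], hence to [e / 2] in all. *)
pose en n : R := e / 4 * 2^-1 ^+ n.
have en0 n : 0 < en n by rewrite mulr_gt0 ?divr_gt0// exprn_gt0// invr_gt0.
have enS n : en n = 2 * en n.+1.
  by rewrite /en exprS mulrCA [X in _ = _ * X]mulrA divff// mul1r.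
have en_small x : 0 < x -> exists n, en n < x.
  move=> x0; have := @cvg_geometric R (e / 4) 2^-1.
  rewrite gtr0_norm ?invr_gt0// invf_lt1// ltr1n => /(_ isT).
  move=> /cvgr0Pnorm_lt /(_ _ x0) [n _ /(_ n (leqnn n)) H].
  by exists n; apply: le_lt_trans H; rewrite /geometric /= ler_norm.
have /choice[dl dlP] : forall n, exists dl, [/\ 0 < dl, dl <= en n &
    forall a b, d a b < dl -> exists S : set T,
      [/\ connected S, S a, S b & forall c, S c -> d a c < en n]].
  move=> n; have [r r0 rP] := uniformly_locally_connected (en0 n).
  exists (Num.min r (en n)); split; rewrite ?lt_min ?r0 ?en0// ?ge_min ?lexx ?orbT//.
  by move=> a b; rewrite lt_min => /andP[/rP].
have /choice[F FP] : forall ns : nat * (nat * (nat -> T)), exists s' : nat * (nat -> T),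
    fine_chain u v (dl ns.1) ns.2 -> fine_chain u v (dl ns.1.+1) s' /\
    exists N, [/\ (0 < N)%N, s'.1 = (ns.2.1 * N)%N & forall i j, (j < N)%N ->
      d (ns.2.2 i) (s'.2 (i * N + j)%N) < en ns.1].
  move=> [n s] /=; have [fc|] := pselect (fine_chain u v (dl n) s); last by exists s.
  have [dn0 _ dnP] := dlP n; have [dn1 _ _] := dlP n.+1.
  have [N [q [N0 fc' qP]]] := refine_chain dn1 dnP dn0 (en0 n) fc.
  by exists ((s.1 * N)%N, q) => _; split => //; exists N.
have [d0 _ _] := dlP 0.
have [c [N0 [c0 cN cS0 cd]]] := connected_chain cS Su Sv d0.
pose st := fix st n := if n is k.+1 then F (k, st k) else (N0.+1, c).
have st_fine n : fine_chain u v (dl n) (st n).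
  elim: n => [|n IH]; first by split => //= i /ltnW; exact: cN.
  by have [] := FP (n, st n) IH.
have stS n : exists N, [/\ (0 < N)%N, (st n.+1).1 = ((st n).1 * N)%N &
    forall i j, (j < N)%N -> d ((st n).2 i) ((st n.+1).2 (i * N + j)%N) < en n].
  by have [_] := FP (n, st n) (st_fine n).
(* [x n t] is the position at time [t] on the chain of level [n]. *)
pose m n (t : R) := Num.truncn (t * (st n).1%:R).
pose x n t := (st n).2 (m n t).
have L0 n : 0 < (st n).1%:R :> R by rewrite ltr0n; case: (st_fine n).
have mP n t : 0 <= t -> (m n t)%:R <= t * (st n).1%:R < (m n t).+1%:R.
  by move=> t0; apply: truncn_itv; rewrite mulr_ge0// ltW.
have xS n t : 0 <= t -> d (x n t) (x n.+1 t) < en n.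
  move=> t0; have [N [Ngt0 LE H]] := stS n; rewrite /x.
  have -> : m n.+1 t = (m n t * N + m n.+1 t %% N)%N.
    rewrite {1}(divn_eq (m n.+1 t) N); congr (_ * _ + _)%N.
    have /andP[h1 h2] := mP n t t0; have /andP[h3 h4] := mP n.+1 t t0.
    rewrite LE natrM mulrA in h3 h4.
    have Nr : 0 < N%:R :> R by rewrite ltr0n.
    apply/eqP; rewrite eqn_leq -ltnS ltn_divLR// leq_divRL// -!(ltr_nat R) -!(ler_nat R) !natrM.
    apply/andP; split.
      by apply: le_lt_trans h3 _; rewrite ltr_pM2r.
    rewrite -natrM ler_nat -ltnS -(ltr_nat R); apply: le_lt_trans h4.
    by rewrite natrM ler_pM2r.
  by apply: H; rewrite ltn_pmod.
have xD n k t : 0 <= t -> d (x n t) (x (n + k)%N t) <= 2 * en n - 2 * en (n + k)%N.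
  move=> t0; elim: k => [|k IH]; first by rewrite addn0 mdistxx; lra.
  rewrite addnS; have := metric_triangle (x n t) (x (n + k)%N t) (x (n + k).+1 t).
  have := xS (n + k)%N t t0; have := enS (n + k)%N; lra.
have /choice[f fP] : forall t, exists p, 0 <= t -> forall n, d (x n t) p <= 2 * en n.
  move=> t; have [t0|] := boolP (0 <= t); last by exists u.
  have [p [_ clp]] := cT (F := (fun k => x k t) @ \oo) _ filterT.
  exists p => _ n; apply/ler_addgt0Pr => h h0.
  have [] := clp [set y | exists2 k, (n <= k)%N & y = x k t] (ball p h) _ (nbhsx_ballx _ _ h0).
    by exists n => // k nk; exists k.
  move=> _ [[k nk ->]]; rewrite ballEmdist /= => pk.
  have := xD n (k - n)%N t t0; rewrite subnKC// => xnk.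
  have := metric_triangle (x n t) (x k t) p; rewrite (metric_sym (x k t) p).
  have := en0 k; lra.
have eqP' a b : (forall n, d a b <= 2 * en n) -> a = b.
  move=> H; apply: (@mdist_positivity R T); apply/eqP.
  rewrite eq_le mdist_ge0 andbT; apply/ler_addgt0Pr => h h0.
  have h2 : 0 < h / 2 by rewrite divr_gt0.
  have [n nh] := en_small _ h2; have := H n; lra.
exists f; split.
- apply/within_continuous_metricP => t /=; rewrite in_itv /= => /andP[t0 t1] h h0.
  have h5 : 0 < h / 5 by rewrite divr_gt0.
  have [n nh] := en_small _ h5.
  exists (1 / (st n).1%:R); first by rewrite divr_gt0.
  move=> t'; rewrite in_itv /= => /andP[t'0 t'1]; rewrite ltr_pdivlMr// => tt'.
  have close : d (x n t) (x n t') <= en n.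
    have [_ _ _ dn] := st_fine n; have [_ dle _] := dlP n.
    have /andP[h1 h2] := mP n t t0; have /andP[h3 h4] := mP n t' t'0.
    have h6 : `|t * (st n).1%:R - t' * (st n).1%:R| < 1.
      by rewrite -mulrBl normrM (gtr0_norm (L0 n)).
    move: h6; rewrite ltr_norml => /andP[h6 h7].
    have h8 : (m n t < (m n t').+2)%N.
      rewrite -(ltr_nat R) -addn2 natrD; move: h4; rewrite -addn1 natrD; lra.
    have h9 : (m n t' < (m n t).+2)%N.
      rewrite -(ltr_nat R) -addn2 natrD; move: h2; rewrite -addn1 natrD; lra.
    have close_nat p q : (p < q.+2)%N -> (q < p.+2)%N ->
      p = q \/ p = q.+1 \/ q = p.+1 by clear; lia.
    rewrite /x; have [E|[E|E]] := close_nat _ _ h8 h9.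
    + by rewrite E mdistxx ltW.
    + by rewrite E metric_sym (le_trans _ dle)// ltW.
    + by rewrite E (le_trans _ dle)// ltW.
  have := fP t t0 n; have := fP t' t'0 n.
  have := metric_triangle (f t) (x n t) (f t').
  have := metric_triangle (x n t) (x n t') (f t').
  rewrite (metric_sym (f t) (x n t)); lra.
- apply/esym/eqP' => n; have := fP 0 (lexx 0) n.
  by rewrite /x /m mul0r truncn0; have [_ -> _ _] := st_fine n.
- apply/esym/eqP' => n; have := fP 1 ler01 n.
  by rewrite /x /m mul1r natrK; have [_ _ H _] := st_fine n; rewrite (H _ (leqnn _)).
- move=> t /andP[t0 t1]; exists (x 0 t); first exact: cS0.
  by apply: le_lt_trans (fP t t0 0) _; rewrite /en expr0; lra.
Qed.

End Paths.

(** * An arc inside a path *)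
Section WeightedSup.
Context {R : realType}.
Implicit Types b : nat -> R.

Definition partial_weight b n := \sum_(j < n) b j * 2^-1 ^+ j.
(** The sum of the series; its terms are nonnegative where it is used. *)
Definition weight b := sup (range (partial_weight b)).

Lemma partial_weight1 n : partial_weight (fun=> 1) n <= 2.
Proof.
suff -> : partial_weight (fun=> 1) n = 2 - 2 * 2^-1 ^+ n.
  have : 0 <= (2^-1 : R) ^+ n by rewrite exprn_ge0.
  lra.
elim: n => [|n IH]; first by rewrite /partial_weight big_ord0 expr0; lra.
rewrite /partial_weight big_ord_recr /= -/(partial_weight (fun=> 1) n) IH exprS; lra.
Qed.

Lemma partial_weight_le b b' c n : 0 <= c -> (forall k, b k <= b' k + c) ->
  partial_weight b n <= partial_weight b' n + 2 * c.
Proof.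
move=> c0 bb'; have h2 k : 0 <= (2^-1 : R) ^+ k by rewrite exprn_ge0.
apply: (@le_trans _ _ (partial_weight b' n + c * partial_weight (fun=> 1) n)).
  rewrite /partial_weight mulr_sumr -big_split; apply: ler_sum => k _ /=.
  rewrite mul1r -mulrDl; exact: ler_wpM2r.
rewrite lerD2l mulrC; apply: ler_wpM2r => //; exact: partial_weight1.
Qed.

Definition unit_seq b := forall k, 0 <= b k <= 1.

Lemma weight_ub b n : unit_seq b -> partial_weight b n <= weight b.
Proof.
move=> ub; apply: ub_le_sup; last by exists n.
exists (partial_weight (fun=> 0) n + 2 * 1) => _ [m _ <-].
have -> : partial_weight (fun=> 0) n = partial_weight (fun=> 0) m.
  by rewrite /partial_weight !big1// => i _; rewrite mul0r.
by apply: partial_weight_le => // k; rewrite add0r; case/andP: (ub k).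
Qed.

Lemma weight_le b b' c : unit_seq b' -> 0 <= c ->
  (forall k, b k <= b' k + c) -> weight b <= weight b' + 2 * c.
Proof.
move=> ub' c0 bb'; apply: ge_sup; first by exists (partial_weight b 0), 0.
move=> _ [n _ <-]; apply: le_trans (partial_weight_le n c0 bb') _.
by rewrite lerD2r weight_ub.
Qed.

Lemma weight_lt b b' k : unit_seq b -> unit_seq b' ->
  (forall j, b j <= b' j) -> b k < b' k -> weight b < weight b'.
Proof.
move=> ub ub' bb' bk.
have h2 j : 0 < (2^-1 : R) ^+ j by rewrite exprn_gt0.
pose dl := (b' k - b k) * 2^-1 ^+ k.
have dl0 : 0 < dl by rewrite mulr_gt0// subr_gt0.
suff : weight b <= weight b' - dl by lra.
have mono n m : (n <= m)%N -> partial_weight b n <= partial_weight b m.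
  move=> nm; rewrite /partial_weight -(subnKC nm) big_split_ord /= lerDl.
  apply: sumr_ge0 => i _; apply: mulr_ge0; last exact: ltW.
  by case/andP: (ub (n + i)%N).
apply: ge_sup; first by exists (partial_weight b 0), 0.
move=> _ [n _ <-]; apply: le_trans (mono n (maxn n k.+1) (leq_maxl _ _)) _.
set m := maxn _ _; rewrite lerBrDr.
apply: le_trans (weight_ub m ub').
have km : (k < m)%N by rewrite leq_maxr.
rewrite /partial_weight (bigD1 (Ordinal km))//= [leRHS](bigD1 (Ordinal km))//=.
rewrite addrAC; apply: lerD; first by rewrite /dl mulrBl; lra.
by apply: ler_sum => i _; apply: ler_wpM2r; rewrite ?bb'// ltW.
Qed.

End WeightedSup.

Lemma closed_max (R : realType) (A : set R) (a c : R) : closed A -> A a ->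
  a <= c -> exists m, [/\ A m, m <= c & forall x, A x -> x <= c -> x <= m].
Proof.
move=> cA Aa ac; pose B := A `&` [set x | x <= c].
have B0 : B !=set0 by exists a.
have ubB : has_ubound B by exists c => x [].
have cB : closed B by apply: closedI => //; exact: closed_le.
exists (sup B); have [h1 h2] : B (sup B).
  by move: (closure_sup B0 ubB); rewrite -(closure_id B).1.
by split=> // x Ax xc; apply: ub_le_sup.
Qed.

Lemma closed_min (R : realType) (A : set R) (a c : R) : closed A -> A a ->
  c <= a -> exists m, [/\ A m, c <= m & forall x, A x -> c <= x -> m <= x].
Proof.
move=> cA Aa ac.
have cA' : closed (-%R @^-1` A : set R).
  by apply: closed_comp => // x _; exact: opp_continuous.
have [||m [Am mc mx]] := @closed_max R _ (- a) (- c) cA'.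
- by rewrite /= opprK.
- by rewrite lerN2.
exists (- m); split => //; first by rewrite lerNr.
move=> x Ax cx; rewrite lerNl; apply: mx; first by rewrite /= opprK.
by rewrite lerN2.
Qed.

Section ArcInPath.
Context {R : realType} {T : metricType R} (f : R -> T).
Hypothesis cf : {within `[0, 1], continuous f}.
Hypothesis f01 : f 0 <> f 1.
Local Notation d := (@mdist R T).

(** A set of times that is left when excursions of the path are cut out: [f] takes
    the same value at the two ends of every gap. *)
Definition cut_set (A : set R) := [/\ closed A, A 0, A 1, A `<=` `[0, 1] &
  forall a b, A a -> A b -> a < b -> (forall c, a < c < b -> ~ A c) -> f a = f b].

Lemma eq_mdist (x y : T) : (forall e : R, 0 < e -> d x y <= e) -> x = y.
Proof.
move=> H; apply: (@mdist_positivity R T); apply/eqP.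
rewrite eq_le mdist_ge0 andbT; apply/ler_addgt0Pr => e e0.
by rewrite add0r; exact: H.
Qed.

Lemma path_cont t (e : R) : 0 <= t <= 1 -> 0 < e -> exists2 h : R, 0 < h &
  forall t', 0 <= t' <= 1 -> `|t - t'| < h -> d (f t) (f t') < e.
Proof.
move=> t01 e0; have /within_continuous_metricP /(_ t) := cf.
rewrite /= in_itv /= => /(_ t01 e e0)[h h0 hP].
by exists h.
Qed.

(** The chain condition of Zorn's lemma, for complements of cut sets. A closed
    interval inside a gap of the intersection is compact, so a single member of
    the chain misses it; the gap of that member around it has its ends close to
    the given ones. *)
Lemma chain_bigcap_cut_set (F : set (set R)) :
  (forall B, F B -> cut_set (`[0, 1] `\` B)) -> total_on F subset ->
  cut_set (`[0, 1] `\` \bigcup_(B in F) B).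
Proof.
move=> FC Ftot.
have AE : `[0, 1] `\` \bigcup_(B in F) B =
    `[0, 1] `&` \bigcap_(B in F) (`[0, 1] `\` B).
  apply/seteqP; split=> x [x01 H]; split=> //.
    by move=> B FB; split => // Bx; apply: H; exists B.
  by move=> [B FB Bx]; have [_] := H B FB.
have i0 : `[0, 1]%classic (0 : R) by rewrite /= in_itv /= lexx ler01.
have i1 : `[0, 1]%classic (1 : R) by rewrite /= in_itv /= lexx ler01.
split.
- rewrite AE; apply: closedI; first exact: itv_closed.
  by apply: closed_bigI => B FB; case: (FC B FB).
- by rewrite AE; split=> // B FB; case: (FC B FB).
- by rewrite AE; split=> // B FB; case: (FC B FB).
- by move=> x [].
move=> a b [a01 Aa] [b01 Ab] ab gap; apply: eq_mdist => e e0.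
have e2 : 0 < e / 2 by rewrite divr_gt0.
move: (a01) (b01); rewrite /= !in_itv /= => a01' b01'.
have [ha ha0 haP] := path_cont a01' e2.
have [hb hb0 hbP] := path_cont b01' e2.
pose m := Num.min (Num.min ha hb) (b - a).
have m0 : 0 < m by rewrite !lt_min ha0 hb0 subr_gt0.
pose eta := m / 3.
have eta0 : 0 < eta by rewrite divr_gt0.
have [ea eb eab] : [/\ eta < ha, eta < hb & eta < (b - a) / 2].
  have : m <= ha by rewrite /m !ge_min lexx.
  have : m <= hb by rewrite /m !ge_min lexx orbT.
  have : m <= b - a by rewrite /m !ge_min lexx orbT.
  by rewrite /eta; split; lra.
pose K := `[a + eta, b - eta]%classic.
have KN x : K x -> exists2 B, F B & B x.
  rewrite /K /= in_itv /= => /andP[x1 x2]; apply: contrapT => nB.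
  have := gap x; apply; first by apply/andP; split; lra.
  split; first by rewrite /= in_itv /=; apply/andP; split; lra.
  by move=> [B FB Bx]; apply: nB; exists B.
have [B FB KB] : exists2 B, F B & K `<=` B.
  pose Q (S : set R) := K `&` S = set0 \/ exists2 B, F B & K `&` S `<=` B.
  have [|C D|C D CD|x Kx|K0|[B FB KB]] := @compact_induction _ K Q (@segment_compact R _ _).
  - by left; rewrite setI0.
  - move=> [C0|[B1 FB1 CB1]] [D0|[B2 FB2 DB2]].
    + by left; rewrite setIUr C0 D0 setU0.
    + by right; exists B2; rewrite // setIUr C0 set0U.
    + by right; exists B1; rewrite // setIUr D0 setU0.
    + right; have [B12|B21] := Ftot _ _ FB1 FB2.
        by exists B2 => // x [Kx [Cx|Dx]]; [apply: B12; exact: CB1|exact: DB2].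
      by exists B1 => // x [Kx [Cx|Dx]]; [exact: CB1|apply: B21; exact: DB2].
  - move=> [D0|[B FB DB]]; first by left; rewrite -subset0 -D0; exact: setIS.
    by right; exists B => // x [Kx /CD Dx]; exact: DB.
  - have [B FB Bx] := KN x Kx; have [cB _ _ _ _] := FC B FB.
    exists (~` (`[0, 1] `\` B)).
      by apply: open_nbhs_nbhs; split; [exact: closed_openC|move=> []].
    right; exists B => // y [Ky ny]; apply: contrapT => nBy; apply: ny; split=> //.
    move: Ky; rewrite /K /= !in_itv /= => /andP[y1 y2]; apply/andP; split; lra.
  - have Kh : K ((a + b) / 2).
      by rewrite /K /= in_itv /=; apply/andP; split; lra.
    by move: K0; rewrite setIid => K0; rewrite K0 in Kh.
  - by exists B => //; rewrite setIid in KB.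
have [cB B0 B1 B01 Bgap] := FC B FB.
have nBa : (`[0, 1] `\` B) a by split => // Ba; apply: Aa; exists B.
have nBb : (`[0, 1] `\` B) b by split => // Bb; apply: Ab; exists B.
have [|a' [Aa' a'1 a'2]] := closed_max (c := a + eta) cB nBa; first by lra.
have [|b' [Ab' b'1 b'2]] := closed_min (c := b - eta) cB nBb; first by lra.
have aa' := a'2 a nBa; have bb' := b'2 b nBb.
have E : f a' = f b'.
  apply: Bgap => //; first by lra.
  move=> c /andP[c1 c2] Bc.
  have [ca|ca] := leP c (a + eta); first by have := a'2 c Bc ca; lra.
  have [cb|cb] := leP (b - eta) c; first by have := b'2 c Bc cb; lra.
  case: Bc => _; apply; apply: KB; rewrite /K /= in_itv /=; apply/andP; split; lra.
have := B01 _ Aa'; have := B01 _ Ab'; rewrite /= !in_itv /= => b'01 a'01.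
have h1 : d (f a) (f a') < e / 2.
  by apply: haP => //; rewrite ler0_norm; [lra|lra].
have h2 : d (f b) (f b') < e / 2.
  by apply: hbP => //; rewrite ger0_norm; [lra|lra].
have := metric_triangle (f a) (f a') (f b); rewrite E (metric_sym (f b') (f b)) in h1 *.
lra.
Qed.

(** If [f a = f b], then all times between [a] and [b] can be cut out. On a
    minimal cut set the path therefore never comes back, except across a gap. *)
Lemma minimal_cut_set : exists2 A, cut_set A &
  forall a b, A a -> A b -> a < b -> f a = f b -> forall c, a < c < b -> ~ A c.
Proof.
have [F FC Ftot|B [BC Bmax]] := @Zorn_bigcup R [set B | cut_set (`[0, 1] `\` B)].
  exact: chain_bigcap_cut_set.
exists (`[0, 1] `\` B) => // a b Aa Ab ab fab c /andP[ac cb] Ac.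
pose I := `]a, b[%classic : set R.
have IE x : I x <-> a < x < b by rewrite /I /= in_itv.
apply: (Bmax (B `|` I)); first split.
- by move=> x Bx; left.
- move=> /(_ c); case: Ac => _ nBc BI; apply: nBc; apply: BI; right.
  by apply/IE/andP.
have [cA A0 A1 A01 Agap] := BC.
have in01 x : (`[0, 1] `\` B) x -> 0 <= x <= 1 by move=> /A01; rewrite /= in_itv.
rewrite /= setDUr; split.
- apply: closedI => //; rewrite setDE; apply: closedI; first exact: itv_closed.
  exact/open_closedC/interval_open.
- split=> //; split; first exact: A01.
  by rewrite IE; have := in01 a Aa; lra.
- split=> //; split; first exact: A01.
  by rewrite IE; have := in01 b Ab; lra.
- by move=> x [/A01].
move=> x y [Ax [_ nIx]] [Ay [_ nIy]] xy gap.
have keep z : (`[0, 1] `\` B) z -> ~ I z ->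
    ((`[0, 1] `\` B) `&` (`[0, 1] `\` I)) z.
  by move=> Az nIz; split=> //; split => //; exact: A01.
have nIa : ~ I a by rewrite IE ltxx.
have nIb : ~ I b by rewrite IE ltxx andbF.
have gapa : ~ (x < a < y) by move=> /gap; apply; exact: keep.
have gapb : ~ (x < b < y) by move=> /gap; apply; exact: keep.
rewrite !IE in nIx nIy.
have [xa|xa] := ltP x a.
  apply: Agap => // z /andP[xz zy] Az; apply: (gap z); first by rewrite xz.
  by apply: keep => //; rewrite IE; lra.
have [bx|bx] := leP b x.
  apply: Agap => // z /andP[xz zy] Az; apply: (gap z); first by rewrite xz.
  by apply: keep => //; rewrite IE; lra.
have xE : x = a by lra.
have yE : y = b by lra.
by rewrite xE yE.
Qed.

(** A dense sequence on the path; indices that code no rational give [f 0]. *)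
Definition sample (k : nat) : T := f (ratr (odflt 0 (unpickle k : option rat))).

Lemma sample_dense t (e : R) : 0 <= t <= 1 -> 0 < e ->
  exists k, d (f t) (sample k) < e.
Proof.
move=> /andP[t0 t1] e0; have [|h h0 hP] := path_cont (t := t) _ e0.
  by rewrite t0.
have [r r01 tr] : exists2 r : rat, 0 <= (ratr r : R) <= 1 & `|t - ratr r| < h.
  have [t1'|t1'] := ltP t 1.
    have [|r] := rat_in_itvoo (x := t) (y := Num.min (t + h) 1).
      by rewrite lt_min t1'; lra.
    rewrite in_itv /= lt_min => /andP[h1 /andP[h2 h3]]; exists r; first by lra.
    by rewrite ltr0_norm; lra.
  have [|r] := rat_in_itvoo (x := Num.max (t - h) 0) (y := 1).
    by rewrite gt_max; lra.
  rewrite in_itv /= gt_max => /andP[/andP[h1 h2] h3]; exists r; first by lra.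
  by rewrite ger0_norm; lra.
by exists (pickle r); rewrite /sample pickleK /=; exact: hP.
Qed.

Variable A : set R.
Hypothesis cutA : cut_set A.
Hypothesis minA : forall a b, A a -> A b -> a < b -> f a = f b ->
  forall c, a < c < b -> ~ A c.

Let inA01 t : A t -> 0 <= t <= 1.
Proof. by case: cutA => _ _ _ A01 _ /A01; rewrite /= in_itv. Qed.

(** The part of the path up to time [t] grows with [t], so its distance to a
    sample point decreases; it has to drop for some sample point whenever a new
    point is reached. *)
Definition reach k t := inf [set d (f s) (sample k) | s in A `&` [set s | s <= t]].

Lemma reach_lb k t s : A s -> s <= t -> reach k t <= d (f s) (sample k).
Proof.
move=> As st; apply: ge_inf; last by exists s.
by exists 0 => _ [x _ <-]; exact: mdist_ge0.
Qed.

Lemma le_reach k t c : A t -> (forall s, A s -> s <= t -> c <= d (f s) (sample k)) ->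
  c <= reach k t.
Proof.
move=> At H; apply: lb_le_inf.
  by exists (d (f t) (sample k)); exists t => //; split => //=.
by move=> _ [s [As st] <-]; exact: H.
Qed.

Lemma reach_ge0 k t : A t -> 0 <= reach k t.
Proof. by move=> At; apply: le_reach => // s _ _; exact: mdist_ge0. Qed.

(** Summing these distances, truncated at 1, with weights gives a parameter that
    decreases along the path and distinguishes its points. *)
Definition height_seq t k := Num.min 1 (reach k t).
Definition height t := weight (height_seq t).

Lemma height_seq_unit t : A t -> unit_seq (height_seq t).
Proof.
move=> At k; rewrite /height_seq le_min ler01 reach_ge0//= ge_min lexx//.
Qed.

Lemma reach_near k t t' (e : R) : A t -> A t' -> 0 <= e ->
  (forall s, A s -> `|t - s| <= `|t - t'| -> d (f t) (f s) < e) ->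
  reach k t <= reach k t' + 2 * e.
Proof.
move=> At At' e0 near; rewrite -lerBlDr; apply: le_reach => // s As st'.
have [st|st] := leP s t; first by have := reach_lb k As st; lra.
have h1 : `|t - s| <= `|t - t'|.
  by rewrite ler0_norm ?ler0_norm; lra.
have := near s As h1; have := reach_lb k At (lexx t).
have := metric_triangle (f t) (f s) (sample k); lra.
Qed.

Lemma min1_le (a b c : R) : 0 <= c -> a <= b + c ->
  Num.min 1 a <= Num.min 1 b + c.
Proof. by move=> c0 ab; case: (leP 1 a) => ?; case: (leP 1 b) => ?; lra. Qed.

Lemma height_cont t (e : R) : A t -> 0 < e -> exists2 h : R, 0 < h &
  forall t', A t' -> `|t - t'| < h -> `|height t - height t'| < e.
Proof.
move=> At e0; have e9 : 0 < e / 9 by rewrite divr_gt0.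
have [h h0 hP] := path_cont (inA01 At) e9; exists h => // t' At' tt'.
have near s : A s -> `|t - s| <= `|t - t'| -> d (f t) (f s) < e / 9.
  by move=> As ts; apply: hP; [exact: inA01|exact: le_lt_trans tt'].
have H1 : height t <= height t' + 2 * (2 * (e / 9)).
  apply: weight_le; [exact: height_seq_unit|lra|move=> k].
  apply: min1_le; [lra|apply: reach_near => //; exact: ltW].
have H2 : height t' <= height t + 2 * (4 * (e / 9)).
  apply: weight_le; [exact: height_seq_unit|lra|move=> k].
  apply: min1_le; first by lra.
  rewrite -lerBlDr; apply: le_reach => // s As st.
  have [st'|st'] := leP s t'; first by have := reach_lb k As st'; lra.
  have h1 : `|t - s| <= `|t - t'|.
    by rewrite ger0_norm ?ger0_norm; lra.
  have := near s As h1; have := near t' At' (lexx _).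
  have := reach_lb k At' (lexx t').
  have := metric_triangle (f t') (f t) (sample k).
  have := metric_triangle (f t) (f s) (sample k).
  rewrite (metric_sym (f t') (f t)); lra.
rewrite ltr_norml; apply/andP; split; lra.
Qed.

Lemma height_eq t t' : A t -> A t' -> t <= t' -> f t = f t' -> height t = height t'.
Proof.
move=> At At'; rewrite le_eqVlt => /orP[/eqP->//|tt'] ft.
congr weight; apply/funext => k; congr Num.min; apply/eqP; rewrite eq_le; apply/andP; split.
  apply: le_reach => // s As st'; have [st|st] := leP s t; first exact: reach_lb.
  move: st'; rewrite le_eqVlt => /orP[/eqP->|st'].
    by rewrite -ft; apply: reach_lb.
  by have := minA At At' tt' ft (c := s); rewrite st st' => /(_ isT).
by apply: le_reach => // s As st; apply: reach_lb => //; apply: le_trans st _; exact: ltW.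
Qed.

(** The path up to time [t] is compact and misses [f t'], so it has a distance
    [r > 0] from it; a sample point closer than [r / 2] to [f t'] detects this. *)
Lemma height_lt t t' : A t -> A t' -> t <= t' -> f t <> f t' ->
  height t' < height t.
Proof.
move=> At At' tt' ft.
pose K := A `&` [set s | s <= t].
have cA : closed A by case: cutA.
have cK : compact K.
  have -> : K = `[0, 1] `&` K.
    apply/seteqP; split=> [x Kx|x []//]; split=> //.
    by case: Kx => /inA01; rewrite /= in_itv.
  apply: compact_closedI; first exact: segment_compact.
  by apply: closedI => //; exact: closed_le.
pose Q (S : set R) := exists2 r : R, 0 < r & forall s, S s -> K s -> r <= d (f s) (f t').
have [|S S' [r r0 rP] [r' r'0 r'P]|S S' SS [r r0 rP]|s [As st]|r r0 rP] :=
  @compact_induction _ K Q cK.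
- by exists 1.
- exists (Num.min r r'); first by rewrite lt_min r0.
  by move=> s [Ss|Ss] Ks; rewrite ge_min; [rewrite rP|rewrite r'P ?orbT].
- by exists r => // s /SS; exact: rP.
- have fst : 0 < d (f s) (f t').
    rewrite mdist_gt0; apply/eqP => fs; apply: ft.
    move: st; rewrite /= le_eqVlt => /orP[/eqP <-//|st].
    have st' : s < t' by apply: lt_le_trans tt'.
    move: tt'; rewrite le_eqVlt => /orP[/eqP ->//|tt''].
    by have := minA As At' st' fs (c := t); rewrite st tt'' => /(_ isT).
  have f2 : 0 < d (f s) (f t') / 2 by rewrite divr_gt0.
  have [h h0 hP] := path_cont (inA01 As) f2.
  exists (ball s h); first exact: nbhsx_ballx.
  exists (d (f s) (f t') / 2) => // s' ss' [As' _].
  have := hP s' (inA01 As') ss'.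
  have := metric_triangle (f s) (f s') (f t'); lra.
have [|k kP] := sample_dense (t := t') (e := Num.min 1 (r / 2)) (inA01 At').
  by rewrite lt_min ltr01 divr_gt0.
move: kP; rewrite lt_min => /andP[k1 kr].
have le1 : reach k t' <= d (f t') (sample k) by apply: reach_lb.
have le2 : r / 2 <= reach k t.
  apply: le_reach => // s As st; have := rP s (conj As st) (conj As st).
  have := metric_triangle (f s) (sample k) (f t').
  rewrite (metric_sym (sample k)); lra.
apply: (@weight_lt _ _ _ k); [exact: height_seq_unit|exact: height_seq_unit| |].
- move=> j; rewrite /height_seq le_min !ge_min lexx /=; apply/orP; right.
  by apply: le_reach => // s As st; apply: reach_lb => //; apply: le_trans tt'.
- by rewrite /height_seq lt_min gt_min (le_lt_trans le1 k1)/= gt_min; lra.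
Qed.

Lemma height_inj t t' : A t -> A t' -> height t = height t' <-> f t = f t'.
Proof.
move=> At At'; wlog tt' : t t' At At' / t <= t'.
  move=> H; have [tt'|/ltW tt'] := leP t t'; first exact: H.
  by split=> /esym E; apply/esym; apply/H.
split=> [E|]; last exact: height_eq.
apply: contrapT => ft; have := height_lt At At' tt' ft; lra.
Qed.

Lemma height_within_continuous : {within A, continuous height}.
Proof.
apply/(@within_continuous_metricP R R^o) => t At e e0.
have [h h0 hP] := height_cont At e0; exists h => // t' At' tt'.
by rewrite /mdist /= distrC; exact: hP.
Qed.

(** The height does not jump at a gap, because [f] agrees at its ends. *)
Lemma height_surj y : height 1 <= y <= height 0 -> exists2 t, A t & height t = y.
Proof.
case: cutA => cA A0 A1 _ Agap /andP[y1 y0].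
have closed_height (P : set R) : closed P -> closed (A `&` height @^-1` P).
  have /continuous_closedP H := height_within_continuous.
  by move=> /H; rewrite closed_setSI.
have cB : closed (A `&` height @^-1` [set z | y <= z]).
  by apply: closed_height; exact: closed_ge.
have cC : closed (A `&` height @^-1` [set z | z <= y]).
  by apply: closed_height; exact: closed_le.
have [||m [[Am my] m1 mP]] := closed_max (a := 0) (c := 1) cB; [by []|by []|].
have [||m' [[Am' my'] m0 m'P]] := closed_min (a := 1) (c := m) cC; [by []|by []|].
have [my2|my2] := leP (height m) y.
  by exists m => //; apply/eqP; rewrite eq_le my2.
exists m' => //; apply/eqP; rewrite eq_le; apply/andP; split=> //.
have mm' : m < m'.
  rewrite lt_neqAle m0 andbT; apply/eqP => E; move: my'; rewrite /= -E; lra.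
have /height_eq <- // : f m = f m'.
apply: Agap => // c /andP[mc cm'] Ac.
have [yc|yc] := leP y (height c).
  have := mP c (conj Ac yc); have := inA01 Ac => /andP[_ c1] /(_ c1); lra.
have := m'P c (conj Ac (ltW yc)) (ltW mc); lra.
Qed.

(** The height, scaled to [0, 1], is the parameter of the arc. *)
Lemma arc_in_cut_path : exists2 C, is_arc R (f 0) (f 1) C & C `<=` f @` `[0, 1].
Proof.
case: cutA => cA A0 A1 A01 _.
have M : height 1 < height 0 by apply: height_lt.
pose w := height 0 - height 1; have w0 : 0 < w by rewrite subr_gt0.
pose theta t := (height 0 - height t) / w.
have ctheta : {within A, continuous theta}.
  move=> t; apply: (@cvgM _ _ (nbhs (t : subspace A))); last exact: cvg_cst.
  by apply: cvgB; [exact: cvg_cst|exact: height_within_continuous].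
have thetaE t t' : theta t = theta t' <-> height t = height t'.
  split=> [|E]; last by rewrite /theta E.
  move=> /(congr1 (fun z => z * w)); rewrite /theta !divfK ?gt_eqF//; lra.
have /choice[g gP] : forall s, exists t, 0 <= s <= 1 -> A t /\ theta t = s.
  move=> s; have [/andP[s0 s1]|] := pselect (0 <= s <= 1); last by exists 0.
  have [|t At tE] := @height_surj (height 0 - s * w).
    apply/andP; split; last by rewrite gerBl mulr_ge0// ltW.
    have : s * w <= 1 * w by rewrite ler_wpM2r// ltW.
    rewrite mul1r /w; lra.
  exists t => _; split => //; rewrite /theta tE.
  by rewrite opprB addrC subrK mulfK// gt_eqF.
have in01 (s : R) : `[0, 1]%classic s -> 0 <= s <= 1 by rewrite /= in_itv.
exists ((f \o g) @` `[0, 1]); last first.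
  move=> _ [s /in01 s01 <-]; exists (g s) => //.
  by have [/A01] := gP s s01.
exists (f \o g); split => //.
(* The inverse image of [K] under [f \o g] is the image under [theta] of a
   compact set of times. *)
- apply/continuous_closedP => K cK; apply/closed_subspaceP.
  exists (theta @` (A `&` f @^-1` K)).
    apply: compact_closed; first exact: Rhausdorff.
    apply: continuous_compact.
      by apply: continuous_subspaceW ctheta; exact: subIsetl.
    have /continuous_closedP/(_ _ cK)/closed_subspaceP[V cV VE] := cf.
    have -> : A `&` f @^-1` K = `[0, 1] `&` (A `&` V).
      have VE' x : (V `&` `[0, 1]) x <-> (f @^-1` K `&` `[0, 1]) x by rewrite VE.
      apply/seteqP; split=> x.
      + move=> [Ax Kx]; have x01 := A01 _ Ax; split=> //; split=> //.
        by have [] := (VE' x).2 (conj Kx x01).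
      + by move=> [x01 [Ax Vx]]; split=> //; have [] := (VE' x).1 (conj Vx x01).
    by apply: compact_closedI; [exact: segment_compact|exact: closedI].
  apply/seteqP; split=> s [].
  + move=> [t [At Kt] ts] s01; split=> //; rewrite /from_subspace /=.
    have [Ag gs] := gP s (in01 _ s01).
    suff -> : f (g s) = f t by [].
    by apply/height_inj => //; apply/thetaE; rewrite gs.
  + move=> Ks s01; split=> //; have [Ag gs] := gP s (in01 _ s01).
    by exists (g s).
- move=> s s' /set_mem/in01 s01 /set_mem/in01 s01' /= E.
  have [Ag gs] := gP s s01; have [Ag' gs'] := gP s' s01'.
  by rewrite -gs -gs'; apply/thetaE/height_inj.
- have [|Ag gs] := gP 0; first by rewrite lexx ler01.
  by apply/height_inj => //; apply/thetaE; rewrite gs /theta subrr mul0r.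
- have [|Ag gs] := gP 1; first by rewrite lexx ler01.
  by apply/height_inj => //; apply/thetaE; rewrite gs /theta divff// gt_eqF.
Qed.

End ArcInPath.

Lemma arc_in_path (R : realType) (T : metricType R) (f : R -> T) :
  {within `[0, 1], continuous f} -> f 0 <> f 1 ->
  exists2 C, is_arc R (f 0) (f 1) C & C `<=` f @` `[0, 1].
Proof.
move=> cf f01; have [A cutA minA] := minimal_cut_set cf.
exact: (arc_in_cut_path cf f01 cutA minA).
Qed.

(** * Arcs and separation in a dendrite *)

(** The points that are joined to [u] by a connected set whose closure lies in [C]
    form a clopen part of [C]. The compact closure of such a set has a
    neighbourhood of positive width inside [C], which contains a path. *)
Lemma arc_in_open_metric (R : realType) (T : metricType R) (C : set T) (u v : T) :
  compact [set: T] -> locally_connected T -> open C -> connected C ->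
  C u -> C v -> u <> v -> exists2 A, is_arc R u v A & A `<=` C.
Proof.
move=> cT lcT oC cC Cu Cv uv.
have small a : C a -> exists V : set T,
    [/\ open V, connected V, V a & closure V `<=` C].
  move=> Ca; have /nbhs_ballP[r /= r0 rC] := open_nbhs_nbhs (conj oC Ca).
  have r2 : 0 < r / 2 by rewrite divr_gt0.
  have [V [oV cV Va Vr]] := lcT _ _ (nbhsx_ballx a _ r2).
  exists V; split=> // z clz; apply: rC; rewrite (splitr r).
  have [w [/Vr aw zw]] := clz _ (nbhsx_ballx z _ r2).
  by apply: ball_triangle aw _; exact: ball_sym.
pose E := [set b | exists S : set T, [/\ connected S, S u, S b & closure S `<=` C]].
have EC : E `<=` C by move=> b [S [_ _ Sb SC]]; exact/SC/subset_closure.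
have Ejoin b (V : set T) : E b -> V b -> connected V -> closure V `<=` C -> V `<=` E.
  move=> [S [cS Su Sb SC]] Vb cV VC c Vc; exists (S `|` V); split; [|by left|by right|].
  - by apply: connectedU => //; exists b.
  - by rewrite closureU => z [/SC|/VC].
have ECE : E = C.
  apply: cC.
  - have [V [oV cV Vu VC]] := small _ Cu.
    by exists u; exists V.
  - exists E; last by rewrite setIidr.
    rewrite openE => b Eb; have [V [oV cV Vb VC]] := small _ (EC _ Eb).
    apply: filterS (open_nbhs_nbhs (conj oV Vb)); exact: Ejoin Eb Vb cV VC.
  - exists (closure E); first exact: closed_closure.
    apply/seteqP; split=> [b Eb|b [Cb clb]].
      by split; [exact: EC|exact: subset_closure].
    have [V [oV cV Vb VC]] := small _ Cb.
    have [w [Ew Vw]] := clb _ (open_nbhs_nbhs (conj oV Vb)).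
    exact: Ejoin Ew Vw cV VC _ Vb.
have [S [cS Su Sv SC]] : E v by rewrite ECE.
have cK : compact (closure S).
  by apply: subclosed_compact cT _ => //; exact: closed_closure.
pose Q (A : set T) := exists2 r : R, 0 < r &
  forall s y, A s -> closure S s -> mdist s y < r -> C y.
have [|A B [r r0 rP] [s s0 sP]|A B AB [r r0 rP]|s Ss|r r0 rP] :=
  @compact_induction T (closure S) Q cK.
- by exists 1.
- exists (Num.min r s); first by rewrite lt_min r0.
  by move=> a y [Aa|Ba] Sa; rewrite lt_min => /andP[h1 h2]; [exact: rP h1|exact: sP h2].
- by exists r => // s y /AB; exact: rP.
- have /nbhs_ballP[r /= r0 rC] := open_nbhs_nbhs (conj oC (SC _ Ss)).
  have r2 : 0 < r / 2 by rewrite divr_gt0.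
  exists (ball s (r / 2)); first exact: nbhsx_ballx.
  exists (r / 2) => // a y sa _ ay; apply: rC; rewrite (splitr r).
  by apply: ball_triangle sa _; rewrite ballEmdist.
have [f [cf f0 f1 fS]] := path_near_connected cT lcT cS Su Sv r0.
have f01 : f 0 <> f 1 by rewrite f0 f1.
have [A] := arc_in_path cf f01; rewrite f0 f1 => arcA Af.
exists A => // z /Af [t]; rewrite /= in_itv /= => t01 <-.
have [s Ss st] := fS t t01; apply: rP st; exact: subset_closure.
Qed.

Lemma arc_in_open (R : realType) (W : topologicalType) (C : set W) (u v : W) :
  dendrite R W -> open C -> connected C -> C u -> C v -> u <> v ->
  exists2 A, is_arc R u v A & A `<=` C.
Proof.
move=> [_ cW [T [h]] lcW _] oC cC Cu Cv uv.
have ch := @hfun_continuous _ _ h; have cb := @hback_continuous _ _ h.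
have hK := @hfunK _ _ h; have bK := @hbackK _ _ h.
have imE (V : set W) : h @` V = hback h @^-1` V.
  apply/seteqP; split=> [_ [w Vw <-]|x Vx]; first by rewrite /= hK.
  by exists (hback h x).
have cT : compact [set: T].
  have -> : [set: T] = h @` [set: W].
    by apply/seteqP; split=> // x _; exists (hback h x).
  by apply: continuous_compact => //; exact: continuous_subspaceT.
have lcT : locally_connected T.
  move=> x U xU; have xU' : nbhs (hback h x) (h @^-1` U).
    by apply: ch; rewrite bK.
  have [V [oV cV Vx VU]] := lcW _ _ xU'.
  exists (h @` V); split.
  - by rewrite imE; apply: open_comp => // y _; exact: cb.
  - by apply: connected_continuous_connected => //; exact: continuous_subspaceT.
  - by exists (hback h x).
  - by move=> _ [w /VU Uw <-].
have [|||||A [f [cf fi fA f0 f1]] AC] :=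
  @arc_in_open_metric R T (h @` C) (h u) (h v) cT lcT.
- by rewrite imE; apply: open_comp => // y _; exact: cb.
- by apply: connected_continuous_connected => //; exact: continuous_subspaceT.
- by exists u.
- by exists v.
- by move=> /(can_inj hK).
exists (hback h @` A); last first.
  by move=> _ [x /AC [w Cw <-] <-]; rewrite hK.
exists (hback h \o f); split.
- by move=> t; apply: (@continuous_comp (subspace _) T W f (hback h)); [exact: cf|exact: cb].
- by move=> s t sI tI /(can_inj bK); exact: fi.
- by rewrite -fA image_comp.
- by rewrite /= f0 hK.
- by rewrite /= f1 hK.
Qed.

(* The name is shared with arcs of cyclic sequences. *)
Local Notation arc := Defs.arc.

Section Separation.
Context {R : realType} {W : topologicalType}.
Hypothesis dW : dendrite R W.
Implicit Types x y z w c : W.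

Lemma dendrite_hausdorff : hausdorff_space W.
Proof.
case: dW => _ _ [T [h]] _ _ x y xy.
apply: (can_inj (@hfunK _ _ h)); apply: metric_hausdorff => A B hA hB.
have hc := @hfun_continuous _ _ h.
by have [z [Az Bz]] := xy _ _ (hc x _ hA) (hc y _ hB); exists (h z).
Qed.

Lemma arcE x y A : is_arc R x y A -> x <> y -> arc R x y = A.
Proof.
case: dW => _ _ _ _ uW xA xy; have [B [xB uB]] := uW _ _ xy.
have arcB C : is_arc R x y C -> C = A by move=> xC; rewrite -(uB A)// -(uB C).
have Ax : A x.
  by case: xA => f [_ _ <- <- _]; exists 0 => //; rewrite /= in_itv /= lexx ler01.
apply/seteqP; split=> z; first by move=> [->//|[C /arcB ->]].
by move=> Az; right; exists A.
Qed.

Lemma is_arcP x y : x <> y -> is_arc R x y (arc R x y).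
Proof.
move=> xy; case: dW => _ _ _ _ uW; have [B [xB _]] := uW _ _ xy.
by rewrite (arcE xB).
Qed.

Lemma arcxx x : arc R x x = [set x].
Proof.
apply/seteqP; split=> [z [//|[A [f [_ fi _ f0 f1]]]]|z ->]; last by left.
have i0 : (0 : R) \in `[0, 1]%classic by rewrite inE /= in_itv /= lexx ler01.
have i1 : (1 : R) \in `[0, 1]%classic by rewrite inE /= in_itv /= lexx ler01.
have := fi 0 1 i0 i1; rewrite f0 f1 => /(_ erefl) /eqP.
by rewrite eq_sym oner_eq0.
Qed.

Lemma arc_connected x y : connected (arc R x y).
Proof.
have [->|xy] := pselect (x = y); first by rewrite arcxx; exact: connected1.
have [f [cf _ <- _ _]] := is_arcP xy.
by apply: connected_continuous_connected cf; exact: segment_connected.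
Qed.
Arguments arc_connected : clear implicits.

Lemma arc_closed x y : closed (arc R x y).
Proof.
apply: compact_closed; first exact: dendrite_hausdorff.
have [->|xy] := pselect (x = y); first by rewrite arcxx; exact: compact_set1.
have [f [cf _ <- _ _]] := is_arcP xy.
by apply: continuous_compact cf _; exact: segment_compact.
Qed.

Lemma arc_left x y : arc R x y x.
Proof. by left. Qed.

Lemma arc_right x y : arc R x y y.
Proof.
have [->|xy] := pselect (x = y); first exact: arc_left.
have [f [_ _ <- _ <-]] := is_arcP xy.
by exists 1 => //; rewrite /= in_itv /= lexx ler01.
Qed.

Lemma arc_sub_connected x y (C : set W) : open C -> connected C -> C x -> C y ->
  arc R x y `<=` C.
Proof.
move=> oC cC Cx Cy; have [->|xy] := pselect (x = y).
  by rewrite arcxx => _ ->.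
by have [A xA AC] := arc_in_open dW oC cC Cx Cy xy; rewrite (arcE xA).
Qed.

Lemma open_punctured x : open (~` [set x]).
Proof.
apply: closed_openC; apply: compact_closed; first exact: dendrite_hausdorff.
exact: compact_set1.
Qed.

Lemma open_component (O : set W) x : open O -> open (connected_component O x).
Proof.
case: dW => _ _ _ lcW _ oO; rewrite openE => y xy.
have Oy : O y by apply: connected_component_sub xy.
have [V [oV cV Vy VO]] := lcW _ _ (open_nbhs_nbhs (conj oO Oy)).
apply: filterS (open_nbhs_nbhs (conj oV Vy)).
rewrite (same_connected_component xy); exact: connected_component_max.
Qed.

(** The component of the complement of [x] that contains [y]; empty if [y = x].
    As a relation between [y] and [z] it says that [x] does not separate them. *)
Definition side x y : set W := connected_component (~` [set x]) y.

Lemma side_open x y : open (side x y).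
Proof. exact/open_component/open_punctured. Qed.

Lemma side_connected x y : connected (side x y).
Proof. exact: component_connected. Qed.
Arguments side_connected : clear implicits.

Lemma side_refl x y : y <> x -> side x y y.
Proof. by move=> yx; apply: connected_component_refl. Qed.

Lemma side_sym x y z : side x y z -> side x z y.
Proof. exact: connected_component_sym. Qed.

Lemma side_trans x y z w : side x y z -> side x z w -> side x y w.
Proof. exact: connected_component_trans. Qed.

Lemma side_neqr x y z : side x y z -> z <> x.
Proof. by move=> /connected_component_sub. Qed.

Lemma side_neql x y z : side x y z -> y <> x.
Proof. by move=> /side_sym /side_neqr. Qed.

Lemma sidexx x y : ~ side x x y.
Proof. by move=> /side_neql. Qed.

Lemma side_eq x y z : side x y z -> side x y = side x z.
Proof. exact: same_connected_component. Qed.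

Lemma side_max x y (C : set W) : connected C -> C y -> ~ C x -> C `<=` side x y.
Proof. by move=> cC Cy Cx; apply: connected_component_max => // z Cz zx; apply: Cx; rewrite -zx. Qed.

(** A component of the complement of [y] is open and connected, hence contains the
    arcs between its points; conversely an arc that avoids [y] is a connected set
    joining its ends. *)
Lemma arcP x y z : arc R x z y <-> ~ side y x z.
Proof.
split=> [axz xyz|nxyz].
  have := arc_sub_connected (side_open y x) (side_connected y x) (side_refl (side_neql xyz)) xyz.
  by move=> /(_ _ axz) /side_neqr.
apply: contrapT => nA; apply: nxyz.
exact: (side_max (arc_connected x z) (arc_left x z) nA) (arc_right x z).
Qed.

Lemma dendrite_connected : connected [set: W].
Proof.
case: dW => -[x _] _ _ _ _.
have -> : [set: W] = \bigcup_(y in setT) arc R x y.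
  by apply/seteqP; split=> // y _; exists y => //; exact: arc_right.
apply: bigcup_connected => [|y _]; last exact: arc_connected.
by exists x => y _; exact: arc_left.
Qed.

Lemma compl_sides x y : ~` (side x y `|` [set x]) = \bigcup_(z in ~` (side x y `|` [set x])) side x z.
Proof.
apply/seteqP; split=> z.
  by move=> nz; exists z => //; apply: side_refl => zx; apply: nz; right.
move=> [w nw wz] [yz|zx]; last by have := side_neqr wz.
by apply: nw; left; apply: side_trans yz (side_sym wz).
Qed.

Lemma side_closedU x y : closed (side x y `|` [set x]).
Proof.
rewrite -openC compl_sides; apply: bigcup_open => z _; exact: side_open.
Qed.

(** Otherwise the side would be open and closed. *)
Lemma closure_side x y : y <> x -> closure (side x y) x.
Proof.
move=> yx; apply: contrapT => nx.
have clE : closure (side x y) = side x y.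
  apply/seteqP; split; last exact: subset_closure.
  move=> z clz; have : closure (side x y `|` [set x]) z.
    by apply: closureS clz => w; left.
  rewrite -(closure_id _).1; last exact: side_closedU.
  by case=> // zx; rewrite zx in clz.
have := dendrite_connected (B := side x y).
move=> H; have E : side x y = setT.
  apply: H; first by exists y; exact: side_refl.
  - by exists (side x y); rewrite ?setTI//; exact: side_open.
  - exists (side x y); rewrite ?setTI//; rewrite -clE; exact: closed_closure.
by have /side_neqr : side x y x by rewrite E.
Qed.

Lemma side_connectedU x y : y <> x -> connected (side x y `|` [set x]).
Proof.
move=> yx; have -> : side x y `|` [set x] = closure (side x y).
  apply/seteqP; split=> z.
    by move=> [/subset_closure//|->]; exact: closure_side.
  move=> clz; rewrite (closure_id (_ `|` _)).1; last exact: side_closedU.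
  by apply: closureS clz => w; left.
by apply: connected_closure; exact: side_connected.
Qed.

(** It is a union of closed sides, which all contain [x]. *)
Lemma side_complement_connected x y : connected (~` side x y).
Proof.
have -> : ~` side x y = [set x] `|` \bigcup_(z in ~` (side x y `|` [set x])) (side x z `|` [set x]).
  apply/seteqP; split=> z.
    move=> nz; have [->|zx] := pselect (z = x); first by left.
    by right; exists z; [move=> []|left; exact: side_refl].
  move=> [->|[w nw [wz|->]]]; try by move=> /side_neqr.
  by move=> yz; apply: nw; left; apply: side_trans yz (side_sym wz).
have -> : [set x] `|` \bigcup_(z in ~` (side x y `|` [set x])) (side x z `|` [set x]) =
   \bigcup_(z in [set z | z = x \/ (~` (side x y `|` [set x])) z]) (side x z `|` [set x]).
  apply/seteqP; split=> z.
    by move=> [->|[w nw h]]; [exists x; [left|right]|exists w => //; right].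
  by move=> [w [->|nw] h]; [case: h => [/sidexx//|->]; left|right; exists w].
apply: bigcup_connected; first by exists x => z _; right.
move=> z [->|nz].
  have -> : side x x `|` [set x] = [set x].
    by apply/seteqP; split=> w; [case=> [/sidexx|]|right].
  exact: connected1.
by apply: side_connectedU => zx; apply: nz; right.
Qed.

(** Antisymmetry of the order on the points seen from [x]. *)
Lemma side_antisym x y z : ~ side y x z -> ~ side z x y -> y = z.
Proof.
move=> h1 h2; apply: contrapT => yz; apply: h2.
have [->|xy] := pselect (x = y); first exact: side_refl.
apply: (side_max (side_connectedU xy)); last by right.
- by left; exact: side_refl.
- by case=> // /esym.
Qed.

(** The arc from [x] to [y] is connected and covered by the closed sets [arc x z]
    and [arc y z], so these meet on it. *)
Lemma center_exists x y z :
  exists c, [/\ ~ side c x y, ~ side c y z & ~ side c x z].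
Proof.
suff [c []] : exists c, [/\ arc R x y c, arc R y z c & arc R x z c].
  by move=> /arcP h1 /arcP h2 /arcP h3; exists c.
apply: contrapT => nc.
have cov c : arc R x y c -> arc R x z c \/ arc R y z c.
  move=> /arcP nxy; apply: contrapT => /not_orP[h1 h2]; apply: nxy.
  have xz : side c x z by apply: contrapT => /arcP.
  have yz : side c y z by apply: contrapT => /arcP.
  by apply: side_trans xz (side_sym yz).
have E : arc R x y `&` arc R x z = arc R x y.
  apply: (arc_connected x y).
  - by exists x; split; exact: arc_left.
  - exists (~` arc R y z); first exact/closed_openC/arc_closed.
    apply/seteqP; split=> c [h1 h2]; split=> //.
      by move=> h3; apply: nc; exists c.
    by have [] := cov c h1.
  - by exists (arc R x z) => //; exact: arc_closed.
apply: nc; exists y; split; [exact: arc_right|exact: arc_left|].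
suff [] : (arc R x y `&` arc R x z) y by [].
by rewrite E; exact: arc_right.
Qed.

(** Seen from [c], at least two of the three points lie on other sides than [c'],
    so they are in the same place as [c] when seen from [c']: [c'] would not
    separate them. *)
Lemma center_unique x y z c c' :
  ~ side c x y -> ~ side c y z -> ~ side c x z ->
  ~ side c' x y -> ~ side c' y z -> ~ side c' x z -> c = c'.
Proof.
move=> h1 h2 h3 h1' h2' h3'; apply: contrapT => cc'.
have key a b : ~ side c c' a -> ~ side c c' b -> ~ side c' a b -> False.
  move=> ha hb hab.
  have ac : side c' c a by apply: contrapT => h; apply: cc'; apply: side_antisym (a) _ _ _ _ => /side_sym.
  have bc : side c' c b by apply: contrapT => h; apply: cc'; apply: side_antisym (b) _ _ _ _ => /side_sym.
  by apply: hab; apply: side_trans (side_sym ac) bc.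
have [hx|hx] := pselect (side c c' x).
  have hy : ~ side c c' y by move=> hy; apply: h1; apply: side_trans (side_sym hx) hy.
  have hz : ~ side c c' z by move=> hz; apply: h3; apply: side_trans (side_sym hx) hz.
  exact: key hy hz h2'.
have [hy|hy] := pselect (side c c' y).
  have hz : ~ side c c' z by move=> hz; apply: h2; apply: side_trans (side_sym hy) hz.
  exact: key hx hz h3'.
exact: key hx hy h1'.
Qed.

End Separation.

(** * Betweenness and branch points *)
Section Betweenness.
Context {R : realType} {W : topologicalType}.
Hypothesis dW : dendrite R W.
Implicit Types x y z w c : W.

(** Equivalent to membership in the arc by [arcP]. In this form most laws of
    betweenness only say that [side y] is symmetric and transitive. *)
Definition btw x y z := ~ side y x z.

Lemma btw_sym x y z : btw x y z -> btw z y x.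
Proof. by move=> h /side_sym. Qed.

Lemma btw_left x z : btw x x z.
Proof. exact: sidexx. Qed.

Lemma btw_right x z : btw x z z.
Proof. exact/btw_sym/btw_left. Qed.

Lemma btw_split w x y z : btw x y z -> btw x y w \/ btw w y z.
Proof.
move=> h; apply: contrapT => /not_orP[/contrapT h1 /contrapT h2].
by apply: h; apply: side_trans h1 h2.
Qed.

Lemma btw_antisym x y z : btw x y z -> btw x z y -> y = z.
Proof. exact: (side_antisym dW). Qed.

Lemma btw_antisyml x y z : btw x y z -> btw y x z -> x = y.
Proof. by move=> /btw_sym h1 /btw_sym h2; apply: btw_antisym h2 h1. Qed.

Lemma btwxx x y : btw x y x -> y = x.
Proof. by move=> h; apply: contrapT => yx; apply: h; apply: side_refl => /esym. Qed.

Lemma btw_trans x y z w : btw x y z -> btw x z w -> btw x y w.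
Proof.
move=> h1 h2; have [//|h3] := btw_split w h1.
have [h4|h4] := btw_split y h2.
  by rewrite (btw_antisym h1 h4) in h3 *.
by rewrite (btw_antisym (btw_sym h4) h3) in h2 *.
Qed.

Lemma btw_trans2 x y z w : btw x y z -> btw x z w -> btw y z w.
Proof.
move=> h1 h2; have [h4|//] := btw_split y h2.
by rewrite (btw_antisym h1 h4); exact: btw_left.
Qed.

Lemma btw_glue x y z w : btw x y z -> btw y z w -> y <> z -> btw x z w.
Proof.
move=> h1 h2 yz; have [h3|//] := btw_split x h2.
by case: yz; exact: btw_antisym h1 (btw_sym h3).
Qed.

Lemma btw_glue2 x y z w : btw x y z -> btw y z w -> y <> z -> btw x y w.
Proof. by move=> h1 h2 yz; apply: btw_trans (h1) _; exact: btw_glue h1 h2 yz. Qed.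

Lemma gate_side d r c : btw d r c -> r <> c -> side c d r.
Proof. by move=> h rc; apply: contrapT => h'; apply: rc; exact: (btw_antisym h h'). Qed.

Lemma gate_side' d r c : btw d r c -> r <> d -> side d r c.
Proof. by move=> h rd; apply/side_sym/gate_side => //; exact: btw_sym. Qed.

Lemma interior_point x y : x <> y -> exists t, [/\ t <> x, t <> y & btw x t y].
Proof.
move=> xy; have [f [_ fi fA f0 f1]] := is_arcP dW xy.
have i0 : (0 : R) \in `[0, 1]%classic by rewrite inE /= in_itv /=; lra.
have i1 : (1 : R) \in `[0, 1]%classic by rewrite inE /= in_itv /=; lra.
have i2 : (2^-1 : R) \in `[0, 1]%classic by rewrite inE /= in_itv /=; lra.
exists (f 2^-1); split.
- by rewrite -f0 => /(fi _ _ i2 i0); lra.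
- by rewrite -f1 => /(fi _ _ i2 i1); lra.
- by apply/(arcP dW); rewrite -fA; exists 2^-1 => //; exact/set_mem.
Qed.

Lemma closure_sideE x y z : closure (side x y) z -> side x y z \/ z = x.
Proof.
move=> clz; have : closure (side x y `|` [set x]) z.
  by apply: closureS clz => w; left.
by rewrite -(closure_id _).1 //; exact: side_closedU dW _ _.
Qed.

Lemma three_sides_branch c x y z : x <> c -> y <> c -> z <> c ->
  btw x c y -> btw y c z -> btw x c z -> branch_points c.
Proof.
move=> xc yc zc xy yz xz.
pose g (n : nat) := side c (if n is 0 then x else if n is 1 then y else z).
have eqs a b : a <> c -> b <> c -> side c a = side c b -> side c a b.
  by move=> _ bc ->; exact: side_refl.
have gi : {in `I_3 &, injective g}.
  move=> m n /set_mem + /set_mem; rewrite /g.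
  move: m n => [|[|[|m]]] [|[|[|n]]]//= _ _ E; exfalso.
  - exact/xy/eqs.
  - exact/xz/eqs.
  - by apply: xy; apply/side_sym/eqs.
  - exact/yz/eqs.
  - by apply: xz; apply/side_sym/eqs.
  - by apply: yz; apply/side_sym/eqs.
rewrite /branch_points /= -(card_le_eql (inj_card_eq gi)); apply: subset_card_le.
by move=> _ [[|[|[|n]]] //= _ <-]; rewrite /g; [exists x|exists y|exists z].
Qed.

Lemma branch_three_sides c : branch_points c -> exists x y z,
  [/\ x <> c, y <> c & z <> c] /\ [/\ btw x c y, btw y c z & btw x c z].
Proof.
move=> /pcard_leP[g].
have gP n : (n < 3)%N -> exists2 x, x <> c & side c x = g n.
  move=> n3; have [x xc xE] : hat c (g n) by apply: funS.
  by exists x => //.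
have gd m n : (m < 3)%N -> (n < 3)%N -> g m = g n -> m = n.
  by move=> m3 n3; apply: inj; rewrite inE.
have [x xc xg] := gP 0 isT; have [y yc yg] := gP 1 isT; have [z zc zg] := gP 2 isT.
exists x, y, z; split=> //; split => /side_eq; rewrite ?xg ?yg ?zg => /gd.
- by move=> /(_ isT isT).
- by move=> /(_ isT isT).
- by move=> /(_ isT isT).
Qed.

(** Of three sides at [c], two at most contain one of the points [x] and [y]. *)
Lemma side_avoiding c x y : branch_points c ->
  exists z, [/\ z <> c, btw z c x & btw z c y].
Proof.
move=> /branch_three_sides[a [b [d [[ac bc dc] [ab bd ad]]]]].
have two p : btw a c p /\ btw b c p \/ btw a c p /\ btw d c p \/ btw b c p /\ btw d c p.
  have := btw_split p ab; have := btw_split p bd; have := btw_split p ad.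
  have s q : btw p c q -> btw q c p by exact: btw_sym.
  by move=> [|/s] h1 [|/s] h2 [|/s] h3; tauto.
have := two x; have := two y => h1 h2.
have [[h3 h4]|[[h3 h4]|[h3 h4]]] : (btw a c x /\ btw a c y) \/ (btw b c x /\ btw b c y) \/ (btw d c x /\ btw d c y) by tauto.
- by exists a.
- by exists b.
- by exists d.
Qed.

Lemma btw_outside c z p q w : side c z w -> btw z c p -> btw z c q -> ~ btw p w q.
Proof.
move=> zw zp zq; apply.
apply: (@side_max _ w p (~` side c z)) => //.
exact: side_complement_connected dW c z.
Qed.

Lemma center_branch (x y z : branch W) c : btw (\val x) c (\val y) ->
  btw (\val y) c (\val z) -> btw (\val x) c (\val z) -> branch_points c.
Proof.
move=> h1 h2 h3.
have [<-|xc] := pselect (\val x = c); first exact: (set_mem (valP x)).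
have [<-|yc] := pselect (\val y = c); first exact: (set_mem (valP y)).
have [<-|zc] := pselect (\val z = c); first exact: (set_mem (valP z)).
exact: three_sides_branch h1 h2 h3.
Qed.

Lemma arc_centerP x y z : [/\ btw x (arc_center R x y z) y,
  btw y (arc_center R x y z) z & btw x (arc_center R x y z) z].
Proof.
rewrite /arc_center; case: xgetP => [c -> [[]]|].
  by move=> /(arcP dW) h1 /(arcP dW) h2 /(arcP dW) h3.
have [c [/(arcP dW) h1 /(arcP dW) h2 /(arcP dW) h3]] := center_exists dW x y z.
by move=> /(_ c); case.
Qed.

Lemma val_Kfun (x y z : branch W) :
  \val (Kfun R x y z) = arc_center R (\val x) (\val y) (\val z).
Proof.
have [h1 h2 h3] := arc_centerP (\val x) (\val y) (\val z).
by rewrite /Kfun insubdK//; exact/mem_set/(center_branch h1 h2 h3).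
Qed.

Lemma KfunP (x y z : branch W) : let c := \val (Kfun R x y z) in
  [/\ btw (\val x) c (\val y), btw (\val y) c (\val z) & btw (\val x) c (\val z)].
Proof. by rewrite /= val_Kfun; exact: arc_centerP. Qed.

Lemma Kfun_eq (x y z k : branch W) : btw (\val x) (\val k) (\val y) ->
  btw (\val y) (\val k) (\val z) -> btw (\val x) (\val k) (\val z) -> Kfun R x y z = k.
Proof.
move=> h1 h2 h3; apply: val_inj; have [k1 k2 k3] := KfunP x y z.
exact: (center_unique dW k1 k2 k3 h1 h2 h3).
Qed.

Lemma KfunE (x y z : branch W) : Kfun R x y z = y <-> btw (\val x) (\val y) (\val z).
Proof.
split=> [<-|h]; first by have [_ _] := KfunP x y z.
by apply: Kfun_eq => //; [exact: btw_right|exact: btw_left].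
Qed.

Hypothesis dX : dense (@branch_points W).

Lemma branch_in_open (U : set W) : open U -> U !=set0 ->
  exists x : branch W, U (\val x).
Proof.
by move=> oU U0; have [x [Ux bx]] := dX U0 oU; exists (SigSub (mem_set bx)).
Qed.

(** Near an interior point [t] of the arc there is a branch point [b]. The center
    of [x], [y] and [b] is on the arc; it is [b] or has three sides. *)
Lemma branch_between x y : x <> y ->
  exists z : branch W, [/\ \val z <> x, \val z <> y & btw x (\val z) y].
Proof.
move=> xy; have [t [tx ty xty]] := interior_point xy.
have [_ _ _ lcW _] := dW.
pose O := ~` [set x] `&` ~` [set y] : set W.
have oO : open O by apply: openI; exact: open_punctured dW _.
have Ot : O t by split.
have [V [oV cV Vt VO]] := lcW _ _ (open_nbhs_nbhs (conj oO Ot)).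
have [b Vb] : exists b : branch W, V (\val b) by apply: branch_in_open => //; exists t.
have [c [xcy ycb xcb]] := center_exists dW x y (\val b).
(* As [V] is connected, it contains all points between [t] and [b]; if the center
   were [x] or [y], then that point would be between [t] and [b]. *)
have Vtb s : btw t s (\val b) -> V s.
  move=> h; apply: contrapT => nVs; apply: h.
  exact: (side_max cV Vt nVs) Vb.
have cx : c <> x.
  move=> cx; rewrite cx in xcy ycb xcb.
  have [h|h] := btw_split t ycb.
    by apply: tx; apply/esym; apply: btw_antisym h (btw_sym xty).
  by have [nx _] := VO _ (Vtb _ h); exact: nx.
have cy : c <> y.
  move=> cy; rewrite cy in xcy ycb xcb.
  have [h|h] := btw_split t xcb.
    by apply: ty; apply/esym; apply: btw_antisym h xty.
  by have [_ ny] := VO _ (Vtb _ h); exact: ny.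
have [bc|cb] := pselect (\val b = c); first by exists b; rewrite bc.
have bc : branch_points c.
  apply: (three_sides_branch (x := x) (y := y) (z := \val b)) => //; exact: nesym.
by exists (SigSub (mem_set bc)).
Qed.

(** Arcs are nowhere dense: at any branch point there is a side that contains
    neither end of a given arc, hence is disjoint from the arc. *)
Lemma open_avoids_arcs (l : seq (W * W)) (V : set W) : open V -> V !=set0 ->
  exists x : branch W, V (\val x) /\ forall p, List.In p l -> ~ btw p.1 (\val x) p.2.
Proof.
move=> oV V0; suff [V' [oV' V'0 V'V H]] : exists V', [/\ open V', V' !=set0, V' `<=` V &
    forall p w, List.In p l -> V' w -> ~ btw p.1 w p.2].
  have [x Vx] := branch_in_open oV' V'0.
  by exists x; split; [exact: V'V|move=> p pl; exact: H].
elim: l => [|[p q] l [V' [oV' V'0 V'V H]]]; first by exists V; split.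
have [b V'b] := branch_in_open oV' V'0.
have [z [zb zp zq]] := side_avoiding p q (set_mem (valP b)).
have [w [zw V'w]] := closure_side dW zb (open_nbhs_nbhs (conj oV' V'b)).
exists (V' `&` side (\val b) z); split.
- by apply: openI => //; exact: side_open dW _ _.
- by exists w.
- by move=> u [/V'V].
- move=> [p' q'] u /= [[<- <-]|inl] [V'u zu]; last exact: H inl V'u.
  exact: btw_outside zu zp zq.
Qed.

Lemma dense_sequence : exists D : nat -> W, forall U : set W,
  open U -> U !=set0 -> exists k, U (D k).
Proof.
have [_ cW [T [h]] _ _] := dW.
have hc := @hfun_continuous _ _ h; have bc := @hback_continuous _ _ h.
have net n : exists l : seq W, forall w, exists2 c, List.In c l &
    mdist (h w) (h c) < n.+1%:R^-1 :> R.
  pose Q (S : set W) := exists l : seq W, forall w, S w -> exists2 c, List.In c l &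
    mdist (h w) (h c) < n.+1%:R^-1 :> R.
  have [|A B [l lP] [m mP]|A B AB [l lP]|w _|l lP] := @compact_induction W setT Q cW.
  - by exists [::].
  - exists (l ++ m) => w [/lP|/mP] [c cl cw]; exists c => //; apply: List.in_or_app.
      by left.
    by right.
  - by exists l => w /AB /lP.
  - have n0 : 0 < n.+1%:R^-1 :> R by rewrite invr_gt0.
    exists (h @^-1` ball (h w) n.+1%:R^-1); first exact/hc/nbhsx_ballx.
    exists [:: w] => u; rewrite /= ballEmdist /= => wu; exists w; first by left.
    by rewrite metric_sym.
  - by exists l => w; exact: lP.
have [w0 _] := dW; have [w _] := w0.
have /choice[l lP] := net.
exists (fun k => nth w (l (nth 0 (CodeSeq.decode k) 0)) (nth 0 (CodeSeq.decode k) 1))%N => U oU [u Uu].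
have : nbhs (h u) (hback h @^-1` U).
  by apply: bc; rewrite hfunK; exact: open_nbhs_nbhs.
move=> /nbhs_ballP[r /= r0 rU].
have [n nr] : exists n, n.+1%:R^-1 < r.
  exists (Num.truncn r^-1); rewrite invf_plt ?posrE//.
  exact: truncnS_gt.
have [c cl uc] := lP n u.
have [i iE] : exists i, nth w (l n) i = c.
  elim: (l n) cl => //= a s IH [->|/IH[i iE]]; first by exists 0.
  by exists i.+1.
exists (CodeSeq.code [:: n; i]); rewrite CodeSeq.codeK /= iE.
suff : (hback h @^-1` U) (h c) by rewrite /= hfunK.
by apply: rU; rewrite ballEmdist /=; exact: lt_trans uc nr.
Qed.

(** A branch point is the center of three members of a dense sequence, chosen in
    three of its sides. *)
Lemma enum_branch : exists e : nat -> branch W, forall x : branch W, exists n, e n = x.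
Proof.
have [D DP] := dense_sequence.
have [[w _] _ _ _ _] := dW.
have [x0 _] : exists x : branch W, setT (\val x).
  by apply: branch_in_open; [exact: openT|exists w].
have /choice[k kP] : forall x : branch W, exists k : seq nat,
    [/\ btw (D (nth 0%N k 0%N)) (\val x) (D (nth 0%N k 1)), btw (D (nth 0%N k 1)) (\val x) (D (nth 0%N k 2)) &
        btw (D (nth 0%N k 0%N)) (\val x) (D (nth 0%N k 2))].
  move=> x; have [a [b [c [[ax bx cx] [ab bc ac]]]]] := branch_three_sides (set_mem (valP x)).
  have pick y : y <> \val x -> exists k, side (\val x) y (D k).
    move=> yx; apply: DP; first exact: side_open dW _ _.
    by exists y; exact: side_refl.
  have [i ai] := pick a ax; have [j bj] := pick b bx; have [m cm] := pick c cx.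
  exists [:: i; j; m] => /=.
  split=> h; [apply: ab|apply: bc|apply: ac].
  - exact: side_trans ai (side_trans h (side_sym bj)).
  - exact: side_trans bj (side_trans h (side_sym cm)).
  - exact: side_trans ai (side_trans h (side_sym cm)).
have kinj (x y : branch W) : k x = k y -> x = y.
  move=> E; apply: val_inj; have [h1 h2 h3] := kP x; have [] := kP y; rewrite -E => h1' h2' h3'.
  exact: (center_unique dW h1 h2 h3 h1' h2' h3').
exists (fun n => xget x0 [set x | CodeSeq.code (k x) = n]) => x.
exists (CodeSeq.code (k x)); case: xgetP => [y -> /= E|/(_ x)]; last by case.
by apply: kinj; apply: (can_inj CodeSeq.codeK).
Qed.

End Betweenness.

(** * Back and forth between kaleidoscopic colourings *)
Section Colours.
Context {R : realType} {W : topologicalType} {M : Type}.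
Hypothesis dW : dendrite R W.
Hypothesis dX : dense (@branch_points W).
Hypothesis M3 : `I_3 #<= [set: M].
Implicit Types (x y z a b c : branch W) (k : component W -> M).
Local Notation btw x y z := (btw (\val x) (\val y) (\val z)).

(** The colour of the direction of [w] at [x]. With the value [None] at [x] itself,
    a map that preserves [col] is injective. *)
Definition col k x (w : W) : option M :=
  if pselect (w <> \val x) is left wx then Some (k (Phi wx)) else None.

Lemma colE k x w (wx : w <> \val x) : col k x w = Some (k (Phi wx)).
Proof.
rewrite /col; case: pselect => // wx'.
by rewrite (Prop_irrelevance wx wx').
Qed.

Lemma colxx k x : col k x (\val x) = None.
Proof. by rewrite /col; case: pselect. Qed.

Lemma col_side k x w w' : side (\val x) w w' -> col k x w = col k x w'.
Proof.
move=> ww'; rewrite (colE _ (side_neql ww')) (colE _ (side_neqr ww')).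
by congr (Some (k _)); apply: component_eq => //=; exact: side_eq.
Qed.

Lemma three_colours : exists m1 m2 m3 : M, [/\ m1 <> m2, m1 <> m3 & m2 <> m3].
Proof.
have /card_leP[g] := M3.
have i0 : `I_3 0 by []. have i1 : `I_3 1 by []. have i2 : `I_3 2 by [].
pose j n (h : `I_3 n) : `I_3 := SigSub (mem_set h).
exists (\val (g (j _ i0))), (\val (g (j _ i1))), (\val (g (j _ i2))).
have gi m n (hm : `I_3 m) (hn : `I_3 n) : \val (g (j _ hm)) = \val (g (j _ hn)) -> m = n.
  by move=> /val_inj/(inj (in_setT _) (in_setT _)) [].
by split=> /gi.
Qed.

Lemma other_colour (m : M) : exists m', m <> m'.
Proof.
have [m1 [m2 [m3 [h12 h13 h23]]]] := three_colours.
have [E|] := pselect (m = m1); last by exists m1.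
by exists m2; rewrite E.
Qed.

Section OneColouring.
Variable k : component W -> M.
Hypothesis kk : kaleidoscopic k R.

Lemma col_eq_side x w w' : w <> \val x -> col k x w = col k x w' -> side (\val x) w w'.
Proof.
move=> wx; have [->|w'x] := pselect (w' = \val x); first by rewrite colxx (colE _ wx).
rewrite (colE _ wx) (colE _ w'x) => -[E].
have [[_ kinj _] _] := (kk.1 x, kk.2).
have : Phi wx = Phi w'x by apply: kinj => //; rewrite inE.
move=> /(congr1 (@cset W)) /= E'.
have : side (\val x) w' w' by exact: side_refl.
by rewrite /side -E'.
Qed.

Lemma col_surj x m : exists y, col k x (\val y) = Some m.
Proof.
have [[_ _ ks] _] := (kk.1 x, kk.2).
have [[x' C [w wx CE]] /= xx' kC] := ks m I.
subst x'.
have [y wy] : exists y : branch W, side (\val x) w (\val y).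
  apply: (branch_in_open dX); first exact: (side_open dW _ _).
  by exists w; exact: side_refl.
exists y; rewrite -(col_side k wy) (colE _ wx) -kC; congr (Some (k _)).
exact: component_eq.
Qed.

Lemma col_between x y m m' : x <> y -> m <> m' -> exists z,
  [/\ btw x z y, z <> x, z <> y, col k z (\val x) = Some m & col k z (\val y) = Some m'].
Proof.
move=> xy mm'; have [z [zx [zy [[az nz] kx ky]]]] := kk.2 x y xy m m' mm'.
exists z; split.
- exact/(arcP dW).
- by move=> E; apply: nz; left; rewrite E.
- by move=> E; apply: nz; right; rewrite E.
- by rewrite (colE _ zx) kx.
- by rewrite (colE _ zy) ky.
Qed.

Lemma col_hang x m m' : exists z, col k x (\val z) = Some m /\ col k z (\val x) = Some m'.
Proof.
have [y xy] := col_surj x m; have [m'' mm''] := other_colour m'.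
have xNy : x <> y by move=> E; rewrite E colxx in xy.
have [z [xzy zx zy zx' zy']] := col_between xNy mm''.
exists z; split=> //; rewrite -xy; apply: col_side; apply: contrapT => h.
by apply: zx; apply: val_inj; exact: (esym (btw_antisyml dW xzy h)).
Qed.

End OneColouring.

(** The point [r] is the projection of [c] to the subtree spanned by [f0 :: F].
    When a point [f] is added to [F], the projection moves to the center of [c],
    [r] and [f]. *)
Lemma projection_exists c (f0 : branch W) (F : seq (branch W)) :
  (forall f f', List.In f (f0 :: F) -> List.In f' (f0 :: F) -> ~ btw f c f') ->
  exists r, [/\ r <> c, exists f1 f2, [/\ List.In f1 (f0 :: F), List.In f2 (f0 :: F) & btw f1 r f2] &
    forall f, List.In f (f0 :: F) -> btw f r c].
Proof.
elim: F => [|f F IH] H.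
  exists f0; split.
  - by move=> E; apply: (H f0 f0); [left|left|rewrite E; exact: btw_left].
  - by exists f0, f0; split; [left|left|exact: btw_left].
  - by move=> f [<-|//]; exact: btw_left.
have sub g : List.In g (f0 :: F) -> List.In g [:: f0, f & F] by move=> [->|h]; [left|right; right].
have [|r [rc [f1 [f2 [F1 F2 f1rf2]]] rF]] := IH.
  by move=> g g' /sub h /sub h'; exact: H.
pose q := Kfun R c r f; have [] := KfunP dW c r f; rewrite -/q => cqr rqf cqf.
have qc : q <> c.
  move=> qc; rewrite qc in rqf; have r0 := rF f0 (or_introl erefl).
  apply: (H f0 f); [by left|by right; left|].
  apply: (btw_glue dW r0 rqf); by move=> /val_inj.
exists q; split=> //.
- have [qr|qr] := pselect (q = r).
    by exists f1, f2; split; [exact: sub|exact: sub|rewrite qr].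
  have qr' : \val q <> \val r by move=> /val_inj.
  have [h1|h1] := btw_split (\val f1) rqf; last first.
    by exists f1, f; split=> //; [exact: sub|right; left].
  have [h2|h2] := btw_split (\val f2) rqf; last first.
    by exists f2, f; split=> //; [exact: sub|right; left].
  exfalso; have [h3|h3] := btw_split (\val q) f1rf2.
    by apply: qr'; apply: (btw_antisym dW (btw_sym h1) h3).
  by apply/qr'/esym; apply: (btw_antisym dW (btw_sym h3) (btw_sym h2)).
- move=> g [<-|[<-|gF]].
  + apply: btw_sym; apply: (btw_trans dW cqr); apply: btw_sym; apply: rF; by left.
  + exact: btw_sym.
  + apply: btw_sym; apply: (btw_trans dW cqr); apply: btw_sym; apply: rF; by right.
Qed.

Lemma btw_linear x y z (w : branch W) : btw x y w -> btw x z w -> btw x y z \/ btw x z y.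
Proof.
move=> h1 h2; have [h|h] := btw_split (\val y) h2; first by right.
by left; apply/btw_sym/(btw_trans2 dW (btw_sym h))/btw_sym.
Qed.

(** A finite partial isomorphism, as a list of pairs. Betweenness is preserved as
    well, because it can be read off from the colours. *)
Definition iso k1 k2 (l : seq (branch W * branch W)) := forall p q : branch W * branch W,
  List.In p l -> List.In q l -> col k2 p.2 (\val q.2) = col k1 p.1 (\val q.1).

(** The first components span a subtree without further branching, so that a new
    point attaches to it at one point or between two neighbours. *)
Definition center_closed (l : seq (branch W * branch W)) := forall p q r : branch W * branch W,
  List.In p l -> List.In q l -> List.In r l ->
  exists s, [/\ List.In s l, btw p.1 s.1 q.1, btw q.1 s.1 r.1 & btw p.1 s.1 r.1].

Definition swap (p : branch W * branch W) := (p.2, p.1).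

Lemma swap_in l p : List.In p (List.map swap l) <-> List.In (swap p) l.
Proof.
rewrite List.in_map_iff; split=> [[[q1 q2] [<-]]//|h].
by exists (swap p); split=> //; case: p {h}.
Qed.

Section TwoColourings.
Variables k1 k2 : component W -> M.
Hypothesis kk1 : kaleidoscopic k1 R.
Hypothesis kk2 : kaleidoscopic k2 R.

Lemma iso_neq l p q : iso k1 k2 l -> List.In p l -> List.In q l ->
  p.1 <> q.1 -> p.2 <> q.2.
Proof.
move=> il pl ql pq1 pq2; have := il _ _ pl ql; rewrite pq2 colxx.
rewrite (_ : col k1 _ _ = Some (k1 (Phi (fun E => pq1 (val_inj (esym E))))))//.
exact: colE.
Qed.

Lemma btw_col a b c (a' b' c' : branch W) :
  col k2 b' (\val a') = col k1 b (\val a) -> col k2 b' (\val c') = col k1 b (\val c) ->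
  btw a b c -> btw a' b' c'.
Proof.
move=> h1 h2 abc h; apply: abc; apply: (col_eq_side kk1).
  by move=> E; move: h1; rewrite E colxx (colE _ (side_neql h)).
by rewrite -h1 -h2; exact: col_side.
Qed.

Lemma iso_btw l p q r : iso k1 k2 l -> List.In p l -> List.In q l -> List.In r l ->
  btw p.1 q.1 r.1 -> btw p.2 q.2 r.2.
Proof. by move=> il pl ql rl; apply: btw_col; exact: il. Qed.

Lemma iso_swap l : iso k1 k2 l -> iso k2 k1 (List.map swap l).
Proof. by move=> il p q /swap_in pl /swap_in ql; rewrite [RHS](il _ _ pl ql). Qed.

Lemma center_closed_swap l : iso k1 k2 l -> center_closed l ->
  center_closed (List.map swap l).
Proof.
move=> il cl p q r /swap_in pl /swap_in ql /swap_in rl.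
have [s [sl h1 h2 h3]] := cl _ _ _ pl ql rl.
exists (swap s); split; first by apply/swap_in; case: s sl {h1 h2 h3}.
- exact: iso_btw il pl sl ql h1.
- exact: iso_btw il ql sl rl h2.
- exact: iso_btw il pl sl rl h3.
Qed.

(** The point [r] is a gate between [d] and [c]: from both ends, the direction of
    the other one is the direction of [r], or it is seen from [r] itself. Hence
    only the colours at gates have to be checked. *)
Lemma iso_cons l c c' : iso k1 k2 l ->
  (forall d, List.In d l -> exists r, [/\ List.In r l, btw d.1 r.1 c /\ r.1 <> c,
     btw d.2 r.2 c' /\ r.2 <> c', col k2 c' (\val r.2) = col k1 c (\val r.1) &
     col k2 r.2 (\val c') = col k1 r.1 (\val c)]) ->
  iso k1 k2 ((c, c') :: l).
Proof.
move=> il gate p q [<-|pl] [<-|ql] /=.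
- by rewrite !colxx.
- have [r [rl [h1 rc] [h2 rc'] e1 e2]] := gate q ql.
  have h3 : \val r.1 <> \val c by move=> /val_inj.
  have h4 : \val r.2 <> \val c' by move=> /val_inj.
  by rewrite (col_side _ (gate_side dW h1 h3)) (col_side _ (gate_side dW h2 h4)).
- have [r [rl [h1 rc] [h2 rc'] e1 e2]] := gate p pl.
  have [E|rp] := pselect (r.1 = p.1).
    have E2 : r.2 = p.2.
      apply: contrapT => h; have := il _ _ rl pl; rewrite E colxx.
      by rewrite (colE k2 (fun E' => h (val_inj (esym E')))).
    by rewrite -E -E2.
  have h3 : \val r.1 <> \val p.1 by move=> /val_inj.
  have h4 : \val r.2 <> \val p.2.
    move=> /val_inj E; have := il _ _ pl rl; rewrite E colxx.
    by rewrite (colE k1 h3).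
  by rewrite -(col_side _ (gate_side' dW h1 h3)) -(col_side _ (gate_side' dW h2 h4)) il.
- exact: il.
Qed.

Lemma center_closed_cons l c c' : center_closed l ->
  (forall d e, List.In d l -> List.In e l ->
     (exists2 r, List.In r l & btw d.1 r.1 c /\ btw e.1 r.1 c) \/ btw d.1 c e.1) ->
  center_closed ((c, c') :: l).
Proof.
move=> cl gate.
have key d e : List.In d l -> List.In e l -> exists s, [/\ List.In s ((c, c') :: l),
    btw d.1 s.1 e.1, btw d.1 s.1 c & btw e.1 s.1 c].
  move=> dl el; have [[r rl [h1 h2]]|h] := gate _ _ dl el; last first.
    by exists (c, c'); split; [left|exact: h|exact: btw_right|exact: btw_right].
  have [s [sl k3 k4 k5]] := cl _ _ _ dl rl el.
  exists s; split; [by right|exact: k5| |].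
    exact: (btw_trans dW k3 h1).
  exact: (btw_trans dW (btw_sym k4) h2).
move=> p q r [<-|pl] [<-|ql] [<-|rl] /=.
- by exists (c, c'); split; [left|exact: btw_left..].
- by exists (c, c'); split; [left|exact: btw_left..].
- by exists (c, c'); split; [left|exact: btw_left|exact: btw_right|exact: btw_left].
- have [s [sl h1 h2 h3]] := key _ _ ql rl.
  by exists s; split=> //; exact: btw_sym.
- by exists (c, c'); split; [left|exact: btw_right|exact: btw_left|exact: btw_right].
- have [s [sl h1 h2 h3]] := key _ _ pl rl.
  by exists s; split=> //; exact: btw_sym.
- have [s [sl h1 h2 h3]] := key _ _ pl ql.
  by exists s; split.
- by have [s [sl h1 h2 h3]] := cl _ _ _ pl ql rl; exists s; split=> //; right.
Qed.

(** Among the points of [l] beyond [c], seen from [b0], there is one closest to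
    [c]: a center of two such points and [b0] is closer than both. *)
Lemma gate_on_side l c (b0 d0 : branch W * branch W) : center_closed l ->
  (forall p, List.In p l -> p.1 <> c) -> List.In b0 l -> List.In d0 l ->
  btw d0.1 c b0.1 ->
  exists a : branch W * branch W, [/\ List.In a l, btw a.1 c b0.1 &
    forall d, List.In d l -> btw d.1 c b0.1 -> btw d.1 a.1 c].
Proof.
move=> cl lc b0l d0l h0.
suff : forall L, (forall d, List.In d L -> List.In d l) -> exists a : branch W * branch W, [/\ List.In a l,
    btw a.1 c b0.1 & forall d, List.In d L -> btw d.1 c b0.1 -> btw d.1 a.1 c].
  by move=> /(_ l); apply.
elim=> [|d L IH] Ll; first by exists d0.
have [|a [al acb aL]] := IH; first by move=> e eL; apply: Ll; right.
have [dcb|dcb] := pselect (btw d.1 c b0.1); last first.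
  by exists a; split=> // e [<-//|]; exact: aL.
have dl : List.In d l by apply: Ll; left.
have [s [sl asd dsb asb]] := cl _ _ _ al dl b0l.
have nacd : ~ btw a.1 c d.1.
  move=> acd; apply: (lc s sl); apply: val_inj.
  exact: (center_unique dW asd dsb asb acd dcb acb).
have asc : btw a.1 s.1 c.
  have [//|acs] := btw_linear asb acb.
  by case: nacd; exact: (btw_trans dW acs asd).
have dsc : btw d.1 s.1 c.
  have [//|dcs] := btw_linear dsb dcb.
  by case: nacd; apply/btw_sym/(btw_trans dW dcs)/btw_sym.
exists s; split=> //; first exact: (btw_trans2 dW asc acb).
move=> e [<-//|eL] ecb; apply/btw_sym/(btw_trans dW (btw_sym asc))/btw_sym.
exact: aL.
Qed.

(** The conditions that back and forth maintains. *)
Definition good l := iso k1 k2 l /\ center_closed l.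

(** The point [c] has a neighbour [a] and a neighbour [b] on its two sides. Its
    image is a point between their images with the two required colours, which
    the kaleidoscopic property provides. *)
Lemma insert_ext l c (a0 b0 : branch W * branch W) : good l -> (forall p, List.In p l -> p.1 <> c) ->
  List.In a0 l -> List.In b0 l -> btw a0.1 c b0.1 ->
  exists c', good ((c, c') :: l).
Proof.
move=> [il cl] lc a0l b0l h0.
have [a [al acb0 aP]] := gate_on_side cl lc b0l a0l h0.
have [b [bl bca bP]] := gate_on_side cl lc al b0l (btw_sym acb0).
have ac := lc a al; have bc := lc b bl.
have acW : \val a.1 <> \val c by move=> /val_inj.
have bcW : \val b.1 <> \val c by move=> /val_inj.
have ab1 : a.1 <> b.1.
  by move=> E; rewrite E in bca; apply: bcW; apply/esym/(btwxx bca).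
have ab2 := iso_neq il al bl ab1.
have m12 : k1 (Phi acW) <> k1 (Phi bcW).
  move=> E; apply: bca; apply: (col_eq_side kk1) => //.
  by rewrite (colE _ acW) (colE _ bcW) E.
have [c' [ac'b c'a c'b e1 e2]] := col_between kk2 ab2 m12.
rewrite -colE in e1; rewrite -colE in e2.
have c'aW : \val c' <> \val a.2 by move=> /val_inj.
have c'bW : \val c' <> \val b.2 by move=> /val_inj.
exists c'.
have gates d : List.In d l -> btw d.1 a.1 c \/ btw d.1 b.1 c.
  move=> dl; have [h|h] := btw_split (\val d.1) acb0.
    by right; apply: bP => //; exact: btw_sym.
  by left; exact: aP.
(* The two neighbours [p] and [q] play symmetric roles. *)
have gate_ok p q d : List.In p l -> List.In q l -> List.In d l ->
    p.1 <> c -> btw p.1 c q.1 -> c' <> p.2 -> btw p.2 c' q.2 ->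
    col k2 c' (\val p.2) = col k1 c (\val p.1) -> btw d.1 p.1 c ->
    [/\ btw d.1 p.1 c /\ p.1 <> c,
     btw d.2 p.2 c' /\ p.2 <> c', col k2 c' (\val p.2) = col k1 c (\val p.1) &
     col k2 p.2 (\val c') = col k1 p.1 (\val c)].
  move=> pl ql dl pc pcq c'p pc'q e dpc.
  have pcW : \val p.1 <> \val c by move=> /val_inj.
  have c'pW : \val c' <> \val p.2 by move=> /val_inj.
  have dpq : btw d.1 p.1 q.1 := btw_glue2 dW dpc pcq pcW.
  have dpq2 := iso_btw il dl pl ql dpq.
  split=> //; first split=> //.
  - exact: btw_sym (btw_trans2 dW (btw_sym pc'q) (btw_sym dpq2)).
  - by move=> E; apply: c'p.
  - have h1 : side (\val p.1) (\val c) (\val q.1) by apply: (gate_side' dW) => // /esym.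
    have h2 : side (\val p.2) (\val c') (\val q.2) by exact: (gate_side' dW).
    by rewrite (col_side _ h1) (col_side _ h2) il.
split.
- apply: iso_cons => // d dl; have [h|h] := gates d dl.
  + by exists a; have [] := gate_ok a b d al bl dl ac (btw_sym bca) c'a ac'b e1 h.
  + by exists b; have [] := gate_ok b a d bl al dl bc bca c'b (btw_sym ac'b) e2 h.
- apply: center_closed_cons => // d e dl el.
  have mixed d' e' : btw d'.1 a.1 c -> btw e'.1 b.1 c -> btw d'.1 c e'.1.
    move=> h1 h2; have h3 := btw_glue dW h1 (btw_sym bca) acW.
    by apply: (btw_glue2 dW h3 (btw_sym h2)) => /esym.
  have [h|h] := gates d dl; have [h'|h'] := gates e el.
  + by left; exists a.
  + by right; exact: mixed.
  + by right; apply/btw_sym/mixed.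
  + by left; exists b.
Qed.

(** Here [c] is attached to the subtree at the point [r] of [l] only. *)
Lemma hang_ext l c r : good l -> List.In r l -> r.1 <> c ->
  (forall d, List.In d l -> btw d.1 r.1 c) -> exists c', good ((c, c') :: l).
Proof.
move=> [il cl] rl rc gate.
have rcW : \val r.1 <> \val c by move=> /val_inj.
have crW : \val c <> \val r.1 by move=> /val_inj /esym.
have [c' [e1 e2]] := col_hang kk2 r.2 (k1 (Phi crW)) (k1 (Phi rcW)).
rewrite -colE in e1; rewrite -colE in e2.
have rc' : r.2 <> c' by move=> E; rewrite E colxx (colE _ crW) in e1.
exists c'; split.
- apply: iso_cons => // d dl; exists r; split=> //; split=> //; first exact: gate.
  by apply: btw_col (gate d dl) => //; exact: il.
- apply: center_closed_cons => // d e dl el; left; exists r => //.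
  by split; exact: gate.
Qed.

(** A point [c] off the subtree is attached to it at its projection [r], which is
    added first if necessary. *)
Lemma good_ext l c : good l -> l <> [::] -> exists l',
  [/\ good l', forall p, List.In p l -> List.In p l' & exists c', List.In (c, c') l'].
Proof.
move=> gl l0.
have [[p [pl pc]]|lc] := pselect (exists p, List.In p l /\ p.1 = c).
  by exists l; split=> //; exists p.2; rewrite -pc; case: (p) pl.
have lc' p : List.In p l -> p.1 <> c by move=> pl pc; apply: lc; exists p.
have [[a [b [al bl acb]]]|nacb] :=
    pselect (exists a b : branch W * branch W, [/\ List.In a l, List.In b l & btw a.1 c b.1]).
  have [c' gl'] := insert_ext gl lc' al bl acb.
  by exists ((c, c') :: l); split=> //; [right|exists c'; left].
have inl f : List.In f [seq p.1 | p <- l] -> exists2 p, List.In p l & p.1 = f.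
  by move=> /List.in_map_iff[p [pf pl]]; exists p.
case: l => [//|p0 l] in gl l0 lc lc' nacb inl *.
have [|r [rc [f1 [f2 [F1 F2 f1rf2]]] rF]] := @projection_exists c p0.1 [seq p.1 | p <- l].
  move=> f f' /inl[p pl <-] /inl[p' p'l <-] h; apply: nacb; by exists p, p'.
have rl p : List.In p (p0 :: l) -> btw p.1 r c.
  by move=> pl; apply: rF; exact: (List.in_map fst _ _ pl).
have [[s [sl sr]]|ns] := pselect (exists s, List.In s (p0 :: l) /\ s.1 = r).
  have [||c' gl'] := @hang_ext _ c s gl sl.
  - by rewrite sr.
  - by rewrite sr.
  by exists ((c, c') :: p0 :: l); split=> //; [right|exists c'; left].
have [q1 q1l q1E] := inl _ F1; have [q2 q2l q2E] := inl _ F2.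
have [||r' gl1] := @insert_ext _ r q1 q2 gl _ q1l q2l.
- by move=> p pl pr; apply: ns; exists p.
- by rewrite q1E q2E.
have [|||c' gl'] := @hang_ext _ c (r, r') gl1.
- by left.
- by [].
- by move=> d [<-|dl] /=; [exact: btw_left|exact: rl].
by exists [:: (c, c'), (r, r'), p0 & l]; split=> //; [move=> p; right; right|exists c'; left].
Qed.

End TwoColourings.

(** X is countable, so its points can be added one at a time on both sides, and
    the union of the partial isomorphisms is a bijection of X. *)
Lemma back_and_forth k1 k2 l0 : kaleidoscopic k1 R -> kaleidoscopic k2 R ->
  good k1 k2 l0 -> l0 <> [::] -> exists s s' : branch W -> branch W,
  [/\ cancel s s', cancel s' s,
      forall a b, col k2 (s a) (\val (s b)) = col k1 a (\val b) &
      forall p, List.In p l0 -> s p.1 = p.2].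
Proof.
move=> kk1 kk2 gl0 l00.
have [e eP] := enum_branch dW dX.
have both l c : good k1 k2 l -> l <> [::] -> exists l', [/\ good k1 k2 l', l' <> [::],
    forall p, List.In p l -> List.In p l', exists c', List.In (c, c') l' &
    exists c', List.In (c', c) l'].
  move=> gl l_0.
  have [l1 [gl1 sub1 [c1 c1P]]] := good_ext kk1 kk2 c gl l_0.
  have [il1 cl1] := gl1.
  have gl1' : good k2 k1 (List.map swap l1).
    by split; [exact: iso_swap|exact: (center_closed_swap kk1 il1 cl1)].
  have [|l2 [gl2 sub2 [c2 c2P]]] := good_ext kk2 kk1 c gl1'.
    by case: l1 c1P {gl1 sub1 il1 cl1 gl1'}.
  have [il2 cl2] := gl2.
  have sub l3 p : List.In p l3 -> List.In (swap p) (List.map swap l3).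
    by move=> h; apply/swap_in; case: p h.
  exists (List.map swap l2); split.
  - by split; [exact: iso_swap|exact: (center_closed_swap kk2 il2 cl2)].
  - by case: l2 c2P {gl2 sub2 il2 cl2}.
  - by move=> p /sub1/sub/sub2/sub; case: p.
  - by exists c1; apply/swap_in/sub2/swap_in.
  - by exists c2; apply/swap_in.
have /choice[F FP] : forall nl : nat * seq (branch W * branch W), exists l',
    good k1 k2 nl.2 -> nl.2 <> [::] -> [/\ good k1 k2 l', l' <> [::],
    forall p, List.In p nl.2 -> List.In p l', exists c', List.In (e nl.1, c') l' &
    exists c', List.In (c', e nl.1) l'].
  move=> [n l] /=; have [gl|] := pselect (good k1 k2 l); last by exists l.
  have [l_0|] := pselect (l <> [::]); last by exists l.
  by have [l' H] := both l (e n) gl l_0; exists l'.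
pose S := fix S n := if n is m.+1 then F (m, S m) else l0.
have SP n : good k1 k2 (S n) /\ S n <> [::].
  by elim: n => [//|n [g0 n0]]; have [] := FP (n, S n) g0 n0.
have SS n p : List.In p (S n) -> List.In p (S n.+1).
  by have [g0 n0] := SP n; have [_ _ H _ _] := FP (n, S n) g0 n0; exact: H.
have Smono m n p : (m <= n)%N -> List.In p (S m) -> List.In p (S n).
  move=> mn; rewrite -(subnKC mn); elim: (n - m)%N => [|d IH]; first by rewrite addn0.
  by rewrite addnS => /IH /SS.
pose Rel p := exists n, List.In p (S n).
have Rel_iso p q : Rel p -> Rel q -> col k2 p.2 (\val q.2) = col k1 p.1 (\val q.1).
  move=> [m pm] [n qn]; have [[il _] _] := SP (maxn m n).
  by apply: il; [exact: Smono (leq_maxl _ _) pm|exact: Smono (leq_maxr _ _) qn].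
have /choice[s sP] : forall c, exists c', Rel (c, c').
  move=> c; have [n <-] := eP c; have [g0 n0] := SP n.
  by have [_ _ _ [c' c'P] _] := FP (n, S n) g0 n0; exists c', n.+1.
have /choice[s' s'P] : forall c, exists c', Rel (c', c).
  move=> c; have [n <-] := eP c; have [g0 n0] := SP n.
  by have [_ _ _ _ [c' c'P]] := FP (n, S n) g0 n0; exists c', n.+1.
have func1 p q : Rel p -> Rel q -> p.1 = q.1 -> p.2 = q.2.
  move=> rp rq E; have := Rel_iso _ _ rp rq; rewrite E colxx => h.
  by apply: contrapT => pq; rewrite (colE k2 (fun E' => pq (val_inj (esym E')))) in h.
have func2 p q : Rel p -> Rel q -> p.2 = q.2 -> p.1 = q.1.
  move=> rp rq E; have := Rel_iso _ _ rp rq; rewrite E colxx => /esym h.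
  by apply: contrapT => pq; rewrite (colE k1 (fun E' => pq (val_inj (esym E')))) in h.
exists s, s'; split.
- by move=> c; exact: (func2 (s' (s c), s c) (c, s c)).
- by move=> c; exact: (func1 (s' c, s (s' c)) (s' c, c)).
- by move=> a b; exact: (Rel_iso (a, s a) (b, s b)).
- by move=> p pl; apply: (func1 (p.1, s p.1) p) => //; exists 0.
Qed.

End Colours.

(** * Homogeneity of the kaleidoscopic group *)
Section ActComponents.
Context {R : realType} {W : topologicalType}.
Hypothesis dW : dendrite R W.
Hypothesis dX : dense (@branch_points W).
Implicit Types (x a b : branch W).

Lemma homeo_side (g : homeo W W) (x y : W) : y <> x ->
  g @` side x y = side (g x) (g y).
Proof. by move=> yx; rewrite /side homeo_connected_component// homeo_setC1. Qed.

Lemma act_Phi (g : homeo W W) x (w : W) (wx : w <> \val x)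
    (gwx : g w <> \val (branch_act g x)) :
  component_act g (Phi wx) = Phi gwx.
Proof. by apply: component_eq => //=; exact: homeo_side. Qed.

Lemma homeo_neq (g : homeo W W) (x y : W) : y <> x -> g y <> g x.
Proof. by move=> yx /(can_inj (@hfunK _ _ g)). Qed.

Lemma component_Phi (c : component W) (w : W) (wc : cset c w) :
  exists wx : w <> \val (cbase c), c = Phi wx.
Proof.
case: c wc => x C xC /= Cw; have [y yx yC] := xC.
have yw : side (\val x) y w by rewrite /side yC.
exists (side_neqr yw); apply: component_eq => //=; rewrite -yC; exact: side_eq yw.
Qed.

Lemma component_nonempty (c : component W) : cset c !=set0.
Proof.
case: c => x C xC /=; have [y yx yC] := xC.
by exists y; rewrite -yC; exact: side_refl.
Qed.

Lemma component_open (c : component W) : open (cset c).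
Proof. case: c => x C xC /=; have [y yx <-] := xC; exact: (side_open dW). Qed.

Lemma component_closure (c : component W) : closure (cset c) (\val (cbase c)).
Proof. case: c => x C xC /=; have [y yx <-] := xC; exact: (closure_side dW). Qed.

Lemma component_meets (c : component W) (U : set W) : open U ->
  U `&` cset c !=set0 -> exists a, U (\val a) /\ cset c (\val a).
Proof.
move=> oU Uc; have [|a [Ua ca]] := branch_in_open dX (U := U `&` cset c) _ Uc.
  by apply: openI => //; exact: component_open.
by exists a.
Qed.

Lemma component_has_branch (c : component W) : exists a, cset c (\val a).
Proof.
have [||a [_ ca]] := @component_meets c setT; first exact: openT.
  by have [y cy] := component_nonempty c; exists y.
by exists a.
Qed.

Lemma eq_on_branch (f : W -> W) : continuous f ->
  (forall x, f (\val x) = \val x) -> forall w, f w = w.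
Proof.
move=> cf fx w; apply: (dendrite_hausdorff dW) => A B fA wB.
have fA' : nbhs w (f @^-1` A) by exact: cf.
have : nbhs w (f @^-1` A `&` B) by exact: filterI.
rewrite nbhsE => -[N [oN Nw] NAB].
have [x Nx] := branch_in_open dX oN (ex_intro _ w Nw).
have [Ax Bx] := NAB _ Nx.
by exists (\val x); split=> //; rewrite /= fx in Ax.
Qed.

End ActComponents.

Section Extension.
Context {R : realType} {W : topologicalType} {M : Type}.
Hypothesis dW : dendrite R W.
Hypothesis dX : dense (@branch_points W).
Implicit Types (x a b : branch W).

(** [u] lies in the closure of the image of every side that contains [w]. *)
Definition limit_point (s : branch W -> branch W) (w u : W) := forall x a,
  side (\val x) w (\val a) -> u = \val (s x) \/ side (\val (s x)) (\val (s a)) u.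

Definition keeps_sides (s : branch W -> branch W) := forall x a b,
  side (\val x) (\val a) (\val b) -> side (\val (s x)) (\val (s a)) (\val (s b)).

(** Any cluster point of the images of the branch points near [w] will do. *)
Lemma limit_point_exists s w : keeps_sides s -> exists u, limit_point s w u.
Proof.
move=> ss.
pose F := [set S : set W | exists2 V, nbhs w V & forall a, V (\val a) -> S (\val (s a))].
have FF : ProperFilter F.
  split.
    move=> [V]; rewrite nbhsE => -[N [oN Nw] NV] H.
    by have [x /NV /H] := branch_in_open dX oN (ex_intro _ w Nw).
  split.
  - by exists setT => //; exact: filterT.
  - move=> A B [V nV VA] [V' nV' VB]; exists (V `&` V'); first exact: filterI.
    by move=> a [/VA Aa /VB Ba].
  - by move=> A B AB [V nV VA]; exists V => // a /VA /AB.
have [_ cW _ _ _] := dW.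
have [u [_ clu]] := cW F FF filterT.
exists u => x a xwa.
have [|h|h] := @closure_sideE _ _ dW (\val (s x)) (\val (s a)) u; [|by right|by left].
move=> B nB; apply: clu => //.
exists (side (\val x) w).
  apply: open_nbhs_nbhs; split; first exact: (side_open dW).
  exact: (side_refl (side_neql xwa)).
by move=> b xwb; apply: ss; exact: side_trans (side_sym xwa) xwb.
Qed.

(** Between two limit points there is a branch point [z], which can be chosen so
    that its preimage is not [w]. Both limit points then lie on the side of [z]
    that corresponds to the side of [w]. *)
Lemma limit_point_unique s s' w u u' : cancel s' s -> limit_point s w u ->
  limit_point s w u' -> u = u'.
Proof.
move=> s'K lu lu'; apply: contrapT => uu'.
have [z [zu zu' uzu' zw]] : exists z : branch W,
    [/\ \val z <> u, \val z <> u', btw u (\val z) u' & \val (s' z) <> w].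
  have [z1 [z1u z1u' uz1u']] := branch_between dW dX uu'.
  have [z1w|z1w] := pselect (\val (s' z1) = w); last by exists z1.
  have [z2 [z2u z2z1 uz2z1]] := branch_between dW dX (nesym z1u).
  have h := btw_trans dW uz2z1 uz1u'.
  exists z2; split=> //.
    by move=> z2u'; rewrite z2u' in uz2z1; apply: z1u'; exact: (btw_antisym dW uz1u' uz2z1).
  rewrite -z1w => /val_inj E; apply: z2z1; congr (\val _).
  exact: (can_inj s'K).
have [a wa] : exists a, side (\val (s' z)) w (\val a).
  apply: (branch_in_open dX); first exact: (side_open dW).
  by exists w; apply: side_refl; exact: nesym.
have := lu _ _ wa; have := lu' _ _ wa; rewrite s'K.
move=> [E|h'] [E'|h]; try by [exact: (zu (esym E'))|exact: (zu' (esym E))].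
by apply: uzu'; apply: side_trans (side_sym h) h'.
Qed.

Lemma limit_point_branch s a : keeps_sides s -> limit_point s (\val a) (\val (s a)).
Proof. by move=> ss x b xab; right; apply/side_sym/ss. Qed.

(** Being a limit point is a closed relation between [w] and [u]; in a compact
    space a map with closed graph is continuous. *)
Lemma limit_map_exists s s' : cancel s' s -> keeps_sides s ->
  exists g : W -> W, continuous g /\ forall a, g (\val a) = \val (s a).
Proof.
move=> s'K ss.
have /choice[g gP] : forall w, exists u, limit_point s w u.
  by move=> w; exact: limit_point_exists.
exists g; split; last first.
  by move=> a; apply: limit_point_unique s'K (gP _) _; exact: limit_point_branch.
move=> w U; rewrite nbhsE => -[N [oN Nw] NU].
have [_ cW _ _ _] := dW.
have cK : compact (~` N).
  by apply: subclosed_compact cW _ => //; exact: open_closedC.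
pose Q (S : set W) := exists2 V, nbhs w V & forall w' u, V w' -> S u ->
  ~ N u -> ~ limit_point s w' u.
have [|A B [V nV VP] [V' nV' V'P]|A B AB [V nV VP]|u nNu|V nV VP] :=
  @compact_induction W (~` N) Q cK.
- by exists setT => //; exact: filterT.
- exists (V `&` V'); first exact: filterI.
  by move=> w' u [Vw V'w] [Au|Bu]; [exact: VP|exact: V'P].
- by exists V => // w' u Vw /AB; exact: VP.
- have nlu : ~ limit_point s w u.
    by move=> lu; apply: nNu; rewrite (limit_point_unique s'K lu (gP w)).
  have [x [a [xwa nux nxau]]] : exists x a, [/\ side (\val x) w (\val a),
      u <> \val (s x) & ~ side (\val (s x)) (\val (s a)) u].
    apply: contrapT => H; apply: nlu => x a xwa; apply: contrapT => /not_orP[h1 h2].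
    by apply: H; exists x, a.
  exists (~` (side (\val (s x)) (\val (s a)) `|` [set \val (s x)])).
    apply: open_nbhs_nbhs; split; last by move=> [].
    exact/closed_openC/(side_closedU dW).
  exists (side (\val x) w).
    apply: open_nbhs_nbhs; split; first exact: (side_open dW).
    exact: (side_refl (side_neql xwa)).
  move=> w' u' xww' nu' _ lu'; have := lu' x a (side_trans (side_sym xww') xwa).
  by move=> [h|h]; apply: nu'; [right|left].
apply: filterS nV => w' Vw'; apply: NU; apply: contrapT => nN.
exact: (VP _ _ Vw' nN nN (gP w')).
Qed.

Lemma keeps_sides_col k1 k2 (s : branch W -> branch W) : kaleidoscopic k1 R ->
  kaleidoscopic k2 R ->
  (forall a b, col k2 (s a) (\val (s b)) = col k1 a (\val b) :> option M) ->
  keeps_sides s.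
Proof.
move=> kk1 kk2 sc x a b xab; apply: (col_eq_side kk2).
  move=> E; have := sc x a; rewrite E colxx.
  by rewrite (colE _ (side_neql xab)).
by rewrite !sc; exact: col_side.
Qed.

(** The bijection of X given by back and forth and its inverse extend to W; the
    extensions are inverse to each other since X is dense. *)
Theorem extend_homeo k1 k2 l0 : `I_3 #<= [set: M] ->
  kaleidoscopic k1 R -> kaleidoscopic k2 R -> @iso _ M k1 k2 l0 ->
  center_closed l0 -> l0 <> [::] ->
  exists g : homeo W W, (forall c, k2 (component_act g c) = k1 c) /\
    forall p, List.In p l0 -> g (\val p.1) = \val p.2.
Proof.
move=> M3 kk1 kk2 il0 cl0 l00.
have [s [s' [sK s'K sc sl]]] := back_and_forth dW dX M3 kk1 kk2 (conj il0 cl0) l00.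
have ss := keeps_sides_col kk1 kk2 sc.
have ss' : keeps_sides s'.
  by apply: (keeps_sides_col kk2 kk1) => a b; rewrite -sc !s'K.
have [f [cf fs]] := limit_map_exists s'K ss.
have [f' [cf' fs']] := limit_map_exists sK ss'.
have fK : cancel f f'.
  apply: (eq_on_branch dW dX (f := f' \o f)).
    by move=> w; apply: continuous_comp; [exact: cf|exact: cf'].
  by move=> x; rewrite /= fs fs' sK.
have f'K : cancel f' f.
  apply: (eq_on_branch dW dX (f := f \o f')).
    by move=> w; apply: continuous_comp; [exact: cf'|exact: cf].
  by move=> x; rewrite /= fs' fs s'K.
exists (Homeo fK f'K cf cf'); split; last first.
  by move=> p pl /=; rewrite fs sl.
move=> c; set g := Homeo _ _ _ _.
have [a ca] := component_has_branch dW dX c.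
have [ax ->] := component_Phi ca.
have gax : g (\val a) <> \val (branch_act g (cbase c)) by exact: homeo_neq.
rewrite (act_Phi _ gax).
have sx : branch_act g (cbase c) = s (cbase c) by apply: val_inj; rewrite /= fs.
have := sc (cbase c) a; rewrite (colE _ ax) -sx -fs => E.
by move: E; rewrite (colE k2 gax) => -[].
Qed.

End Extension.

Section Paste.
Context {R : realType} {W : topologicalType}.
Hypothesis dW : dendrite R W.

Definition paste (r a : W) (f : W -> W) (w : W) : W :=
  if pselect (side r a w) then f w else w.

Lemma paste_in r a f w : side r a w -> paste r a f w = f w.
Proof. by rewrite /paste; case: pselect. Qed.

Lemma paste_out r a f w : ~ side r a w -> paste r a f w = w.
Proof. by rewrite /paste; case: pselect. Qed.

Lemma paste_continuous r a f : continuous f -> f r = r -> continuous (paste r a f).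
Proof.
move=> cf fr.
have : {within (side r a `|` [set r]) `|` ~` side r a, continuous (paste r a f)}.
  apply: withinU_continuous; [exact: (side_closedU dW)| | |].
  - exact/open_closedC/(side_open dW).
  - apply: (@subspace_eq_continuous _ _ _ f); last exact: continuous_subspaceT.
    move=> w; rewrite inE => -[rw|->]; first by rewrite /from_subspace paste_in.
    by rewrite /from_subspace paste_out// => /side_neqr.
  - apply: (@subspace_eq_continuous _ _ _ (id : W -> W)); last first.
      by apply: continuous_subspaceT => w; exact: cvg_id.
    by move=> w; rewrite inE => h; rewrite /from_subspace paste_out.
have -> : (side r a `|` [set r]) `|` ~` side r a = setT.
  apply/seteqP; split=> // w _.
  by have [h|h] := pselect (side r a w); [left; left|right].
by move=> h w; have := h w; rewrite /continuous_at nbhs_subspaceT.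
Qed.

Lemma paste_homeo (g : homeo W W) (r a : W) : g r = r ->
  g @` side r a = side r a -> exists g' : homeo W W,
    (forall w, side r a w -> g' w = g w) /\ (forall w, ~ side r a w -> g' w = w).
Proof.
move=> gr gC.
have br : hback g r = r by rewrite -{1}gr hfunK.
have gin w : side r a w -> side r a (g w) by move=> h; rewrite -gC; exists w.
have bin w : side r a w -> side r a (hback g w).
  by rewrite -{1}gC => -[v h <-]; rewrite hfunK.
have K1 : cancel (paste r a g) (paste r a (hback g)).
  move=> w; have [h|h] := pselect (side r a w).
    by rewrite (paste_in g h) paste_in ?hfunK//; exact: gin.
  by rewrite (paste_out g h) paste_out.
have K2 : cancel (paste r a (hback g)) (paste r a g).
  move=> w; have [h|h] := pselect (side r a w).
    by rewrite (paste_in _ h) paste_in ?hbackK//; exact: bin.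
  by rewrite (paste_out _ h) paste_out.
exists (Homeo K1 K2 (paste_continuous (@hfun_continuous _ _ g) gr)
  (paste_continuous (@hback_continuous _ _ g) br)).
by split=> w; [exact: paste_in|exact: paste_out].
Qed.

End Paste.

Section Homogeneity.
Context {R : realType} {W : topologicalType} {M : Type}.
Hypothesis dW : dendrite R W.
Hypothesis dX : dense (@branch_points W).
Hypothesis M3 : `I_3 #<= [set: M].
Variables (kappa : component W -> M) (Gamma : perm_group M).
Hypothesis kk : kaleidoscopic kappa R.
Hypothesis tG : transitive_group Gamma.
Implicit Types (x a b r : branch W).

(** An isomorphism from [twist a gamma] to [kappa] is a homeomorphism that acts by
    [gamma] on the colours at [a] and preserves the colours at other points. *)
Definition twist (a : branch W) (gamma : M -> M) (c : component W) : M :=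
  if pselect (cbase c = a) then gamma (kappa c) else kappa c.

(** The only point between [x] and [y] whose colours change is [a]; if it is the
    witness, then a witness between [x] and [a] replaces it. *)
Lemma twist_kaleidoscopic a gamma : bijective gamma ->
  kaleidoscopic (twist a gamma) R.
Proof.
move=> [gi gK giK]; split.
- move=> x; have [kf ki ks] := kk.1 x; have [E|xa] := pselect (x = a).
    subst x; split.
    + by [].
    + move=> c d /set_mem cx /set_mem dx; rewrite /twist.
      case: pselect => //= _; case: pselect => //= _ /(can_inj gK).
      by apply: ki; rewrite inE /= ?cx ?dx.
    + move=> m _; have [c cx cm] := ks (gi m) I.
      exists c => //; rewrite /twist; case: pselect => [_|] /=; last by rewrite cx.
      by rewrite cm giK.
  split.
  + by [].
  + move=> c d /set_mem cx /set_mem dx; rewrite /twist.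
    case: pselect => [E|n1] /=; first by rewrite cx in E.
    case: pselect => [E|n2] /=; first by rewrite dx in E.
    by apply: ki; rewrite inE.
  + move=> m _; have [c cx cm] := ks m I; exists c => //.
    by rewrite /twist; case: pselect => [E|//] /=; rewrite cx in E.
- move=> x y xy m m' mm'.
  have tw z (w : W) (wz : w <> \val z) : z <> a -> twist a gamma (Phi wz) = kappa (Phi wz).
    by move=> za; rewrite /twist; case: pselect.
  have [z [zx [zy [az kx ky]]]] := kk.2 x y xy m m' mm'.
  have [za|za] := pselect (z = a); last by exists z, zx, zy; rewrite !tw.
  have xz : x <> z by move=> E; apply: (zx); rewrite E.
  have [z' [z'x [z'z [az' kx' kz']]]] := kk.2 x z xz m m' mm'.
  have z'a : z' <> a by rewrite -za => E; apply: (z'z); rewrite E.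
  have /(arcP dW) xzy := az.1; have /(arcP dW) xz'z := az'.1.
  have xz'y := btw_trans dW xz'z xzy.
  have sz : side (\val z') (\val z) (\val y).
    apply: contrapT => h; apply: (z'z).
    exact: (btw_antisyml dW h (btw_trans2 dW xz'z xzy)).
  have z'y := side_neqr sz.
  exists z', z'x, (side_neqr sz); rewrite !tw//; split=> //.
  + split; first exact/(arcP dW).
    by move=> [E|E]; [apply: (z'x)|apply: (z'y)].
  + rewrite -kz'; congr kappa; apply: component_eq => //=.
    by apply: side_eq; exact: side_sym.
Qed.

(** With [gam] mapping the colour of [r] at [a] to the colour of [r] at [b], the
    pairs (r, r) and (a, b) form a partial isomorphism from [twist a gam] to
    [kappa]. A homeomorphism that extends it preserves the side of [a] at [r], and
    the identity can be pasted to it outside. *)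
Theorem homogeneous r a b : side (\val r) (\val a) (\val b) ->
  exists2 g : homeo W W, kgroup kappa Gamma g &
    g (\val a) = \val b /\ forall w, ~ side (\val r) (\val a) w -> g w = w.
Proof.
move=> rab.
have ra : \val r <> \val a by move=> /esym; exact: side_neql rab.
have rb : \val r <> \val b by move=> /esym; exact: side_neqr rab.
have rNa : r <> a by move=> E; apply: ra; rewrite E.
have [gam Ggam gamE] := tG (kappa (Phi ra)) (kappa (Phi rb)).
have bgam : bijective gam.
  by have [gi _ [h1 h2]] := pg_inv Ggam; exists gi.
have kt := twist_kaleidoscopic a bgam.
pose l0 := [:: (r, r); (a, b)].
have il0 : iso (twist a gam) kappa l0.
  move=> p q [<-|[<-|//]] [<-|[<-|//]] /=; rewrite ?colxx//.
    rewrite -(col_side _ rab) !(colE _ (nesym ra)); congr Some.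
    by rewrite /twist; case: pselect.
  rewrite (colE _ rb) (colE _ ra) -gamE; congr Some.
  by rewrite /twist; case: pselect.
have cl0 : center_closed l0.
  move=> p q s [<-|[<-|//]] [<-|[<-|//]] [<-|[<-|//]] /=.
  - by exists (r, r); split; [left|exact: btw_left..].
  - by exists (r, r); split; [left|exact: btw_left..].
  - by exists (r, r); split; [left|exact: btw_left|exact: btw_right|exact: btw_left].
  - by exists (a, b); split; [right; left|exact: btw_right|exact: btw_left|exact: btw_right].
  - by exists (r, r); split; [left|exact: btw_right|exact: btw_left|exact: btw_right].
  - by exists (a, b); split; [right; left|exact: btw_left|exact: btw_right|exact: btw_left].
  - by exists (a, b); split; [right; left|exact: btw_left..].
  - by exists (a, b); split; [right; left|exact: btw_left..].
have [|g [gk gl]] := extend_homeo dW dX M3 kt kk il0 cl0; first by [].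
have gr : g (\val r) = \val r by apply: (gl (r, r)); left.
have ga : g (\val a) = \val b by apply: (gl (a, b)); right; left.
have gC : g @` side (\val r) (\val a) = side (\val r) (\val a).
  by rewrite homeo_side ?gr ?ga; [apply/esym/side_eq|exact: nesym].
have [g' [g'in g'out]] := paste_homeo dW gr gC.
exists g'; last by split=> //; rewrite g'in//; exact/side_refl/nesym.
have rC : ~ side (\val r) (\val a) (\val r) by move=> /side_neqr.
move=> x; have [xC|xC] := pselect (side (\val r) (\val a) (\val x)).
- exists (if pselect (x = a) then gam else id).
    by case: pselect => //= _; exact: pg_id.
  move=> c cx.
  have [e [Ce ce]] : exists e : branch W, side (\val r) (\val a) (\val e) /\ cset c (\val e).
    apply: (component_meets dW dX); first exact: (side_open dW).
    have := @component_closure _ _ dW c; rewrite cx.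
    have /open_nbhs_nbhs nC : open_nbhs (\val x) (side (\val r) (\val a)).
      by split=> //; exact: (side_open dW).
    by move=> /(_ _ nC); rewrite setIC.
  have [ex E] := component_Phi ce.
  have -> : component_act g' c = component_act g c.
    rewrite E; have h1 : g (\val e) <> \val (branch_act g (cbase c)) by exact: homeo_neq.
    have h2 : g' (\val e) <> \val (branch_act g' (cbase c)) by exact: homeo_neq.
    rewrite (act_Phi _ h1) (act_Phi _ h2); apply: component_eq => /=.
      by apply: val_inj => /=; rewrite g'in// cx.
    by rewrite !g'in// cx.
  by rewrite gk /twist cx; case: pselect.
(* Outside the side of [a], every component at [x] is mapped to itself: it has a
   point that is not moved or, for [x = r], is the side of [a]. *)
- exists id; first exact: pg_id.
  move=> c cx; congr kappa.
  have fix_ w : cset c w -> cset c (g' w) -> component_act g' c = c.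
    move=> cw cgw; have [wx E] := component_Phi cw.
    have h : g' w <> \val (branch_act g' (cbase c)) by exact: homeo_neq.
    have xx : branch_act g' (cbase c) = cbase c.
      by apply: val_inj => /=; rewrite cx g'out.
    rewrite {1}E (act_Phi _ h); have [gx E'] := component_Phi cgw.
    apply: component_eq => //=.
    by rewrite [in RHS]E' /= cx g'out.
  have [[w [cw wC]]|H] := pselect (exists w, cset c w /\ ~ side (\val r) (\val a) w).
    by apply: (fix_ w) => //; rewrite g'out.
  have cC : cset c `<=` side (\val r) (\val a).
    by move=> w cw; apply: contrapT => nw; apply: H; exists w.
  have [y cy] := component_nonempty c; have [yx E] := component_Phi cy.
  have xr : \val x = \val r.
    have := @component_closure _ _ dW c; rewrite cx.
    by move=> /(closureS cC) /(closure_sideE dW) [].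
  have cE : cset c = side (\val r) (\val a).
    by rewrite E /= cx xr; apply/esym/side_eq/cC.
  apply: (fix_ y) => //; rewrite cE g'in; last exact: cC.
  by rewrite -gC; exists y => //; exact: cC.
Qed.

End Homogeneity.

(** * Formulas, parameters and types *)
Section Satisfaction.
Context {R : realType} {W : topologicalType} {M : Type}
  (kappa : component W -> M) (Gamma : perm_group M) (MM : rel_structure M).
Hypothesis dW : dendrite R W.
Hypothesis autG : automorphisms MM = Gamma.
Implicit Types (x y z a b : branch W) (g : homeo W W).
Local Notation formula := (formula kappa Gamma MM).
Local Notation eval := (Defs.eval R).

Lemma branch_actK g x : branch_act (homeo_inv g) (branch_act g x) = x.
Proof. by apply: val_inj; rewrite /= hfunK. Qed.

Lemma branch_actVK g x : branch_act g (branch_act (homeo_inv g) x) = x.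
Proof. by apply: val_inj; rewrite /= hbackK. Qed.

Lemma component_actVK g c : component_act g (component_act (homeo_inv g) c) = c.
Proof.
apply: component_eq; first exact: branch_actVK.
apply/seteqP; split=> [_ [_ [u cu <-] <-]|u cu] /=; first by rewrite hbackK.
by exists (hback g u); [exists u | rewrite hbackK].
Qed.

Lemma component_actK g c : component_act (homeo_inv g) (component_act g c) = c.
Proof.
apply: component_eq; first exact: branch_actK.
apply/seteqP; split=> [_ [_ [u cu <-] <-]|u cu] /=; first by rewrite hfunK.
by exists (g u); [exists u | rewrite hfunK].
Qed.

Lemma btw_act g (x y z : W) : btw x y z -> btw (g x) (g y) (g z).
Proof.
move=> h h'; apply: h; have gxy := side_neql h'.
have xy : x <> y by move=> E; apply: gxy; rewrite E.
move: h'; rewrite -homeo_side// => -[z' xz' /(can_inj (@hfunK _ _ g)) <-].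
exact: xz'.
Qed.

Lemma Kfun_act g x y z : Kfun R (branch_act g x) (branch_act g y) (branch_act g z) =
  branch_act g (Kfun R x y z).
Proof.
by have [h1 h2 h3] := KfunP dW x y z; apply: (Kfun_eq dW); exact: btw_act.
Qed.

Lemma eval_act g n (e : 'I_n -> branch W) t :
  eval (branch_act g \o e) (tmap (branch_act g) t) = branch_act g (eval e t).
Proof. by elim: t => //= t1 -> t2 -> t3 ->; exact: Kfun_act. Qed.

Lemma scons_comp (A B : Type) n (f : A -> B) (a : A) (e : 'I_n -> A) :
  scons (f a) (f \o e) = f \o scons a e.
Proof. by apply/funext => i; rewrite /scons /=; case: unliftP. Qed.

(** A homeomorphism preserves centers and components. On the components at a point
    an element of K(Gamma) acts through Gamma, that is, by an automorphism of
    [MM]. *)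
Lemma sat_act (g : kgroup kappa Gamma) n m (phi : formula n m) e h :
  sat R phi e h <-> sat R (map_params (branch_act (\val g)) phi)
    (branch_act (\val g) \o e) (component_act (\val g) \o h).
Proof.
set ga := branch_act (\val g).
have gaI x y : ga x = ga y -> x = y.
  by move=> E; rewrite -[x](branch_actK (\val g)) -[y](branch_actK (\val g)) -/(ga x) E.
elim: phi e h => {n m} /=.
- by move=> n m t u e h; rewrite !eval_act; split=> [->|/gaI].
- move=> n m k P invP ts e h.
  have -> : (fun i => eval (ga \o e) (tmap ga (ts i))) = ga \o (fun i => eval e (ts i)).
    by apply/funext => i; exact: eval_act.
  exact: invP.
- move=> n m s ci e h.
  have same x : (forall i, cbase (h (ci i)) = x) ->
      (rint (fun i => kappa (h (ci i))) <->
       rint (fun i => kappa (component_act (\val g) (h (ci i))))).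
    move=> hx; have [gam Ggam gamE] := set_mem (valP g) x.
    have -> : (fun i => kappa (component_act (\val g) (h (ci i)))) =
        gam \o (fun i => kappa (h (ci i))).
      by apply/funext => i; rewrite /= gamE.
    by move: Ggam; rewrite -autG => -[_]; exact.
  split=> -[[x hx] hs].
    by split; [exists (ga x) => i /=; rewrite hx|apply/(same x)].
  have hx' i : cbase (h (ci i)) = branch_act (homeo_inv (\val g)) x.
    by rewrite -(hx i) /= branch_actK.
  split; [by exists (branch_act (homeo_inv (\val g)) x)|exact/(same _ hx')].
- move=> n m i j e h; split=> [->//|E].
  by rewrite -[h i](component_actK (\val g)) -[h j](component_actK (\val g)) [X in component_act _ X]E.
- move=> n m t u i e h; split=> -[tu E].
    have tu' : \val (eval (ga \o e) (tmap ga u)) <> \val (eval (ga \o e) (tmap ga t)).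
      by rewrite !eval_act => /val_inj/gaI tu'; apply: (tu); rewrite tu'.
    exists tu'; rewrite E; move: tu'; rewrite !eval_act => tu'.
    exact: act_Phi.
  have tu' : \val (eval e u) <> \val (eval e t).
    by move=> /val_inj tu'; apply: (tu); rewrite !eval_act tu'.
  exists tu'; rewrite -[h i](component_actK (\val g)) [X in component_act _ X]E.
  rewrite -[RHS](component_actK (\val g)); congr component_act.
  move: (tu) E; rewrite !eval_act => tu2 E.
  have tu3 : \val g (\val (eval e u)) <> \val (branch_act (\val g) (eval e t)) by exact: homeo_neq.
  by rewrite (act_Phi _ tu3); congr Phi; exact: Prop_irrelevance.
- by move=> n m p IH e h; rewrite IH.
- by move=> n m p IHp q IHq e h; rewrite IHp IHq.
- move=> n m p IH e h; split=> -[x px].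
    by exists (ga x); rewrite scons_comp; exact/IH.
  exists (branch_act (homeo_inv (\val g)) x); apply/IH; rewrite -scons_comp.
  by rewrite /ga branch_actVK.
- move=> n m p IH e h; split=> -[c pc].
    by exists (component_act (\val g) c); rewrite scons_comp; exact/IH.
  exists (component_act (homeo_inv (\val g)) c); apply/IH; rewrite -scons_comp.
  by rewrite component_actVK.
Qed.

Lemma holds_at_act (g : kgroup kappa Gamma) a (phi : formula 1 0) :
  holds_at R a phi <->
  holds_at R (branch_act (\val g) a) (map_params (branch_act (\val g)) phi).
Proof.
rewrite /holds_at (sat_act g).
have -> : component_act (\val g) \o no_component = no_component.
  by apply/funext => -[].
by [].
Qed.

Lemma tmap_comp n (f f' : branch W -> branch W) (t : term n) :
  tmap f (tmap f' t) = tmap (f \o f') t.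
Proof. by elim: t => //= t1 -> t2 -> t3 ->. Qed.

Lemma map_params_comp n m (f f' : branch W -> branch W) (phi : formula n m) :
  map_params f (map_params f' phi) = map_params (f \o f') phi.
Proof.
elim: phi => {n m} //=.
- by move=> n m t u; rewrite !tmap_comp.
- move=> n m k P invP ts; congr Finv; apply/funext => i; exact: tmap_comp.
- by move=> n m t u i; rewrite !tmap_comp.
- by move=> n m p ->.
- by move=> n m p -> q ->.
- by move=> n m p ->.
- by move=> n m p ->.
Qed.

Fixpoint tparams n (t : @term W n) : seq (branch W) :=
  match t with
  | Tvar _ => [::]
  | Tpar x => [:: x]
  | TK t u v => tparams t ++ tparams u ++ tparams v
  end.

Fixpoint params n m (phi : formula n m) : seq (branch W) :=
  match phi with
  | Feq _ _ t u => tparams t ++ tparams u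
  | Finv _ _ _ _ _ ts => flatten [seq tparams (ts i) | i <- enum 'I__]
  | Frel _ _ _ _ => [::]
  | Fceq _ _ _ _ => [::]
  | Fcomp _ _ t u _ => tparams t ++ tparams u
  | Fnot _ _ p => params p
  | Fand _ _ p q => params p ++ params q
  | Fex _ _ p => params p
  | Fcex _ _ p => params p
  end.

Lemma tmap_ext n f f' (t : term n) : (forall x, x \in tparams t -> f x = f' x) ->
  tmap f t = tmap f' t.
Proof.
elim: t => //= [x fx|t IHt u IHu v IHv H]; first by rewrite fx// inE.
by rewrite IHt ?IHu ?IHv// => x h; apply: H; rewrite !mem_cat h ?orbT.
Qed.

Lemma map_params_ext n m f f' (phi : formula n m) :
  (forall x, x \in params phi -> f x = f' x) -> map_params f phi = map_params f' phi.
Proof.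
elim: phi => {n m} //=.
- by move=> n m t u H; congr Feq; apply: tmap_ext => x h; apply: H; rewrite mem_cat h ?orbT.
- move=> n m k P invP ts H; congr Finv; apply/funext => i; apply: tmap_ext => x h.
  apply: H; apply/flattenP; exists (tparams (ts i)) => //.
  by apply: map_f; rewrite mem_enum.
- by move=> n m t u i H; congr Fcomp; apply: tmap_ext => x h; apply: H; rewrite mem_cat h ?orbT.
- by move=> n m p IH /IH ->.
- by move=> n m p IHp q IHq H; congr Fand; [apply: IHp|apply: IHq] => x h; apply: H; rewrite mem_cat h ?orbT.
- by move=> n m p IH /IH ->.
- by move=> n m p IH /IH ->.
Qed.

Lemma tmap_id n (t : @term W n) : tmap id t = t.
Proof. by elim: t => //= t -> u -> v ->. Qed.

Lemma map_params_id n m (phi : formula n m) : map_params id phi = phi.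
Proof.
elim: phi => {n m} //=.
- by move=> n m t u; rewrite !tmap_id.
- by move=> n m k P invP ts; congr Finv; apply/funext => i; exact: tmap_id.
- by move=> n m t u i; rewrite !tmap_id.
- by move=> n m p ->.
- by move=> n m p -> q ->.
- by move=> n m p ->.
- by move=> n m p ->.
Qed.

Lemma map_params_fix n m f (phi : formula n m) :
  (forall x, x \in params phi -> f x = x) -> map_params f phi = phi.
Proof. by move=> H; rewrite -[RHS]map_params_id; exact: map_params_ext. Qed.

Definition fixes (F : seq (branch W)) (g : homeo W W) :=
  forall x, x \in F -> branch_act g x = x.

Lemma holds_at_fixes (g : kgroup kappa Gamma) a (phi : formula 1 0) :
  fixes (params phi) (\val g) -> holds_at R a phi -> holds_at R (branch_act (\val g) a) phi.
Proof. by move=> /map_params_fix E /(holds_at_act g); rewrite E. Qed.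

(** The invariant relation [P] consists of the translates of the tuples (a, F) with
    [a] in [A]. If (a, F) is a translate of such a tuple (a', F), then it is so by
    an element that fixes [F], and [a] is in [A] as well. *)
Lemma definable (F : seq (branch W)) (A : set (branch W)) :
  (forall g : kgroup kappa Gamma, fixes F (\val g) -> forall a, A a -> A (branch_act (\val g) a)) ->
  exists phi : formula 1 0, forall a, holds_at R a phi <-> A a.
Proof.
move=> AF.
have [[x0 _]|noX] := pselect (exists x : branch W, True); last first.
  by exists (Feq _ _ _ _ varv varv) => a; case: noX; exists a.
pose f (i : 'I_(size F)) := nth x0 F i.
pose P : set ('I_(size F).+1 -> branch W) := [set s | exists (g : kgroup kappa Gamma) a,
  A a /\ s = branch_act (\val g) \o scons a f].
have invP : Defs.invariant kappa Gamma P.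
  move=> g s; split=> -[h [a [Aa E]]].
    exists (kmul g h), a; split=> //; rewrite E; apply/funext => i /=.
    exact: val_inj.
  exists (kmul (kinv g) h), a; split=> //; apply/funext => i.
  rewrite -[LHS](branch_actK (\val g)).
  have -> : branch_act (\val g) (s i) = (branch_act (\val g) \o s) i by [].
  by rewrite E; exact: val_inj.
exists (Finv _ _ invP (scons varv (fun i => Tpar _ (f i)))) => a.
rewrite /holds_at /=.
have -> : (fun i => eval (fun=> a) (scons varv (fun i => Tpar 1 (f i)) i)) = scons a f.
  by apply/funext => i; rewrite /scons; case: unliftP.
split=> [[g [a' [Aa' E]]]|Aa]; last first.
  exists (kone kappa Gamma), a; split=> //; apply/funext => i; exact: val_inj.
have E0 i := congr1 (fun s => s i) E.
have := E0 ord0; rewrite /= /scons unlift_none => ->; apply: AF => //.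
move=> x xF; have iF : (index x F < size F)%N by rewrite index_mem.
have := E0 (lift ord0 (Ordinal iF)); rewrite /= /scons liftK /f /= nth_index//.
Qed.

End Satisfaction.

Section Types.
Context {R : realType} {W : topologicalType} {M : Type}
  (kappa : component W -> M) (Gamma : perm_group M) (MM : rel_structure M).
Local Notation formula := (formula kappa Gamma MM 1 0).
Implicit Types (phi psi : formula) (p q : set formula).
Local Notation holds := (holds_at R).

(** By maximality: adding such a [psi] to [p] keeps it finitely satisfiable. *)
Lemma type_closed p (F : set formula) psi : complete_types R p -> finite_set F ->
  F `<=` p -> (forall a, (forall phi, F phi -> holds a phi) -> holds a psi) -> p psi.
Proof.
move=> [fsp maxp] finF Fp Fpsi.
suff <- : p `|` [set psi] = p by right.
apply: maxp; last by move=> phi; left.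
move=> F' finF' F'p.
have [||a aP] := fsp ((F' `\ psi) `|` F).
- by rewrite finite_setU; split=> //; exact: finite_setD.
- by move=> phi [[/F'p[//|->] ne]|/Fp//]; exfalso; exact: ne.
exists a => phi F'phi; have [->|ne] := pselect (phi = psi).
  by apply: Fpsi => chi Fchi; apply: aP; right.
by apply: aP; left.
Qed.

Lemma type_sat p phi : complete_types R p -> p phi -> exists a, holds a phi.
Proof.
move=> [fsp _] pphi; have [|chi ->//|a aP] := fsp [set phi]; first exact: finite_set1.
by exists a; exact: aP.
Qed.

Lemma type_imp p phi psi : complete_types R p -> p phi ->
  (forall a, holds a phi -> holds a psi) -> p psi.
Proof.
move=> ctp pphi H; apply: (type_closed ctp (finite_set1 phi)); first by move=> _ ->.
by move=> a aP; apply: H; exact: aP.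
Qed.

Lemma type_and p phi psi : complete_types R p -> p phi -> p psi -> p (Fand phi psi).
Proof.
move=> ctp pphi ppsi; apply: (@type_closed p [set phi; psi]) => //.
  by move=> _ [->|->].
by move=> a aP; split; apply: aP; [left|right].
Qed.

Lemma type_dec p phi : complete_types R p -> p phi \/ p (Fnot phi).
Proof.
move=> ctp; have [fsp maxp] := ctp.
apply: contrapT => /not_orP[nphi nnphi].
have nfs : ~ finitely_satisfiable R (p `|` [set phi]).
  move=> fs; apply: nphi; rewrite -(maxp _ fs); first by right.
  by move=> chi; left.
apply: nfs => F finF Fp; apply: contrapT => na; apply: nnphi.
apply: (@type_closed p (F `\ phi)) => //; first exact: finite_setD.
  by move=> chi [/Fp[//|->] ne]; exfalso; exact: ne.
move=> a aP aphi; apply: na; exists a => chi Fchi.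
have [->//|ne] := pselect (chi = phi); exact: aP.
Qed.

Lemma type_not p phi : complete_types R p -> p (Fnot phi) -> p phi -> False.
Proof.
move=> ctp np pp; have [a [ap na]] := type_sat ctp (type_and ctp pp np).
exact: na.
Qed.

Lemma complete_type_intro p : finitely_satisfiable R p ->
  (forall phi, p phi \/ p (Fnot phi)) -> complete_types R p.
Proof.
move=> fs dec; split=> // q fsq pq; apply/seteqP; split=> // phi qphi.
have [//|np] := dec phi; exfalso.
have [|chi [->//|->]|a aP] := fsq [set phi; Fnot phi].
- exact: finite_set2.
- exact: pq.
by have := aP (Fnot phi) (or_intror erefl); apply; apply: aP; left.
Qed.

Lemma ultra_bigcap (T : Type) (U : set_system T) (I : Type) (F : set I) (f : I -> set T) :
  Filter U -> finite_set F -> (forall i, F i -> U (f i)) -> U (\bigcap_(i in F) f i).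
Proof.
move=> FU; elim/Pchoice: I => I in F f *.
move=> /finite_fsetP[D ->] H; exact: filter_bigI.
Qed.

Lemma ultra_type (U : set_system (branch W)) : UltraFilter U ->
  complete_types R [set phi : formula | U [set a | holds a phi]].
Proof.
move=> UU; have PU := @ultra_proper _ U UU.
apply: complete_type_intro.
- move=> F finF FU; have : U (\bigcap_(phi in F) [set a | holds a phi]).
    exact: ultra_bigcap.
  by move=> /filter_ex[a aP]; exists a => phi; exact: aP.
- move=> phi; exact: (in_ultra_setVsetC [set a | holds a phi]).
Qed.

Lemma type_ext p q : complete_types R p -> complete_types R q -> p `<=` q -> q = p.
Proof. by move=> [_ maxp] [fsq _]; exact: maxp. Qed.

End Types.

(** * The Stone space of the non-betweenness types *)
Section StoneSpace.
Context {R : realType} {W : topologicalType} {M : Type}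
  (kappa : component W -> M) (Gamma : perm_group M) (MM : rel_structure M).
Hypothesis dW : dendrite R W.
Hypothesis autG : automorphisms MM = Gamma.
Local Notation formula := (formula kappa Gamma MM 1 0).
Local Notation S := (nonbetween_types R kappa Gamma MM).
Local Notation G := (kgroup kappa Gamma).
Local Notation holds := (holds_at R).
Implicit Types (phi psi : formula) (p q : S) (g : G) (x y a : branch W).

Definition contains p : set formula := type_contains (\val p).

Lemma containsP p : complete_types R (contains p).
Proof. exact: (set_mem (valP (\val p))). Qed.

Lemma contains_nonbetween p x y :
  contains p (Fnot (FB kappa Gamma MM 0 (Tpar 1 x) varv (Tpar 1 y))).
Proof. exact: (set_mem (valP p)). Qed.

Lemma contains_inj p q : contains p `<=` contains q -> p = q.
Proof.
move=> pq; apply/val_inj/val_inj; apply/esym.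
exact: (type_ext (containsP p) (containsP q) pq).
Qed.

Lemma mk_type (s : set formula) : complete_types R s ->
  (forall x y, s (Fnot (FB kappa Gamma MM 0 (Tpar 1 x) varv (Tpar 1 y)))) ->
  exists p, contains p = s.
Proof.
move=> cs ns; pose s1 : S1 R kappa Gamma MM := SigSub (mem_set cs).
have s1P : S s1 by move=> x y; exact: ns.
by exists (SigSub (mem_set s1P)).
Qed.

Definition Ftrue : formula := Feq kappa Gamma MM 0 varv varv.

Lemma contains_true p : contains p Ftrue.
Proof.
have [//|H] := type_dec Ftrue (containsP p).
by have [a na] := type_sat (containsP p) H; case: na.
Qed.

Lemma open_contains phi : open [set p | contains p phi].
Proof.
exists [set q : S1 R kappa Gamma MM | type_contains q phi] => //.
exists [set [set q : S1 R kappa Gamma MM | type_contains q phi]].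
  move=> _ ->; exists (finmap.fset1 [set q : S1 R kappa Gamma MM | type_contains q phi]).
    by move=> C; rewrite finmap.in_fset1 inE => /eqP ->; exists phi.
  by rewrite set_fset1 bigcap_set1.
by rewrite bigcup_set1.
Qed.

Lemma nbhs_contains p (U : set S) : nbhs p U ->
  exists2 phi, contains p phi & forall q, contains q phi -> U q.
Proof.
rewrite nbhsE => -[_ [[B [D DP <-] <-] [A DA Ap]] HU].
have [l lP lA] := DP A DA; rewrite -lA in Ap.
suff [phi pphi H] : exists2 phi, contains p phi &
    forall q, contains q phi -> forall C, C \in finmap.enum_fset l -> C (\val q).
  exists phi => // q qphi; apply: HU; exists A => //.
  have Aq : A (\val q) by rewrite -lA => C Cl; exact: (H q qphi C Cl).
  exact: Aq.
have lP' C : C \in finmap.enum_fset l -> exists phi, C = [set q | type_contains q phi].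
  by move=> /lP; rewrite inE => -[phi _ <-]; exists phi.
have lp C : C \in finmap.enum_fset l -> C (\val p) by move=> Cl; exact: Ap.
elim: (finmap.enum_fset l) lP' lp => [|C s IH] sP sp.
  by exists Ftrue => //; exact: contains_true.
have [||phi pphi H] := IH.
- by move=> C' C's; apply: sP; rewrite inE C's orbT.
- by move=> C' C's; apply: sp; rewrite inE C's orbT.
have [psi psiE] := sP C (mem_head _ _).
have ppsi : contains p psi by have := sp C (mem_head _ _); rewrite psiE.
exists (Fand phi psi); first exact: (type_and (containsP p)).
move=> q qand C'; rewrite inE => /orP[/eqP ->|C's].
  rewrite psiE /=; apply: (type_imp (containsP q) qand) => a []//.
apply: H C's; apply: (type_imp (containsP q) qand) => a []//.
Qed.

(** An ultrafilter of types converges to the type of the formulas that almost all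
    of them contain. *)
Lemma types_compact : compact [set: S].
Proof.
rewrite compact_ultra => F UF _.
have PF := @ultra_proper _ F UF.
pose s := [set phi | F [set q | contains q phi]].
have cs : complete_types R s.
  apply: complete_type_intro.
  - move=> D finD Ds; have : F (\bigcap_(phi in D) [set q | contains q phi]).
      exact: ultra_bigcap.
    move=> /filter_ex[q qP]; have [fsq _] := containsP q.
    by apply: fsq => // phi /qP.
  - move=> phi; have [h|h] := in_ultra_setVsetC [set q | contains q phi] UF; first by left.
    right; apply: filterS h => q /= nq.
    by have [] := type_dec phi (containsP q).
have [p pE] : exists p, contains p = s.
  apply: mk_type => // x y; apply: filterS (filterT) => q _.
  exact: contains_nonbetween.
exists p; split=> // U /nbhs_contains[phi pphi H].
by apply: filterS H _; rewrite pE in pphi.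
Qed.

Lemma types_hausdorff : hausdorff_space S.
Proof.
move=> p q pq; apply: contains_inj => phi pphi.
have [//|nq] := type_dec phi (containsP q).
have np : nbhs p [set p | contains p phi].
  by apply: open_nbhs_nbhs; split=> //; exact: open_contains.
have nq' : nbhs q [set p | contains p (Fnot phi)].
  by apply: open_nbhs_nbhs; split=> //; exact: open_contains.
have [t [t1 t2]] := pq _ _ np nq'.
by have := type_not (containsP t) t2 t1.
Qed.

Lemma act_exists g p : exists q, contains q =
  [set phi | contains p (map_params (branch_act (\val (kinv g))) phi)].
Proof.
apply: mk_type; last by move=> x y; exact: contains_nonbetween.
apply: complete_type_intro.
- move=> F finF Fp; have [fsp _] := containsP p.
  have [||a aP] := fsp (map_params (branch_act (\val (kinv g))) @` F).
  + exact: finite_image.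
  + by move=> _ [phi /Fp pphi <-].
  exists (branch_act (\val g) a) => phi Fphi.
  apply/(holds_at_act dW autG (kinv g)); rewrite branch_actK.
  by apply: aP; exists phi.
- by move=> phi; exact: type_dec (containsP p).
Qed.

Definition types_act g p : S := projT1 (cid (act_exists g p)).

Lemma types_actE g p phi : contains (types_act g p) phi <->
  contains p (map_params (branch_act (\val (kinv g))) phi).
Proof. by rewrite /types_act; case: cid => q /= ->. Qed.

Lemma types_act1 p : types_act (kone kappa Gamma) p = p.
Proof.
apply: contains_inj => phi /types_actE.
by rewrite map_params_fix// => x _; exact: val_inj.
Qed.

Lemma types_actM g h p : types_act (kmul g h) p = types_act g (types_act h p).
Proof.
apply: contains_inj => phi /types_actE H; apply/types_actE/types_actE.
rewrite map_params_comp; move: H; congr (contains p _).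
by apply: map_params_ext => x _; exact: val_inj.
Qed.

End StoneSpace.

(** * The topology of the kaleidoscopic group *)
Section GroupTopology.
Context {R : realType} {W : topologicalType} {M : Type}
  (kappa : component W -> M) (Gamma : perm_group M).
Hypothesis dW : dendrite R W.
Hypothesis dX : dense (@branch_points W).
Local Notation G := (kgroup kappa Gamma).
Implicit Types (g h : G) (x y a b : branch W).

Lemma kgroup_open (K O : set W) : compact K -> open O ->
  open [set g : G | (\val g : W -> W) @` K `<=` O].
Proof.
move=> cK oO.
exists [set g : homeo W W | (g : W -> W) @` K `<=` O] => //.
by exists ([set f | f @` K `<=` O] : set {compact-open, W -> W}) => //; exact: compact_open_open.
Qed.

Lemma kgroup_open1 (w : W) (O : set W) : open O -> open [set g : G | O (kact g w)].
Proof.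
move=> oO; have := kgroup_open (@compact_set1 _ w) oO.
congr open; apply/seteqP; split=> g /=.
  by move=> H; apply: H; exists w.
by move=> gw _ [_ -> <-].
Qed.

(** The branch point [x] is the center of three points, and remains the center when
    these move a little, each on its side. *)
Lemma orbit_map_open (g0 : G) x :
  nbhs g0 [set g | branch_act (\val g) x = branch_act (\val g0) x].
Proof.
have [a [b [c [[ax bx cx] [ab bc ac]]]]] := branch_three_sides (set_mem (valP x)).
pose y := kact g0 (\val x).
have near w : w <> \val x -> nbhs g0 [set g | side y (kact g0 w) (kact g w)].
  move=> wx; apply: open_nbhs_nbhs; split.
    apply: (kgroup_open1 w (side_open dW y (kact g0 w))).
  by apply: side_refl; exact: homeo_neq.
apply: filterS (filterI (near a ax) (filterI (near b bx) (near c cx))).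
move=> g [/= ga [gb gc]]; apply: val_inj => /=.
have tr u v : btw u (\val x) v -> side y (kact g0 u) (kact g u) ->
    side y (kact g0 v) (kact g v) -> btw (kact g u) y (kact g v).
  move=> uv gu gv h; have := btw_act (g := \val g0) uv; apply.
  exact: side_trans gu (side_trans h (side_sym gv)).
have E : \val g (\val x) = y; last by rewrite E.
apply: (center_unique dW (x := kact g a) (y := kact g b) (z := kact g c));
  by [exact: btw_act|exact: tr].
Qed.

Lemma agree_nbhs (g0 : G) (F : seq (branch W)) :
  nbhs g0 [set g | forall x, x \in F -> branch_act (\val g) x = branch_act (\val g0) x].
Proof.
elim: F => [|x F IH]; first by apply: filterS filterT.
apply: filterS (filterI (orbit_map_open g0 x) IH) => g [gx gF] y.
by rewrite inE => /orP[/eqP ->|/gF].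
Qed.

Lemma fixes_cat F F' (g : homeo W W) : fixes (F ++ F') g -> fixes F g /\ fixes F' g.
Proof. by move=> H; split=> x xF; apply: H; rewrite mem_cat xF ?orbT. Qed.

Lemma val_branch_act_eq (g g' : homeo W W) x : branch_act g x = branch_act g' x ->
  g (\val x) = g' (\val x).
Proof. by move=> /(congr1 (fun t : branch W => \val t)). Qed.

Lemma fixes_val F (g : homeo W W) x : fixes F g -> x \in F -> g (\val x) = \val x.
Proof. by move=> gF xF; have /(congr1 (fun t : branch W => \val t)) := gF x xF. Qed.

Lemma fixes_side F (g : homeo W W) x y : fixes F g -> x \in F -> y \in F ->
  \val y <> \val x -> g @` side (\val x) (\val y) = side (\val x) (\val y).
Proof.
move=> gF xF yF yx; rewrite homeo_side//.
by rewrite (fixes_val gF xF) (fixes_val gF yF).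
Qed.

Lemma fixes_inv F (g : homeo W W) : fixes F g -> fixes F (homeo_inv g).
Proof. by move=> gF x xF; rewrite -{1}(gF x xF) branch_actK. Qed.

(** A point [u] outside [O] is separated from [w] by a branch point [x]. A
    homeomorphism that fixes [x] and some [y] on the side of [u] preserves that
    side, so it maps no point near [w] into it. *)
Lemma small_neighbourhood (O : set W) (w : W) : open O -> O w ->
  exists (F : seq (branch W)) (N : set W), nbhs w N /\
    forall (g : homeo W W) u, fixes F g -> N u -> O (g u).
Proof.
move=> oO Ow; have [_ cW _ _ _] := dW.
have cL : compact (~` O).
  by apply: subclosed_compact cW _ => //; exact: open_closedC.
pose Q (S : set W) := exists (F : seq (branch W)) (N : set W), nbhs w N /\
    forall (g : homeo W W) u, fixes F g -> N u -> ~ (S `&` ~` O) (g u).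
have [|A B [F [N [nN H]]] [F' [N' [nN' H']]]|A B AB [F [N [nN H]]]|u nOu|F [N [nN H]]] :=
  @compact_induction W (~` O) Q cL.
- by exists [::], setT; split; [exact: filterT|move=> g u _ _ []].
- exists (F ++ F'), (N `&` N'); split; first exact: filterI.
  move=> g u /fixes_cat[gF gF'] [Nu N'u] [[Au|Bu] nO]; first exact: (H g u).
  exact: (H' g u).
- by exists F, N; split=> // g u gF Nu [/AB Bu nO]; exact: (H g u).
- have uw : u <> w by move=> E; apply: nOu; rewrite E.
  have [x [xu xw uxw]] := branch_between dW dX uw.
  have [y uy] : exists y, side (\val x) u (\val y).
    apply: (branch_in_open dX); first exact: (side_open dW).
    by exists u; apply: side_refl; exact: nesym.
  exists (side (\val x) u).
    by apply: open_nbhs_nbhs; split; [exact: (side_open dW)|apply: side_refl; exact: nesym].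
  exists [:: x; y], (~` (side (\val x) u `|` [set \val x])); split.
    apply: open_nbhs_nbhs; split; first exact/closed_openC/(side_closedU dW).
    by move=> [/uxw//|E]; exact: xw.
  move=> g v gF nv [ugv _]; apply: nv; left.
  rewrite (side_eq uy) in ugv *.
  rewrite -(fixes_side gF) in ugv; rewrite ?inE ?eqxx ?orbT//.
    by case: ugv => v' h /(can_inj (@hfunK _ _ g)) <-.
  exact: side_neqr uy.
exists F, N; split=> // g u gF Nu; apply: contrapT => nO.
exact: (H g u gF Nu).
Qed.

(** Together with [agree_nbhs] this shows that the compact-open topology of the
    group is that of pointwise convergence on the discrete set X. *)
Lemma nbhs_one (N : set G) : nbhs (kone kappa Gamma) N ->
  exists F : seq (branch W), forall g, fixes F (\val g) -> N g.
Proof.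
pose Fil : set_system {compact-open, W -> W} := [set S | exists F : seq (branch W),
  forall g : homeo W W, fixes F g -> S g].
have FF : Filter Fil.
  split.
  - by exists [::].
  - move=> A B [F HF] [F' HF']; exists (F ++ F') => g /fixes_cat[gF gF'].
    by split; [exact: HF|exact: HF'].
  - by move=> A B AB [F HF]; exists F => g /HF /AB.
have cvF : nbhs (id : {compact-open, W -> W}) `<=` Fil.
  apply/(@compact_open_cvgP _ _ Fil) => K O cK oO KO.
  pose Q (S : set W) := exists F : seq (branch W), forall (g : homeo W W),
    fixes F g -> forall w, S w -> K w -> O (g w).
  have [|A B [F HF] [F' HF']|A B AB [F HF]|w Kw|F HF] := @compact_induction W K Q cK.
  - by exists [::].
  - exists (F ++ F') => g /fixes_cat[gF gF'] w [Aw|Bw]; first exact: HF.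
    exact: HF'.
  - by exists F => g gF w /AB; exact: HF.
  - have Ow : O w by apply: KO; exists w.
    have [F [V [nV H]]] := small_neighbourhood oO Ow.
    by exists V => //; exists F => g gF u Vu _; exact: H.
  by exists F => g gF _ [w Kw <-]; exact: HF.
move=> [_ [[B [C oC <-] <-] C1] BN].
have [F HF] : Fil C by apply: cvF; exact: open_nbhs_nbhs.
by exists F => g gF; apply: BN; exact: HF.
Qed.

Lemma dendrite_flow : is_flow (kone kappa Gamma) kmul (@kact W M kappa Gamma).
Proof.
have [_ cW _ _ _] := dW.
split=> //; first exact: (dendrite_hausdorff dW).
move=> [g w] U; rewrite nbhsE => -[N [oN Ngw] NU] /=.
have oO : open (kact g @^-1` N).
  by apply: open_comp => // u _; exact: hfun_continuous.
have [F [V [nV H]]] := small_neighbourhood oO Ngw.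
exists ([set g' | forall x, x \in F -> branch_act (\val g') x = branch_act (\val g) x], V).
  by split=> //=; exact: agree_nbhs.
move=> [g' u] /= [g'F Vu]; apply: NU.
have fx : fixes F (homeo_comp (homeo_inv (\val g)) (\val g')).
  move=> x xF; apply: val_inj => /=.
  by rewrite (val_branch_act_eq (g'F x xF)) hfunK.
have := H _ u fx Vu; rewrite /kact /=.
by rewrite hbackK.
Qed.

End GroupTopology.

(** * The location of a type *)
Section TypeFlow.
Context {R : realType} {W : topologicalType} {M : Type}
  (kappa : component W -> M) (Gamma : perm_group M) (MM : rel_structure M).
Hypothesis dW : dendrite R W.
Hypothesis dX : dense (@branch_points W).
Hypothesis M3 : `I_3 #<= [set: M].
Hypothesis kk : kaleidoscopic kappa R.
Hypothesis tG : transitive_group Gamma.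
Hypothesis autG : automorphisms MM = Gamma.
Local Notation formula := (formula kappa Gamma MM 1 0).
Local Notation S := (nonbetween_types R kappa Gamma MM).
Local Notation G := (kgroup kappa Gamma).
Local Notation holds := (holds_at R).
Local Notation act := (types_act dW autG).
Implicit Types (phi psi : formula) (p q : S) (g : G) (x y a : branch W).

Lemma types_flow : is_flow (kone kappa Gamma) kmul act.
Proof.
split.
- exact: types_compact.
- exact: types_hausdorff.
- exact: types_act1.
- exact: types_actM.
move=> [g p] U /nbhs_contains[phi /types_actE pphi H].
pose F := [seq branch_act (homeo_inv (\val g)) x | x <- params phi].
exists ([set g' | forall x, x \in F -> branch_act (\val g') x = branch_act (\val g) x],
  [set q | contains q (map_params (branch_act (\val (kinv g))) phi)]).
  split=> /=; first exact: (agree_nbhs dW).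
  by apply: open_nbhs_nbhs; split=> //; exact: open_contains.
move=> [g' q] /= [g'F qphi]; apply: H; apply/types_actE.
suff -> : map_params (branch_act (\val (kinv g'))) phi =
  map_params (branch_act (\val (kinv g))) phi by [].
apply: map_params_ext => x xphi /=.
have /g'F E : branch_act (homeo_inv (\val g)) x \in F by exact: map_f.
by rewrite -{1}[x](branch_actVK (\val g)) -E branch_actK.
Qed.

(** The formula Phi(x, v) = Phi(x, y), in the form used by [same_direction]. *)
Definition Fside x y : formula :=
  Fand (Fnot (Feq _ _ _ 0 varv (Tpar 1 x)))
       (Fnot (FB _ _ _ 0 varv (Tpar 1 x) (Tpar 1 y))).

Lemma holds_side a x y : holds a (Fside x y) <-> side (\val x) (\val a) (\val y).
Proof.
rewrite /holds_at /=; split=> [[ax nb]|h].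
  by apply: contrapT => h; apply: nb; exact/(KfunE dW).
split=> [E|/(KfunE dW)]; last by apply.
by apply: (side_neql h); rewrite E.
Qed.

Lemma holds_btw a x y : holds a (FB kappa Gamma MM 0 (Tpar 1 x) varv (Tpar 1 y)) <->
  btw (\val x) (\val a) (\val y).
Proof. exact: (KfunE dW). Qed.

Definition located p (z : W) := forall x, \val x <> z -> same_direction (\val p) x z.

Lemma located_side p z x y : located p z -> side (\val x) z (\val y) ->
  contains p (Fside x y).
Proof.
move=> pz zy; have [y' zy' py'] := pz x (nesym (side_neql zy)).
apply: (type_imp (containsP p) py') => a /holds_side h; apply/holds_side.
exact: side_trans h (side_trans (side_sym zy') zy).
Qed.

Lemma side_has_branch (u v : W) : v <> u -> exists y, side u v (\val y).
Proof.
move=> vu; apply: (branch_in_open dX); first exact: (side_open dW).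
by exists v; exact: side_refl.
Qed.

Lemma located_intro p z :
  (forall x y, side (\val x) z (\val y) -> contains p (Fside x y)) -> located p z.
Proof.
move=> H x xz; have [y zy] := side_has_branch (nesym xz).
by exists y => //; exact: H.
Qed.

(** A branch point between [z] and [z'] would see a realization of [p] in the
    directions of both. *)
Lemma located_unique p z z' : located p z -> located p z' -> z = z'.
Proof.
move=> pz pz'; apply: contrapT => zz'.
have [x [xz xz' h]] := branch_between dW dX zz'.
have [y zy] := side_has_branch (nesym xz).
have [y' zy'] := side_has_branch (nesym xz').
have [a [/holds_side h1 /holds_side h2]] := type_sat (containsP p)
  (type_and (containsP p) (located_side pz zy) (located_side pz' zy')).
apply: h; exact: side_trans zy (side_trans (side_sym h1) (side_trans h2 (side_sym zy'))).
Qed.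

(** A common point of the closures of the sets defined by formulas of [p]. *)
Lemma located_exists p : exists z, located p z.
Proof.
pose F := [set D : set W | exists2 phi, contains p phi & forall a, holds a phi -> D (\val a)].
have FF : ProperFilter F.
  split.
    by move=> [phi pphi H]; have [a /H] := type_sat (containsP p) pphi.
  split.
  - by exists (Ftrue kappa Gamma MM) => //; exact: contains_true.
  - move=> A B [phi pphi HA] [psi ppsi HB]; exists (Fand phi psi).
      exact: (type_and (containsP p)).
    by move=> a [/HA Aa /HB Ba].
  - by move=> A B AB [phi pphi H]; exists phi => // a /H /AB.
have [_ cW _ _ _] := dW.
have [z [_ clz]] := cW F FF filterT.
exists z; apply: located_intro => x y zy.
have [//|np] := type_dec (Fside x y) (containsP p).
have [||w [nw zw]] := clz (~` side (\val x) z) (side (\val x) z).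
- exists (Fnot (Fside x y)) => // a na h; apply: na; apply/holds_side.
  exact: side_trans (side_sym h) zy.
- by apply: open_nbhs_nbhs; split; [exact: (side_open dW)|exact: (side_refl (side_neql zy))].
by case: nw.
Qed.

Definition location p : W := projT1 (cid (located_exists p)).

Lemma locationP p : located p (location p).
Proof. by rewrite /location; case: cid. Qed.
Arguments locationP : clear implicits.

Lemma location_eq p z : location p = z <-> located p z.
Proof.
by split=> [<-|pz]; [exact: locationP|exact: (located_unique (locationP p) pz)].
Qed.

Lemma type_finite p (l : seq formula) : (forall phi, List.In phi l -> contains p phi) ->
  exists a, forall phi, List.In phi l -> holds a phi.
Proof.
move=> H; suff [chi pchi chiP] : exists2 chi, contains p chi &
    forall a, holds a chi -> forall phi, List.In phi l -> holds a phi.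
  by have [a /chiP ah] := type_sat (containsP p) pchi; exists a.
elim: l H => [|phi l IH] H.
  by exists (Ftrue kappa Gamma MM) => //; exact: contains_true.
have [|chi pchi chiP] := IH; first by move=> psi psil; apply: H; right.
exists (Fand phi chi); first by apply: (type_and (containsP p)) => //; apply: H; left.
by move=> a [aphi achi] psi [<-//|]; exact: chiP.
Qed.

(** The point [a] realizes [phi] and is on no arc between parameters; [r] is its
    projection to the subtree that they span. No parameter lies on the side of [a]
    at [r], so homogeneity carries [phi] to all branch points of that side. *)
Lemma contains_half p phi : contains p phi -> exists r a : branch W,
  side (\val r) (\val a) (\val a) /\
  forall b : branch W, side (\val r) (\val a) (\val b) -> holds b phi.
Proof.
move=> pphi; have [a0 _] := type_sat (containsP p) pphi.
(* The point [a0] makes the list of parameters nonempty. *)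
pose F := a0 :: params phi.
pose nb := List.map (fun xy : branch W * branch W =>
  Fnot (FB kappa Gamma MM 0 (Tpar 1 xy.1) varv (Tpar 1 xy.2))) (List.list_prod F F).
have nbP psi : List.In psi nb -> contains p psi.
  by move=> /List.in_map_iff[xy [<- _]]; exact: contains_nonbetween.
have [|a aP] := @type_finite p (phi :: nb); first by move=> psi [<-//|]; exact: nbP.
have nbtw f f' : List.In f F -> List.In f' F -> ~ btw (\val f) (\val a) (\val f').
  move=> fF f'F h; have := aP (Fnot (FB kappa Gamma MM 0 (Tpar 1 f) varv (Tpar 1 f'))).
  case; last exact/holds_btw.
  right; apply/List.in_map_iff; exists (f, f'); split=> //.
  exact: List.in_prod.
have [r [ra _ rF]] := projection_exists dW nbtw.
have raW : \val a <> \val r by move=> /val_inj /esym.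
exists r, a; split; first exact: side_refl.
move=> b rab; have [g Kg [gab gout]] := homogeneous dW dX M3 kk tG rab.
pose gK : G := SigSub (mem_set Kg).
have -> : b = branch_act (\val gK) a by apply: val_inj; rewrite /= gab.
apply: (holds_at_fixes dW autG); last by apply: aP; left.
move=> x xphi; apply: val_inj => /=; apply: gout => h.
apply: (rF x); last exact: side_sym.
by right; elim: (params phi) xphi => //= y s IH; rewrite inE => /orP[/eqP->|/IH]; [left|right].
Qed.

Lemma location_continuous : continuous location.
Proof.
move=> p U; rewrite nbhsE => -[N [oN Np] NU].
have [_ cW _ _ _] := dW.
have cK : compact (~` N).
  by apply: subclosed_compact cW _ => //; exact: open_closedC.
pose Q (D : set W) := exists2 phi, contains p phi &
  forall q, contains q phi -> ~ (D `&` ~` N) (location q).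
have [|A B [phi pphi HA] [psi ppsi HB]|A B AB [phi pphi H]|u nNu|phi pphi H] :=
  @compact_induction W (~` N) Q cK.
- by exists (Ftrue kappa Gamma MM); [exact: contains_true|move=> q _ []].
- exists (Fand phi psi); first exact: (type_and (containsP p)).
  move=> q qand [[Aq|Bq] nN].
    by apply: (HA q) => //; apply: (type_imp (containsP q) qand) => a [].
  by apply: (HB q) => //; apply: (type_imp (containsP q) qand) => a [].
- by exists phi => // q /H nq [/AB Bq nN]; apply: nq.
- have pu : location p <> u by move=> E; apply: nNu; rewrite -E.
  have [x [xp xu pxu]] := branch_between dW dX pu.
  have [y py] := side_has_branch (nesym xp).
  exists (side (\val x) u).
    by apply: open_nbhs_nbhs; split; [exact: (side_open dW)|apply: side_refl; exact: nesym].
  exists (Fside x y); first exact: (located_side (locationP p) py).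
  move=> q qxy [uq _].
  have [y' qy'] := side_has_branch (side_neqr uq).
  have [a [/holds_side h1 /holds_side h2]] := type_sat (containsP q)
    (type_and (containsP q) qxy (located_side (locationP q) qy')).
  apply: pxu; apply: side_trans py (side_trans (side_sym h1) (side_trans h2 _)).
  exact: side_trans (side_sym qy') (side_sym uq).
have : nbhs p [set q | contains q phi].
  by apply: open_nbhs_nbhs; split=> //; exact: open_contains.
apply: filterS => q /H nq; apply: NU; apply: contrapT => nN; exact: nq.
Qed.

Lemma location_act g p : location (act g p) = kact g (location p).
Proof.
apply/location_eq/located_intro => x y h; apply/types_actE => /=.
set gi := branch_act _.
apply: (@located_side p (location p) (gi x) (gi y)); first exact: (locationP p).
have := h; rewrite -(hbackK (\val g) (\val x)) -homeo_side.
  by move=> [v hv vy]; rewrite /gi /= -vy hfunK.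
by move=> E; apply: (side_neql h); rewrite /kact E hbackK.
Qed.

(** An ultrafilter that contains the neighbourhoods of [z] and the complements of
    all arcs gives a type located at [z]; such sets meet by [open_avoids_arcs]. *)
Lemma location_surjective z : exists p, location p = z.
Proof.
pose F := [set A : set (branch W) | exists (V : set W) (l : seq (W * W)), nbhs z V /\
  forall a, V (\val a) -> (forall xy, List.In xy l -> ~ btw xy.1 (\val a) xy.2) -> A a].
have FF : ProperFilter F.
  split.
    move=> [V [l [nV H]]]; move: nV; rewrite nbhsE => -[N [oN Nz] NV].
    have [x [Nx xl]] := open_avoids_arcs dW dX l oN (ex_intro _ z Nz).
    by apply: (H x) => //; exact: NV.
  split.
  - by exists setT, [::]; split=> //; exact: filterT.
  - move=> A B [V [l [nV H]]] [V' [l' [nV' H']]].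
    exists (V `&` V'), (l ++ l'); split; first exact: filterI.
    move=> a [Va V'a] al; split.
      by apply: H => // xy xyl; apply: al; apply: List.in_or_app; left.
    by apply: H' => // xy xyl; apply: al; apply: List.in_or_app; right.
  - by move=> A B AB [V [l [nV H]]]; exists V, l; split=> // a Va al; apply/AB/H.
have [U [UU FU]] := ultraFilterLemma FF.
have [p pE] : exists p, contains p = [set phi | U [set a | holds a phi]].
  apply: mk_type; first exact: ultra_type.
  move=> x y; apply: FU; exists setT, [:: (\val x, \val y)]; split; first exact: filterT.
  by move=> a _ H /holds_btw h; apply: (H (\val x, \val y)) => //; left.
exists p; apply/location_eq/located_intro => x y zy; rewrite pE /=; apply: FU.
exists (side (\val x) z), [::]; split.
  by apply: open_nbhs_nbhs; split; [exact: (side_open dW)|exact: (side_refl (side_neql zy))].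
by move=> a za _; apply/holds_side; exact: side_trans (side_sym za) zy.
Qed.

Lemma location_fiber (r a : branch W) phi : side (\val r) (\val a) (\val a) ->
  (forall b : branch W, side (\val r) (\val a) (\val b) -> holds b phi) ->
  forall q, location q = \val a -> contains q phi.
Proof.
move=> raa H q /location_eq qa.
apply: (type_imp (containsP q) (located_side qa raa)) => b /holds_side h.
by apply: H; exact: side_sym.
Qed.

(** All types located at a branch point of the half-space given by [contains_half]
    contain [phi]. *)
Lemma location_irreducible (U : set S) : open U -> U !=set0 ->
  exists z, location @^-1` [set z] `<=` U.
Proof.
move=> oU [p Up]; have [phi pphi HU] := nbhs_contains (open_nbhs_nbhs (conj oU Up)).
have [r [a [raa H]]] := contains_half pphi.
by exists (\val a) => q qa; apply: HU; exact: location_fiber H q qa.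
Qed.

Lemma location_hp : hp_extension (kone kappa Gamma) kmul act kact location.
Proof.
split; [exact: types_flow|exact: (dendrite_flow _ _ dW dX)|].
split; last exact: location_irreducible.
by split; [exact: location_continuous|exact: location_surjective|exact: location_act].
Qed.

End TypeFlow.

(** * Universality *)
Section Universality.
Context {R : realType} {W : topologicalType} {M : Type}
  (kappa : component W -> M) (Gamma : perm_group M) (MM : rel_structure M).
Hypothesis dW : dendrite R W.
Hypothesis dX : dense (@branch_points W).
Hypothesis M3 : `I_3 #<= [set: M].
Hypothesis kk : kaleidoscopic kappa R.
Hypothesis tG : transitive_group Gamma.
Hypothesis autG : automorphisms MM = Gamma.
Local Notation formula := (formula kappa Gamma MM 1 0).
Local Notation S := (nonbetween_types R kappa Gamma MM).
Local Notation G := (kgroup kappa Gamma).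
Local Notation holds := (holds_at R).
Local Notation act := (types_act dW autG).
Local Notation location := (location dW dX).
Implicit Types (phi psi : formula) (p q : S) (g : G) (x a : branch W).

Definition realizations phi : set W := [set w | exists2 a, \val a = w & holds a phi].

(** An open set that represents [phi] in [W]; it is not empty for a formula of a
    type by [contains_half]. *)
Definition dense_part phi : set W := (closure (realizations phi))°.

Lemma dense_part_open phi : open (dense_part phi).
Proof. exact: open_interior. Qed.

Lemma dense_partS phi psi : (forall a, holds a phi -> holds a psi) ->
  dense_part phi `<=` dense_part psi.
Proof.
move=> H; apply: interiorS; apply: closureS => _ [a <- /H ha]; by exists a.
Qed.

Lemma dense_part_nonempty p phi : contains p phi -> dense_part phi !=set0.
Proof.
move=> pphi; have [r [a [raa H]]] := contains_half dW dX M3 kk tG autG pphi.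
exists (\val a); apply: filterS (open_nbhs_nbhs (conj (side_open dW _ _) raa)) => w raw B nB.
have : nbhs w (B `&` side (\val r) (\val a)).
  by apply: filterI => //; apply: open_nbhs_nbhs; split=> //; exact: (side_open dW).
rewrite nbhsE => -[N [oN Nw] NB].
have [b Nb] := branch_in_open dX oN (ex_intro _ w Nw).
have [Bb rab] := NB _ Nb.
by exists (\val b); split=> //; exists b => //; exact: H.
Qed.

Lemma closure_act g phi w :
  closure (realizations (map_params (branch_act (\val (kinv g))) phi)) w ->
  closure (realizations phi) (kact g w).
Proof.
move=> clw B nB; have nB' : nbhs w (kact g @^-1` B) by exact: hfun_continuous.
have [_ [[a <- ha] Ba]] := clw _ nB'.
exists (kact g (\val a)); split=> //; exists (branch_act (\val g) a) => //.
by apply/(holds_at_act dW autG (kinv g)); rewrite branch_actK.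
Qed.

Lemma dense_part_act g phi w :
  dense_part (map_params (branch_act (\val (kinv g))) phi) w ->
  dense_part phi (kact g w).
Proof.
move=> nw; have : nbhs (kact g w) (hback (\val g) @^-1`
    closure (realizations (map_params (branch_act (\val (kinv g))) phi))).
  by apply: hback_continuous; rewrite /kact hfunK.
apply: filterS => v /closure_act; by rewrite /kact hbackK.
Qed.

Section Extension.
Variables (Y : topologicalType) (actY : G -> Y -> Y) (rho : Y -> W).
Hypothesis extY : hp_extension (kone kappa Gamma) kmul actY kact rho.

Let cY : compact [set: Y]. Proof. by case: extY => -[]. Qed.
Let hY : hausdorff_space Y. Proof. by case: extY => -[]. Qed.
Let act1 y : actY (kone kappa Gamma) y = y. Proof. by case: extY => -[]. Qed.
Let actM g h y : actY (kmul g h) y = actY g (actY h y).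
Proof. by case: extY => -[]. Qed.
Let cact : continuous (fun gy : G * Y => actY gy.1 gy.2).
Proof. by case: extY => -[]. Qed.
Let crho : continuous rho. Proof. by case: extY => _ _ [[]]. Qed.
Let srho w : exists y, rho y = w. Proof. by case: extY => _ _ [[]]. Qed.
Let erho g y : rho (actY g y) = kact g (rho y). Proof. by case: extY => _ _ [[]]. Qed.
Let irr (U : set Y) : open U -> U !=set0 -> exists z, rho @^-1` [set z] `<=` U.
Proof. by case: extY => _ _ [_]; apply. Qed.

Lemma homeo_ext (g g' : homeo W W) : (forall w, g w = g' w) ->
  (forall w, hback g w = hback g' w) -> g = g'.
Proof.
case: g g' => f b fK bK cf cb [f' b' fK' bK' cf' cb'] /= /funext E /funext E'.
by subst f' b'; congr Homeo; exact: Prop_irrelevance.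
Qed.

Lemma kmulV g : kmul (kinv g) g = kone kappa Gamma :> G.
Proof. by apply/val_inj/homeo_ext => w /=; rewrite hfunK. Qed.

Lemma actKV g y : actY (kinv g) (actY g y) = y.
Proof. by rewrite -actM kmulV act1. Qed.

Lemma act_continuous g : continuous (actY g).
Proof.
move=> y U yU; have [[N V] /= [nN nV] NVU] := @cact (g, y) U yU.
apply: filterS nV => z Vz; apply: (NVU (g, z)); split=> //=.
exact: nbhs_singleton nN.
Qed.

(** The map [rho] is closed, as [Y] is compact. *)
Lemma fiber_core_open (O : set Y) : open O -> open [set w | rho @^-1` [set w] `<=` O].
Proof.
move=> oO; have -> : [set w | rho @^-1` [set w] `<=` O] = ~` (rho @` ~` O).
  apply/seteqP; split=> w /= H.
    by move=> [y nOy yw]; apply: nOy; exact: H.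
  by move=> y yw; apply: contrapT => nOy; apply: H; exists y.
apply: closed_openC; apply: compact_closed; first exact: (dendrite_hausdorff dW).
apply: continuous_compact; first exact: continuous_subspaceT.
by apply: subclosed_compact cY _ => //; exact: open_closedC.
Qed.

(** The set G_F V. *)
Definition saturation (F : seq (branch W)) (V : set Y) : set Y :=
  [set z | exists g, fixes F (\val g) /\ V (actY g z)].

Lemma saturation_open F V : open V -> open (saturation F V).
Proof.
move=> oV; have -> : saturation F V = \bigcup_(g in [set g | fixes F (\val g)]) (actY g @^-1` V).
  by apply/seteqP; split=> z; [move=> [g [gF Vz]]; exists g|move=> [g gF Vz]; exists g].
apply: bigcup_open => g _; apply: open_comp => // z _; exact: act_continuous.
Qed.

Lemma saturation_act F V g z : fixes F (\val g) -> saturation F V (actY g z) ->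
  saturation F V z.
Proof.
move=> gF [h [hF Vz]]; exists (kmul h g); split; last by rewrite actM.
move=> x xF; rewrite -{2}(hF x xF) -{2}(gF x xF); exact: val_inj.
Qed.

(** The lift of a type will be the common point of the sets [cloud phi], for its
    formulas [phi]. *)
Definition cloud phi : set Y := closure (rho @^-1` dense_part phi).

Lemma cloudS phi psi : (forall a, holds a phi -> holds a psi) -> cloud phi `<=` cloud psi.
Proof. by move=> H; apply: closureS => y; exact: dense_partS. Qed.

Lemma rho_cloud phi y : cloud phi y -> closure (realizations phi) (rho y).
Proof.
move=> cy B; rewrite nbhsE => -[N [oN Ny] NB].
have [z [/= dz Nz]] := cy _ (crho (open_nbhs_nbhs (conj oN Ny))).
have [w [h1 h2]] := interior_subset dz _ (open_nbhs_nbhs (conj oN Nz)).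
by exists w; split=> //; exact: NB.
Qed.

Definition lift_point p (y : Y) := forall phi, contains p phi -> cloud phi y.

(** The open sets [dense_part phi] are not empty and decrease under conjunction. *)
Lemma lift_point_exists p : exists y, lift_point p y.
Proof.
pose Fil := [set D : set Y | exists2 phi, contains p phi & rho @^-1` dense_part phi `<=` D].
have FF : ProperFilter Fil.
  split.
    move=> [phi pphi H]; have [w dw] := dense_part_nonempty pphi.
    by have [y yw] := srho w; apply: (H y); rewrite /= yw.
  split.
  - by exists (Ftrue kappa Gamma MM) => //; exact: contains_true.
  - move=> A B [phi pphi HA] [psi ppsi HB]; exists (Fand phi psi).
      exact: (type_and (containsP p)).
    by move=> y dy; split; [apply: HA|apply: HB]; apply: dense_partS dy => a [].
  - by move=> A B AB [phi pphi H]; exists phi => // y /H /AB.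
have [y [_ cly]] := @cY Fil FF filterT.
by exists y => phi pphi B nB; apply: cly => //; exists phi.
Qed.

(** The set of the branch points whose fiber lies in G_F V is G_F-invariant. If its
    complement belonged to [p], irreducibility would give a fiber that lies in [V]
    and over the dense part of the complement. Fibers of nearby points lie in G_F V
    too, but nearby there are branch points of the complement. *)
Lemma saturated_formula p y F V : lift_point p y -> open V -> V y ->
  exists2 phi, contains p phi &
    forall a, holds a phi -> rho @^-1` [set \val a] `<=` saturation F V.
Proof.
move=> py oV Vy.
have [|phi phiP] := @definable R W M kappa Gamma MM F
  [set a | rho @^-1` [set \val a] `<=` saturation F V].
  move=> g gF a Aa z za; apply: (@saturation_act F V (kinv g)).
    exact: fixes_inv.
  by apply: Aa; rewrite /= erho za /kact /= hfunK.
exists phi; last by move=> a /phiP.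
have [//|np] := type_dec phi (containsP p); exfalso.
have oU : open (V `&` rho @^-1` dense_part (Fnot phi)).
  by apply: openI => //; apply: open_comp (dense_part_open _) => z _; exact: crho.
have [|z zU] := irr oU.
  have [z [dz Vz]] := py _ np _ (open_nbhs_nbhs (conj oV Vy)).
  by exists z.
have [y0 y0z] := srho z; have [Vy0 dy0] := zU _ y0z.
have oD := fiber_core_open (saturation_open F oV).
have Dz : [set w | rho @^-1` [set w] `<=` saturation F V] z.
  move=> u uz; exists (kone kappa Gamma); split; first by move=> x _; exact: val_inj.
  by rewrite act1; have [] := zU u uz.
rewrite /= y0z in dy0.
have [_ [[a <- na] Da]] := interior_subset dy0 _ (open_nbhs_nbhs (conj oD Dz)).
by apply: na; exact/phiP.
Qed.

(** Continuity of the action at the pair of the unit and [y]. *)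
Lemma local_invariance y (O : set Y) : open O -> O y -> exists F V,
  [/\ open V, V y & saturation F V `<=` O].
Proof.
move=> oO Oy; have Oy' : O (actY (kone kappa Gamma) y) by rewrite act1.
have [[N V] /= [nN nV] NVO] := @cact (kone kappa Gamma, y) _ (open_nbhs_nbhs (conj oO Oy')).
have [F FN] := nbhs_one dW dX nN.
move: nV; rewrite nbhsE => -[V' [oV' V'y] V'V].
exists F, V'; split=> // z [g [gF Vz]].
have := NVO (kinv g, actY g z); rewrite /= actKV; apply; split=> /=; last exact: V'V.
by apply: FN; exact: fixes_inv.
Qed.

(** Two points have disjoint neighbourhoods of the form G_F V; the formulas given
    by [saturated_formula] have a common realization in [p], and its fiber would
    lie in both. *)
Lemma lift_point_unique p y y' : lift_point p y -> lift_point p y' -> y = y'.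
Proof.
move=> py py'; apply: contrapT => yy'.
have [P [Q [Py Qy' oP oQ PQ]]] : exists P Q : set Y,
    [/\ P y, Q y', open P, open Q & P `&` Q = set0].
  move: hY; rewrite open_hausdorff => /(_ y y'); move/eqP: yy' => yy' /(_ yy')[[A B]].
  by move=> /= [/set_mem h1 /set_mem h2] [h3 h4 /eqP h5]; exists A, B.
have [F [V [oV Vy VO]]] := local_invariance oP Py.
have [F' [V' [oV' V'y' V'O']]] := local_invariance oQ Qy'.
have [phi pphi phiP] := saturated_formula F py oV Vy.
have [psi ppsi psiP] := saturated_formula F' py' oV' V'y'.
have [a [aphi apsi]] := type_sat (containsP p) (type_and (containsP p) pphi ppsi).
have [z za] := srho (\val a).
have : (P `&` Q) z by split; [apply/VO/(phiP a)|apply/V'O'/(psiP a)].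
by rewrite PQ.
Qed.

Definition lift p : Y := projT1 (cid (lift_point_exists p)).

Lemma liftP p : lift_point p (lift p).
Proof. by rewrite /lift; case: cid. Qed.
Arguments liftP : clear implicits.

(** A branch point between the two values would have [rho (lift p)] in the closure
    of the side of the location. *)
Lemma rho_lift : rho \o lift = location.
Proof.
apply/funext => p /=; apply: contrapT => ne.
have [x [xr xl h]] := branch_between dW dX (nesym ne).
have [y ly] := side_has_branch dW dX (nesym xr).
have lp : located p (location p) by apply/location_eq.
have /(liftP p) /rho_cloud clr := located_side dW lp ly.
have : closure (side (\val x) (location p)) (rho (lift p)).
  apply: closureS clr => _ [a <- /(holds_side kappa Gamma MM dW) ha].
  exact: side_trans ly (side_sym ha).
by move=> /(closure_sideE dW) [|/esym].
Qed.

Lemma lift_continuous : continuous lift.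
Proof.
move=> p U; rewrite nbhsE => -[N [oN Np] NU].
have cK : compact (~` N).
  by apply: subclosed_compact cY _ => //; exact: open_closedC.
pose Q (D : set Y) := exists2 phi, contains p phi &
  forall y, D y -> ~ N y -> ~ cloud phi y.
have [|A B [phi pphi HA] [psi ppsi HB]|A B AB [phi pphi H]|y nNy|phi pphi H] :=
  @compact_induction Y (~` N) Q cK.
- by exists (Ftrue kappa Gamma MM) => //; exact: contains_true.
- exists (Fand phi psi); first exact: (type_and (containsP p)).
  move=> y [Ay|By] nO cl.
    by apply: (HA y) => //; apply: cloudS cl => a [].
  by apply: (HB y) => //; apply: cloudS cl => a [].
- by exists phi => // y /AB; exact: H.
- have [phi pphi ncl] : exists2 phi, contains p phi & ~ cloud phi y.
    apply: contrapT => H; apply: nNy.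
    have -> : y = lift p; last by [].
    apply: (lift_point_unique (p := p)); last exact: (liftP p).
    by move=> phi pphi; apply: contrapT => ncl; apply: H; exists phi.
  exists (~` cloud phi); last by exists phi => // z.
  by apply: open_nbhs_nbhs; split=> //; apply: closed_openC; exact: closed_closure.
have : nbhs p [set q | contains q phi].
  by apply: open_nbhs_nbhs; split=> //; exact: open_contains.
apply: filterS => q qphi; apply: NU; apply: contrapT => nNq.
exact: (H _ nNq nNq (liftP q phi qphi)).
Qed.

Lemma lift_act g p : lift (act g p) = actY g (lift p).
Proof.
apply: (lift_point_unique (p := act g p)); first exact: (liftP (act g p)).
move=> phi /types_actE /(liftP p) clp B nB.
have [z [/= dz Bz]] := clp _ (act_continuous nB).
exists (actY g z); split=> //=; rewrite erho; exact: dense_part_act.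
Qed.

Lemma lift_surjective y : exists p, lift p = y.
Proof.
apply: contrapT => ny.
have cim : compact (lift @` [set: S]).
  apply: continuous_compact; last exact: types_compact.
  by apply: continuous_subspaceT; exact: lift_continuous.
have oC : open (~` (lift @` [set: S])).
  by apply: closed_openC; exact: compact_closed hY cim.
have [|z zC] := irr oC.
  by exists y => -[p _ py]; apply: ny; exists p.
have [p pz] := location_surjective kappa Gamma MM dW dX z.
by apply: (zC (lift p)); [rewrite /= -pz -rho_lift|exists p].
Qed.

Lemma lift_hp : highly_proximal act actY lift.
Proof.
split; first by split; [exact: lift_continuous|exact: lift_surjective|exact: lift_act].
move=> U oU U0; have [z zU] := location_irreducible dW dX M3 kk tG autG oU U0.
have [y yz] := srho z; exists y => p py; apply: zU.
by rewrite /= -rho_lift /= py.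
Qed.

End Extension.

Theorem location_universal :
  universal_hp_extension (kone kappa Gamma) kmul act kact location.
Proof.
split; first exact: location_hp.
move=> Y actY rho extY; exists (lift extY); first exact: lift_hp.
exact: rho_lift.
Qed.

End Universality.

Theorem theorem7p1 (R : realType) (W : topologicalType) (M : Type)
    (Gamma : perm_group M) (MM : rel_structure M) (kappa : component W -> M) :
  countable [set: M] ->
  `I_3 #<= [set: M] ->
  transitive_group Gamma ->
  ultrahomogeneous MM ->
  automorphisms MM = Gamma ->
  wazewski R W M ->
  kaleidoscopic kappa R ->
  exists (act : kgroup kappa Gamma ->
            nonbetween_types R kappa Gamma MM ->
            nonbetween_types R kappa Gamma MM)
         (pi : nonbetween_types R kappa Gamma MM -> W),
    [/\ forall g p phi,
          type_contains (\val (act g p)) phi <->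
          type_contains (\val p) (map_params (branch_act (\val (kinv g))) phi),
        forall p zeta,
          pi p = zeta <->
          forall x : branch W, \val x <> zeta ->
            same_direction (\val p) x zeta &
        universal_hp_extension (kone kappa Gamma) kmul act kact pi].
Proof.
move=> _ M3 tG _ autG [dW _ dX] kk.
exists (types_act dW autG), (location dW dX); split.
- by move=> g p phi; exact: types_actE.
- by move=> p zeta; exact: location_eq.
- exact: location_universal.
Qed.
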